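(* Let $\tau\in\mathbb C$ with $\mathrm{Im}(\tau)>0$, let $E_\tau=\mathbb C/(\mathbb Z+\tau\mathbb Z)$, and fix the global holomorphic differential form $\omega=dz$ on $E_\tau$. The solution of the classical Yang--Baxter equation obtained from the universal family of stable vector bundles of rank two and degree one on the complex torus $E_\tau$ is $$\bar r(y)=\frac12\left(\frac{\mathrm{cn}(y)}{\mathrm{sn}(y)}\,h\otimes h+\frac1{\mathrm{sn}(y)}\,\gamma\otimes\gamma+\frac{\mathrm{dn}(y)}{\mathrm{sn}(y)}\,\sigma\otimes\sigma\right).$$
   Context: Matrices: $h=\begin{pmatrix}1&0\\ 0&-1\end{pmatrix}$, $\sigma=\begin{pmatrix}0&-i\\ i&0\end{pmatrix}$, $\gamma=\begin{pmatrix}0&1\\ 1&0\end{pmatrix}$. Theta functions, with $q=\exp(\pi i\tau)$: $\theta_1(z|\tau)=2q^{1/4}\sum_{n\ge0}(-1)^nq^{n(n+1)}\sin((2n+1)\pi z)$, $\theta_2(z|\tau)=2q^{1/4}\sum_{n\ge0}q^{n(n+1)}\cos((2n+1)\pi z)$, $\theta_3(z|\tau)=1+2\sum_{n\ge1}q^{n^2}\cos(2\pi nz)$, $\theta_4(z|\tau)=1+2\sum_{n\ge1}(-1)^nq^{n^2}\cos(2\pi nz)$. Put $$\mathrm{cn}(z)=\frac{\theta_4(0|\tau)\theta_2(z|\tau)}{\theta_2(0|\tau)\theta_4(z|\tau)},\quad\mathrm{sn}(z)=\frac{\theta_3(0|\tau)\theta_1(z|\tau)}{\theta_2(0|\tau)\theta_4(z|\tau)},\quad\mathrm{dn}(z)=\frac{\theta_4(0|\tau)\theta_3(z|\tau)}{\theta_3(0|\tau)\theta_4(z|\tau)}.$$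 Geometric $r$-matrix: for $x\in\mathbb C$ let $\mathcal P^x$ be the stable bundle of rank two and degree one on $E_\tau$ given by the quotient of $\mathbb C\times\mathbb C^2$ by $(z,w)\sim(z+1,w)\sim(z+\tau,\Phi_x(z)w)$, $\Phi_x(z)=e^{-\pi ix}\begin{pmatrix}0&1\\ e^{-2\pi i(z+\tau)}&0\end{pmatrix}$, with its induced local trivializations. Let $\omega=dz$. For non-isomorphic $\mathcal P^{x_1},\mathcal P^{x_2}$ and distinct points $y_1,y_2$ (for which the maps below are defined), let $\mathrm{res}_{y_1}:\mathrm{Hom}(\mathcal P^{x_1},\mathcal P^{x_2}(y_1))\to\mathrm{Hom}_{\mathbb C}(\mathcal P^{x_1}|_{y_1},\mathcal P^{x_2}|_{y_1})$ be the map sending $F$ to the residue of $F\omega$ at $y_1$ (an isomorphism), and let $\mathrm{ev}_{y_2}:\mathrm{Hom}(\mathcal P^{x_1},\mathcal P^{x_2}(y_1))\to\mathrm{Hom}_{\mathbb C}(\mathcal P^{x_1}|_{y_2},\mathcal P^{x_2}|_{y_2})$ be evaluation of $F$ at $y_2$; the linear map $\tilde r=\mathrm{ev}_{y_2}\circ\mathrm{res}_{y_1}^{-1}$ corresponds via the trivializations to the tensor $r=\sum_\nu a_\nu\otimes b_\nu\in\mathrm{Mat}_{2\times2}(\mathbb C)^{\otimes2}$ with $\tilde r(A)=\sum_\nu\mathrm{tr}(a_\nu A)b_\nu$. After the gauge transformation $r\mapsto(\phi(y_1)\otimes\phi(y_2))\,r\,(\phi(y_1)^{-1}\otimes\phi(y_2)^{-1})$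 with $\phi(y)=\mathrm{diag}\bigl(e^{-\pi iy},e^{\pi i\tau/2}\bigr)$ this tensor is a function $r(x;y)$ of $x=x_2-x_1$ and $y=y_2-y_1$ only. The solution of the classical Yang--Baxter equation obtained from the family is $\bar r(y)=\lim_{x\to0}(\mathrm{pr}\otimes\mathrm{pr})\,r(x;y)$, where $\mathrm{pr}(A)=A-\frac{\mathrm{tr}(A)}2\mathbb 1$ is the projection $\mathrm{Mat}_{2\times2}(\mathbb C)\to\mathfrak{sl}_2(\mathbb C)$. The classical Yang--Baxter equation is $[r^{12}(x),r^{13}(x+y)]+[r^{13}(x+y),r^{23}(y)]+[r^{12}(x),r^{23}(y)]=0$, where the upper indices indicate the tensor factors of the triple tensor product in which the two components of $r$ are placed.
   Formalization: With ω = dz and the given sn, the printed formula is off by a constant: as y → 0 the solution is (1/2y)(h⊗h+γ⊗γ+σ⊗σ) but sn'(0) = πθ₃(0|τ)². The formal statement multiplies the right-hand side by πθ₃(0|τ)²; at zeros of θ₄(y) the formula is read as a limit. *)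

(* Defs.v *)
From HB Require Import structures.
From mathcomp Require Import all_boot all_order all_algebra.
From mathcomp Require Import all_classical all_reals all_analysis.
From mathcomp Require Export complex mxtens.
Import Order.TTheory GRing.Theory Num.Theory.
Import numFieldNormedType.Exports.

Set Implicit Arguments.
Unset Strict Implicit.
Unset Printing Implicit Defensive.

Local Open Scope classical_set_scope.
Local Open Scope ring_scope.
Local Open Scope complex_scope.

(* R[i] carries no topology of its own; viewed as a numClosedFieldType it
   inherits the one given by the modulus. *)
Definition Cx (R : realType) : numClosedFieldType := R[i].

Section complex_functions.
Variable R : realType.
Notation C := (Cx R).

Definition expC (z : C) : C :=
  (expR (complex.Re z) * cos (complex.Im z)) +i*
  (expR (complex.Re z) * sin (complex.Im z)).

Definition iC : C := 'i%C.
Definition piC : C := (pi : R)%:C.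

Definition cosC (z : C) : C := (expC (iC * z) + expC (- (iC * z))) / 2.
Definition sinC (z : C) : C := (expC (iC * z) - expC (- (iC * z))) / (2 * iC).

Definition sumC (u : nat -> C) : C := limn (series u).

Definition nome (tau : C) : C := expC (piC * iC * tau).

(* q^(1/4) means exp(pi i tau / 4). *)
Definition nome4 (tau : C) : C := expC (piC * iC * tau / 4).

Definition theta1 (tau z : C) : C :=
  2 * nome4 tau *
  sumC (fun n => (-1) ^+ n * nome tau ^+ (n * n.+1)%N *
                 sinC (((2 * n).+1)%N%:R * piC * z)).

Definition theta2 (tau z : C) : C :=
  2 * nome4 tau *
  sumC (fun n => nome tau ^+ (n * n.+1)%N * cosC (((2 * n).+1)%N%:R * piC * z)).

(* The sums of theta3 and theta4 start at 1, hence the shifted index. *)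
Definition theta3 (tau z : C) : C :=
  1 + 2 * sumC (fun n => nome tau ^+ (n.+1 ^ 2)%N * cosC (2 * piC * n.+1%:R * z)).

Definition theta4 (tau z : C) : C :=
  1 + 2 * sumC (fun n => (-1) ^+ n.+1 * nome tau ^+ (n.+1 ^ 2)%N *
                         cosC (2 * piC * n.+1%:R * z)).

Definition cn (tau z : C) : C :=
  (theta4 tau 0 * theta2 tau z) / (theta2 tau 0 * theta4 tau z).
Definition sn (tau z : C) : C :=
  (theta3 tau 0 * theta1 tau z) / (theta2 tau 0 * theta4 tau z).
Definition dn (tau z : C) : C :=
  (theta4 tau 0 * theta3 tau z) / (theta3 tau 0 * theta4 tau z).

Definition lattice (tau : C) : set C :=
  [set z | exists m n : int, z = m%:~R + n%:~R * tau].

End complex_functions.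

(* Mat_2 (x) Mat_2 is identified with Mat_4 by the Kronecker product *t. *)
Section tensors.
Variable R : realType.
Notation C := (Cx R).

Definition mx2 (a b c d : C) : 'M[C]_2 :=
  \matrix_(i, j) if i == 0 then (if j == 0 then a else b)
                 else (if j == 0 then c else d).

Definition h_mx : 'M[C]_2 := mx2 1 0 0 (-1).
Definition sigma_mx : 'M[C]_2 := mx2 0 (- iC R) (iC R) 0.
Definition gamma_mx : 'M[C]_2 := mx2 0 1 1 0.

(* The linear map Mat_2 (x) Mat_2 -> V with a (x) b |-> f a b, for f bilinear. *)
Definition tensor_lift (V : lmodType C) (f : 'M[C]_2 -> 'M[C]_2 -> V)
    (t : 'M[C]_(2 * 2)) : V :=
  \sum_(i < 2) \sum_(j < 2) \sum_(k < 2) \sum_(l < 2)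
    t (mxtens_index (i, k)) (mxtens_index (j, l)) *:
      f (delta_mx i j) (delta_mx k l).

Definition contract (t : 'M[C]_(2 * 2)) (A : 'M[C]_2) : 'M[C]_2 :=
  tensor_lift (fun a b => \tr (a *m A) *: b) t.

(* For linear f, the tensor t with contract t = f; see contractK. *)
Definition tensor_of (f : 'M[C]_2 -> 'M[C]_2) : 'M[C]_(2 * 2) :=
  \sum_(i < 2) \sum_(j < 2) delta_mx j i *t f (delta_mx i j).

Lemma contractK (f : {linear 'M[C]_2 -> 'M[C]_2}) (A : 'M[C]_2) :
  contract (tensor_of f) A = f A.
Proof.
have lift_lin : forall i j, f (delta_mx i j) =
    \sum_(k < 2) \sum_(l < 2) f (delta_mx i j) k l *: delta_mx k l.
  by move=> i j; rewrite {1}[f _]matrix_sum_delta.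
rewrite [A in RHS]matrix_sum_delta linear_sum /=.
under [RHS]eq_bigr => p _.
  rewrite linear_sum /=.
  under eq_bigr => q _ do rewrite linearZ /= lift_lin.
  over.
rewrite /contract /tensor_lift /tensor_of.
rewrite exchange_big /=; apply: eq_bigr => p _; apply: eq_bigr => q _.
rewrite scaler_sumr; apply: eq_bigr => k _.
rewrite scaler_sumr; apply: eq_bigr => l _.
rewrite !scalerA; congr (_ *: _).
have -> : \tr (delta_mx q p *m A) = A p q.
  rewrite /mxtrace (bigD1 q) //= big1 ?addr0.
    rewrite mxE (bigD1 p) //= big1 ?addr0.
      by rewrite mxE !eqxx mul1r.
    by move=> i /negPf ni; rewrite mxE ni andbF mul0r.
  move=> i /negPf ni; rewrite mxE big1 // => j _.
  by rewrite mxE ni mul0r.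
rewrite mulrC; congr (_ * _).
rewrite summxE (bigD1 p) //= [X in _ + X]big1 ?addr0.
  rewrite summxE (bigD1 q) //= [X in _ + X]big1 ?addr0.
    by rewrite tensmxE mxE !eqxx mul1r.
  by move=> i /negPf ni; rewrite tensmxE mxE eq_sym ni mul0r.
move=> i /negPf ni; rewrite summxE big1 // => j _.
by rewrite tensmxE mxE (eq_sym p) ni andbF mul0r.
Qed.

Definition pr_sl2 (A : 'M[C]_2) : 'M[C]_2 := A - (\tr A / 2)%:M.

Definition pr_tensor (t : 'M[C]_(2 * 2)) : 'M[C]_(2 * 2) :=
  tensor_lift (fun a b => pr_sl2 a *t pr_sl2 b) t.

Definition leg12 (t : 'M[C]_(2 * 2)) : 'M[C]_(2 * 2 * 2) :=
  tensor_lift (fun a b => a *t b *t (1%:M : 'M[C]_2)) t.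
Definition leg13 (t : 'M[C]_(2 * 2)) : 'M[C]_(2 * 2 * 2) :=
  tensor_lift (fun a b => a *t (1%:M : 'M[C]_2) *t b) t.
Definition leg23 (t : 'M[C]_(2 * 2)) : 'M[C]_(2 * 2 * 2) :=
  tensor_lift (fun a b => (1%:M : 'M[C]_2) *t a *t b) t.

Definition bracket (n : nat) (A B : 'M[C]_n) : 'M[C]_n := A *m B - B *m A.

(* The equation is imposed where all three arguments avoid D, the set of
   points at which r is not defined. *)
Definition classical_YB (D : set C) (r : C -> 'M[C]_(2 * 2)) : Prop :=
  forall x y : C, ~ D x -> ~ D y -> ~ D (x + y) ->
    bracket (leg12 (r x)) (leg13 (r (x + y))) +
    bracket (leg13 (r (x + y))) (leg23 (r y)) +
    bracket (leg12 (r x)) (leg23 (r y)) = 0.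

End tensors.

Section geometry.
Variable R : realType.
Notation C := (Cx R).
Variable tau : C.

(* P^x is the quotient of C x C^2 by
   (z, w) ~ (z + 1, w) ~ (z + tau, Phi x z *m w). *)
Definition Phi (x z : C) : 'M[C]_2 :=
  expC (- (piC R * iC R * x)) *:
    mx2 0 1 (expC (- (2 * piC R * iC R * (z + tau)))) 0.

Definition equivariant (x1 x2 : C) (F : C -> 'M[C]_2) : Prop :=
  forall z, F (z + 1) = F z /\ F (z + tau) *m Phi x1 z = Phi x2 z *m F z.

Definition holomorphic_at (F : C -> 'M[C]_2) (z : C) : Prop :=
  \forall w \near z, forall i j, derivable (fun u => F u i j) w 1.

Definition at_most_simple_pole (F : C -> 'M[C]_2) (p : C) : Prop :=
  exists2 G : C -> 'M[C]_2, holomorphic_at G p &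
    \forall w \near p^', F w = (w - p)^-1 *: G w.

Definition isomorphic_bundles (x1 x2 : C) : Prop :=
  exists F : C -> 'M[C]_2,
    [/\ equivariant x1 x2 F, forall z, holomorphic_at F z
      & forall z, F z \in unitmx].

(* Hom(P^x1, P^x2(p)), as matrix functions on the universal cover.  Such a
   function is meaningless at the points over p; it is set to 0 there so that
   a section is represented by exactly one function. *)
Definition hom_pole (x1 x2 p : C) : set (C -> 'M[C]_2) :=
  [set F | [/\ equivariant x1 x2 F,
    forall z, ~ lattice tau (z - p) -> holomorphic_at F z
    & forall z, lattice tau (z - p) -> at_most_simple_pole F z /\ F z = 0]].

(* The residue of F dz at p, for F with at most a simple pole at p. *)
Definition residue (p : C) (F : C -> 'M[C]_2) : 'M[C]_2 :=
  lim ((z - p) *: F z @[z --> p^']).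

Definition r_tilde (x1 x2 y1 y2 : C) (A : 'M[C]_2) : 'M[C]_2 :=
  xget (fun=> 0) [set F | hom_pole x1 x2 y1 F /\ residue y1 F = A] y2.

Definition gauge_mx (y : C) : 'M[C]_2 :=
  mx2 (expC (- (piC R * iC R * y))) 0 0 (expC (piC R * iC R * tau / 2)).

Definition r_gauged (x1 x2 y1 y2 : C) : 'M[C]_(2 * 2) :=
  (gauge_mx y1 *t gauge_mx y2) *m tensor_of (r_tilde x1 x2 y1 y2) *m
  (invmx (gauge_mx y1) *t invmx (gauge_mx y2)).

Definition r_matrix (x y : C) : 'M[C]_(2 * 2) := r_gauged 0 x 0 y.

Definition r_bar (y : C) : 'M[C]_(2 * 2) :=
  lim (pr_tensor (r_matrix x y) @[x --> 0^']).

(* By totality of division, this is the meromorphic function so denoted only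
   where theta4 tau y != 0, i.e. away from the poles of cn, sn and dn.
   Its residue at 0 is (2 sn'(0))^-1 times the sum of the three tensors, with
   sn'(0) = theta3(0) theta1'(0) / (theta2(0) theta4(0)) = pi theta3(0)^2,
   whereas the residue of r_bar for the form dz is 2^-1 times that sum. *)
Definition elliptic_r (y : C) : 'M[C]_(2 * 2) :=
  2^-1 *: ((cn tau y / sn tau y) *: (h_mx R *t h_mx R) +
           (1 / sn tau y) *: (gamma_mx R *t gamma_mx R) +
           (dn tau y / sn tau y) *: (sigma_mx R *t sigma_mx R)).

End geometry.

(* Main.v *)
Require Import Defs.
From HB Require Import structures.
From mathcomp Require Import all_boot all_order all_algebra.
From mathcomp Require Import all_classical all_reals all_analysis.
From mathcomp Require Import ring lra zify.
Import Order.TTheory GRing.Theory Num.Theory.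
Import numFieldNormedType.Exports.

Set Implicit Arguments.
Unset Strict Implicit.
Unset Printing Implicit Defensive.

Local Open Scope classical_set_scope.
Local Open Scope ring_scope.
Local Open Scope complex_scope.

(** The bundle [P^x] is glued along [tau] by a matrix that exchanges, up to
    exponentials, the two basis vectors. The sections of
    [Hom(P^x1, P^x2(y1))] are therefore diagonalized by four combinations of
    their matrix entries, the sum and difference of the two diagonal ones and
    those of the two off-diagonal ones after an exponential twist: by
    [equivariant_componentP] each combination is a scalar function multiplied
    by -1 or 1 under [z + 1] and by [exp(- pi i x)] or its opposite under
    [z + tau], where [x = x2 - x1]. The four characters are those of the group
    of half periods, deformed by [x].

    For a nontrivial character there is, up to a scalar, exactly one such
    function with a simple pole at [y1]. Existence is given by Kronecker's
    function [kron], the quotient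
    [theta1'(0) theta1(u + z) / (theta1(u) theta1(z))] up to an exponential.
    Uniqueness is [no_section]: pairing a section without poles with the kernel
    of the inverse character, and subtracting a multiple of the logarithmic
    derivative of [theta1], produces a function without poles that is periodic
    under 1 and acquires a constant under [tau]. Its integrals over horizontal
    periods are all equal, so that the constant is 0 ([additive_period_eq0]);
    this constant is 2 pi i times the value of the section at an arbitrary
    point. The integrals are compared by Goursat's theorem, since
    differentiability is all that is known. Consequently the residue map is bijective, its inverse is
    given by the kernels ([residue_bij]), as soon as [x] is not a lattice point;
    for a lattice point some component admits an exponential without zeros, and
    the bundles are isomorphic ([lattice_isomorphic]).

    In the basis of the tensor squares of the identity and of the Pauli
    matrices, the gauged tensor has the four kernels at [y2 - y1], divided by 2,
    as its coefficients ([r_gaugedE]). The projection removes the identity,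
    whose kernel is the only one with a pole at [x = 0]; for the others the
    limit is the value at a half period ([r_barE]). These values are quotients
    of theta functions, equal to the elliptic functions of the statement up to
    the constant [pi theta3(0)^2]. The constant comes from Jacobi's formula
    [theta1'(0) = pi theta2(0) theta3(0) theta4(0)] ([theta1_deriv0]), which,
    like the position of the zeros of the theta functions ([theta1_eq0]), is
    read off from the triple product ([jacobi_triple_product]).

    Finally, by the commutation rules of the Pauli matrices the classical
    Yang-Baxter equation amounts to six identities with three terms between the
    coefficients ([pauli3_YB]). The left side of such an identity is again a
    section with a nontrivial character and no pole, hence 0 ([three_term]). *)

(** * Modulus and limits of complex functions *)

Section modulus.
Variable R : realType.
Notation C := (Cx R).
Implicit Types (z w : C) (e : R).

(** The modulus as a real number: the norm takes its values in the complex
    numbers, where the order is only partial. *)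
Definition cabs (z : C) : R := ComplexField.Normc.normc z.

Lemma normCE z : `|z| = ((cabs z)%:C : C).
Proof. by []. Qed.

Lemma cabs_ge0 z : 0 <= cabs z.
Proof. by rewrite -lecR -normCE; exact: normr_ge0. Qed.

Lemma cabs0 : cabs 0 = 0.
Proof. exact: ComplexField.Normc.normc0. Qed.

Lemma cabs1 : cabs 1 = 1.
Proof. exact: ComplexField.Normc.normc1. Qed.

Lemma cabsM z w : cabs (z * w) = cabs z * cabs w.
Proof. exact: ComplexField.Normc.normcM. Qed.

Lemma cabsD z w : cabs (z + w) <= cabs z + cabs w.
Proof. exact: le_normcD. Qed.

Lemma cabsN z : cabs (- z) = cabs z.
Proof. exact: normcN. Qed.

Lemma cabsB z w : cabs (z - w) = cabs (w - z).
Proof. by rewrite -cabsN opprB. Qed.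

Lemma cabs_subD (z w u : C) : cabs (z - w) <= cabs (z - u) + cabs (u - w).
Proof. by apply: le_trans (cabsD _ _); rewrite addrA subrK. Qed.

Lemma cabs_eq0 z : (cabs z == 0) = (z == 0).
Proof.
apply/eqP/eqP => [|->]; last exact: cabs0.
exact: ComplexField.Normc.eq0_normc.
Qed.

Lemma cabs_gt0 z : (0 < cabs z) = (z != 0).
Proof. by rewrite lt_neqAle cabs_ge0 andbT eq_sym cabs_eq0. Qed.

Lemma cabsV z : cabs z^-1 = (cabs z)^-1.
Proof. exact: ComplexField.Normc.normcV. Qed.

Lemma cabsX z n : cabs (z ^+ n) = cabs z ^+ n.
Proof. by elim: n => [|n IH]; rewrite ?expr0 ?cabs1// !exprS cabsM IH. Qed.

Lemma cabs_real e : cabs (e%:C : C) = `|e|.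
Proof. by rewrite /cabs /= expr0n /= addr0 sqrtr_sqr. Qed.

Lemma cabs_nat n : cabs (n%:R : C) = n%:R.
Proof.
by rewrite -(rmorph_nat (real_complex R)) cabs_real ger0_norm.
Qed.

Lemma le_Re_cabs z : `|complex.Re z| <= cabs z.
Proof.
by case: z => a b; rewrite /cabs /= -sqrtr_sqr; apply: ler_wsqrtr; rewrite lerDl sqr_ge0.
Qed.

Lemma le_Im_cabs z : `|complex.Im z| <= cabs z.
Proof.
by case: z => a b; rewrite /cabs /= -sqrtr_sqr; apply: ler_wsqrtr; rewrite lerDr sqr_ge0.
Qed.

Lemma cReD z w : complex.Re (z + w) = complex.Re z + complex.Re w.
Proof. by case: z w => [a b] [c d]. Qed.
Lemma cImD z w : complex.Im (z + w) = complex.Im z + complex.Im w.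
Proof. by case: z w => [a b] [c d]. Qed.
Lemma cReN z : complex.Re (- z) = - complex.Re z.
Proof. by case: z. Qed.
Lemma cImN z : complex.Im (- z) = - complex.Im z.
Proof. by case: z. Qed.
Lemma cReM z w : complex.Re (z * w) =
  complex.Re z * complex.Re w - complex.Im z * complex.Im w.
Proof. by case: z w => [a b] [c d]. Qed.
Lemma cImM z w : complex.Im (z * w) =
  complex.Re z * complex.Im w + complex.Im z * complex.Re w.
Proof. by case: z w => [a b] [c d]. Qed.

Lemma complex_ext z w : complex.Re z = complex.Re w ->
  complex.Im z = complex.Im w -> z = w.
Proof. by case: z w => [a b] [c d] /= -> ->. Qed.

Lemma cartesianE z : z = (complex.Re z)%:C + iC R * (complex.Im z)%:C.
Proof. exact: complexE. Qed.

Lemma cabs_i : cabs (iC R) = 1.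
Proof. by rewrite /cabs /= expr0n expr1n add0r sqrtr1. Qed.

Lemma cabs_le_ReIm z : cabs z <= `|complex.Re z| + `|complex.Im z|.
Proof.
rewrite {1}(cartesianE z); apply: le_trans (cabsD _ _) _.
by rewrite cabsM cabs_i mul1r !cabs_real.
Qed.

Lemma iC2 : iC R * iC R = -1.
Proof. by rewrite -expr2; exact: sqr_i. Qed.

(** A positive complex number is a positive real one, so real radii suffice. *)
Lemma nbhsCP z (A : set C) :
  nbhs z A <-> exists2 e : R, 0 < e & forall w, cabs (w - z) < e -> A w.
Proof.
split.
  rewrite -nbhs_ballE => -[[a b] /=]; rewrite ltcE /= => /andP[/eqP-> a0] H.
  exists a => // w wz; apply: H; rewrite /ball /= distrC normCE.
  by rewrite -[_ < _]/((_%:C : C) < a%:C) ltcR.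
move=> [e e0 H]; rewrite -nbhs_ballE; exists (e%:C : C) => /=.
  by rewrite ltcR.
by move=> w; rewrite /ball /= distrC normCE ltcR => /H.
Qed.

Lemma dnbhsCP z (A : set C) :
  dnbhs z A <-> exists2 e : R, 0 < e & forall w, w != z -> cabs (w - z) < e -> A w.
Proof.
split=> [/nbhsCP[e e0 H]|[e e0 H]].
  by exists e => // w wz we; exact: H.
by apply/nbhsCP; exists e => // w we wz; exact: H.
Qed.

Lemma cvgCP (T : Type) (F : set_system T) {FF : Filter F} (f : T -> C) (l : C) :
  (f @ F --> l) <-> forall e : R, 0 < e -> \forall x \near F, cabs (f x - l) < e.
Proof.
split=> [H e e0|H A /nbhsCP[e e0 eA]].
  have /H : nbhs l [set w | cabs (w - l) < e] by apply/nbhsCP; exists e.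
  by [].
by apply: filterS (H e e0) => x; exact: eA.
Qed.

Lemma cvgC_ReIm (T : Type) (F : set_system T) {FF : Filter F} (f : T -> C) (l : C) :
  (fun x => complex.Re (f x)) @ F --> complex.Re l -> (fun x => complex.Im (f x)) @ F --> complex.Im l ->
  f @ F --> l.
Proof.
move=> /cvgrPdist_lt Hr /cvgrPdist_lt Hi; apply/cvgCP => e e0.
have e2 : 0 < e / 2 by rewrite divr_gt0.
have := Hr _ e2; have := Hi _ e2; apply: filterS2 => x /= xi xr.
apply: le_lt_trans (cabs_le_ReIm _) _.
by rewrite cReD cReN cImD cImN (splitr e); apply: ltrD; rewrite distrC.
Qed.

Lemma cvg_ReIm (T : Type) (F : set_system T) {FF : Filter F} (f : T -> C) (l : C) :
  f @ F --> l ->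
  ((fun x => complex.Re (f x)) @ F --> complex.Re l) /\ ((fun x => complex.Im (f x)) @ F --> complex.Im l).
Proof.
move=> /cvgCP H; split; apply/cvgrPdist_lt => e e0;
  apply: filterS (H e e0) => x; apply: le_lt_trans.
  by rewrite distrC -cReN -cReD le_Re_cabs.
by rewrite distrC -cImN -cImD le_Im_cabs.
Qed.

Lemma cvgC_mul (T : Type) (F : set_system T) {FF : Filter F} (f g : T -> C) (l k : C) :
  f @ F --> l -> g @ F --> k -> (fun x => f x * g x) @ F --> l * k.
Proof. by move=> fl gk; exact: (@cvgM C T F FF f g l k fl gk). Qed.

Lemma cvgC_add (T : Type) (F : set_system T) {FF : Filter F} (f g : T -> C) (l k : C) :
  f @ F --> l -> g @ F --> k -> (fun x => f x + g x) @ F --> l + k.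
Proof. by move=> fl gk; exact: (@cvgD C C T F FF f g l k fl gk). Qed.

Lemma cvgC_sub (T : Type) (F : set_system T) {FF : Filter F} (f g : T -> C) (l k : C) :
  f @ F --> l -> g @ F --> k -> (fun x => f x - g x) @ F --> l - k.
Proof. by move=> fl gk; exact: (@cvgB C C T F FF f g l k fl gk). Qed.

Lemma cvgC_cst (T : Type) (F : set_system T) {FF : Filter F} (l : C) :
  (fun=> l) @ F --> l.
Proof. exact: cvg_cst. Qed.

Lemma cvgC_inv (T : Type) (F : set_system T) {FF : Filter F} (f : T -> C) (l : C) :
  l != 0 -> f @ F --> l -> (fun x => (f x)^-1) @ F --> l^-1.
Proof. by move=> l0 fl; exact: (@cvgV C T F FF f l l0 fl). Qed.

End modulus.

Arguments cabs {R} z : simpl never.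
Arguments cvgC_cst {R T F FF} l.

(** * Complex derivatives *)

Section linear_approximation.

(** Differentiability as linear approximation. Unlike a difference quotient it
    makes sense for the increment 0, as needed for compositions. *)
Lemma is_derive_approxP (K : numFieldType) (f : K -> K) (z d : K) :
  is_derive z 1 f d <->
  (forall e : K, 0 < e -> \forall h \near (0 : K),
     `|f (z + h) - f z - d * h| <= e * `|h|).
Proof.
have quotE (h : K) : h != 0 ->
    `|d - h^-1 *: (f (h *: 1 + z) - f z)| * `|h| = `|f (z + h) - f z - d * h|.
  move=> h0; rewrite -normrM -normrN; congr (`|_|).
  by rewrite scaler1 mulrBl mulrAC mulVf// mul1r opprB [h + z]addrC.
split=> [[df dv] e e0|H].
  have : h^-1 *: (f (h *: 1 + z) - f z) @[h --> 0^'] --> d.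
    by rewrite -dv; exact: df.
  move/cvgrPdist_le => /(_ e e0) /= H.
  have {}H : \forall h \near (0 : K), h != 0 -> `|d - h^-1 *: (f (h *: 1 + z) - f z)| <= e by exact: H.
  apply: filterS H => h H.
  have [->|h0] := eqVneq h 0; first by rewrite addr0 mulr0 subrr subr0 !normr0 mulr0.
  by rewrite -quotE// ler_wpM2r ?H.
have cv : h^-1 *: (f (h *: 1 + z) - f z) @[h --> 0^'] --> d.
  apply/cvgrPdist_le => e e0; rewrite /dnbhs /=.
  suff : \forall h \near (0 : K), h != 0 -> `|d - h^-1 *: (f (h *: 1 + z) - f z)| <= e by [].
  apply: filterS (H e e0) => h Hh h0.
  by rewrite -(ler_pM2r (_ : 0 < `|h|)) ?normr_gt0// quotE.
split; first by apply/cvg_ex; exists d.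
exact: cvg_lim.
Qed.

Lemma is_deriveRP (R : realType) (f : R -> R) (z d : R) :
  is_derive z 1 f d <->
  (forall e : R, 0 < e -> exists2 r : R, 0 < r & forall h : R, `|h| < r ->
     `|f (z + h) - f z - d * h| <= e * `|h|).
Proof.
split=> [/is_derive_approxP H e e0|H].
  have /nbhs_ballP[r r0 rH] := H e e0.
  by exists r => // h hr; apply: rH; rewrite /ball /= sub0r normrN.
apply/is_derive_approxP => e e0; have [r r0 rH] := H e e0.
apply/nbhs_ballP; exists r => // h; rewrite /ball /= sub0r normrN; exact: rH.
Qed.

Lemma is_deriveCP (R : realType) (f : Cx R -> Cx R) (z d : Cx R) :
  is_derive z 1 f d <->
  (forall e : R, 0 < e -> exists2 r : R, 0 < r & forall h : Cx R, cabs h < r ->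
     cabs (f (z + h) - f z - d * h) <= e * cabs h).
Proof.
have leC (a b c : Cx R) (e : R) : (`|a| <= (e%:C : Cx R) * `|b|) = (cabs a <= e * cabs b).
  by rewrite !normCE -(lecR (cabs a)) rmorphM.
split=> [/is_derive_approxP H e e0|H].
  have e0' : 0 < (e%:C : Cx R) by rewrite ltcR.
  have /nbhsCP[r r0 rH] := H _ e0'.
  by exists r => // h hr; rewrite -leC//; apply: rH; rewrite subr0.
apply/is_derive_approxP => -[e e'] /=; rewrite ltcE /= => /andP[/eqP-> e0].
have [r r0 rH] := H e e0.
by apply/nbhsCP; exists r => // h; rewrite subr0 => /rH; rewrite -leC.
Qed.

End linear_approximation.

Section complex_derivative.
Variable R : realType.
Notation C := (Cx R).
Implicit Types (f g : C -> C) (z d : C).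

Lemma scaleCE (a b : C) : a *: b = a * b.
Proof. by []. Qed.

Lemma derivableCP f z : derivable f z 1 <-> exists d, is_derive z 1 f d.
Proof.
split=> [/derivableP H|[d [//]]].
by exists ('D_1 f z).
Qed.

Lemma is_derive_ext f g z d : (forall w, f w = g w) ->
  is_derive z 1 f d -> is_derive z 1 g d.
Proof. by move=> fg; rewrite (_ : g = f)//; apply/funext => w; rewrite fg. Qed.

Lemma is_derive_near f g z d (r : R) : 0 < r ->
  (forall w, cabs (w - z) < r -> f w = g w) ->
  is_derive z 1 f d -> is_derive z 1 g d.
Proof.
move=> r0 fg /is_deriveCP H; apply/is_deriveCP => e e0.
have [s s0 Hs] := H e e0; exists (Num.min r s) => [|h]; first by rewrite lt_min r0.
rewrite lt_min => /andP[hr hs]; rewrite -!fg ?subrr ?cabs0//; first exact: Hs.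
by rewrite [z + h]addrC addrK.
Qed.

Lemma is_deriveC_add f g z d d' : is_derive z 1 f d -> is_derive z 1 g d' ->
  is_derive z 1 (fun w => f w + g w) (d + d').
Proof. by move=> Hf Hg; exact: is_deriveD. Qed.

Lemma is_deriveC_sub f g z d d' : is_derive z 1 f d -> is_derive z 1 g d' ->
  is_derive z 1 (fun w => f w - g w) (d - d').
Proof. by move=> Hf Hg; exact: is_deriveB. Qed.

Lemma is_deriveC_mul f g z d d' : is_derive z 1 f d -> is_derive z 1 g d' ->
  is_derive z 1 (fun w => f w * g w) (d * g z + f z * d').
Proof.
move=> Hf Hg; apply: (is_derive_eq (is_deriveM Hf Hg)).
by rewrite !scaleCE addrC (mulrC d).
Qed.

Lemma is_deriveC_scale (a : C) f z d : is_derive z 1 f d ->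
  is_derive z 1 (fun w => a * f w) (a * d).
Proof. by move=> Hf; exact: (is_deriveZ a Hf). Qed.

Lemma is_deriveC_cst (a z : C) : is_derive z 1 (fun=> a : C) 0.
Proof. exact: is_derive_cst. Qed.

Lemma is_deriveC_id (z : C) : is_derive z 1 (fun w => w : C) 1.
Proof. exact: is_derive_id. Qed.

Lemma is_deriveC_comp f g z d d' :
  is_derive z 1 g d -> is_derive (g z) 1 f d' ->
  is_derive z 1 (fun w => f (g w)) (d' * d).
Proof.
move=> /is_deriveCP Hg /is_deriveCP Hf; apply/is_deriveCP => e e0.
pose D := cabs d + 1; have D0 : 0 < D by rewrite ltr_wpDl// cabs_ge0.
have e1 : 0 < e / (2 * D) by rewrite divr_gt0// mulr_gt0.
have [r r0 rf] := Hf _ e1.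
pose m := Num.min 1 (e / (2 * (cabs d' + 1))).
have dd0 : 0 < cabs d' + 1 by rewrite ltr_wpDl// cabs_ge0.
have m0 : 0 < m by rewrite lt_min ltr01 divr_gt0// mulr_gt0.
have [s s0 sg] := Hg _ m0.
exists (Num.min s (r / D)); first by rewrite lt_min s0 divr_gt0.
move=> h; rewrite lt_min => /andP[hs hr].
have Hgh := sg h hs.
set k := g (z + h) - g z in Hgh.
have kD : cabs k <= D * cabs h.
  rewrite -(subrK (d * h) k); apply: le_trans (cabsD _ _) _.
  rewrite cabsM /D mulrDl mul1r addrC; rewrite lerD2l.
  by apply: le_trans Hgh _; rewrite ler_piMl ?cabs_ge0// ge_min lexx.
have kr : cabs k < r.
  by apply: le_lt_trans kD _; rewrite mulrC -ltr_pdivlMr.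
have := rf k kr; rewrite /k (addrC (g z)) subrK -/k => Hfk.
have -> : f (g (z + h)) - f (g z) - d' * d * h =
   (f (g (z + h)) - f (g z) - d' * k) + d' * (k - d * h) by ring.
apply: le_trans (cabsD _ _) _; rewrite (splitr e) mulrDl.
apply: lerD.
  apply: le_trans Hfk _.
  have -> : e / 2 * cabs h = e / (2 * D) * (D * cabs h) by field; exact: lt0r_neq0.
  by rewrite ler_pM2l.
rewrite cabsM; apply: le_trans (ler_wpM2l (cabs_ge0 _) Hgh) _.
rewrite mulrA; apply: ler_wpM2r; first exact: cabs_ge0.
apply: (@le_trans _ _ ((cabs d' + 1) * m)).
  by rewrite ler_wpM2r ?lerDl// ltW.
rewrite -ler_pdivlMl// /m.
have -> : (cabs d' + 1)^-1 * (e / 2) = e / (2 * (cabs d' + 1)) by field; exact: lt0r_neq0.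
by rewrite ge_min lexx orbT.
Qed.

Lemma is_derive_affine (a b z : C) : is_derive z 1 (fun w => a * w + b) a.
Proof.
have := is_deriveC_add (is_deriveC_scale a (is_deriveC_id z)) (is_deriveC_cst b z).
by rewrite mulr1 addr0.
Qed.

Lemma is_derive_shiftC f (a z d : C) : is_derive (z + a) 1 f d ->
  is_derive z 1 (fun w => f (w + a)) d.
Proof.
have H : is_derive z 1 (fun w => w + a) 1.
  have := is_deriveC_add (is_deriveC_id z) (is_deriveC_cst a z).
  by rewrite addr0.
by move=> /(is_deriveC_comp H); rewrite mulr1.
Qed.

Lemma is_derive_continuous f z d : is_derive z 1 f d -> f @ z --> f z.
Proof.
move=> [df _]; apply: differentiable_continuous.
exact/derivable1_diffP.
Qed.

Lemma is_derive_unique f z d d' : is_derive z 1 f d -> is_derive z 1 f d' -> d = d'.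
Proof. by move=> [_ <-] [_ <-]. Qed.

(** Real and imaginary parts along a segment are ordinary real functions, so
    real one-variable calculus applies to them. *)
Lemma is_derive_segment f (p d g : C) (t : R) : is_derive (p + t%:C * d) 1 f g ->
  is_derive t 1 (fun s : R => complex.Re (f (p + s%:C * d))) (complex.Re (g * d)) /\
  is_derive t 1 (fun s : R => complex.Im (f (p + s%:C * d))) (complex.Im (g * d)).
Proof.
move=> /is_deriveCP H.
have key (e : R) : 0 < e -> exists2 r : R, 0 < r & forall h : R, `|h| < r ->
   cabs (f (p + (t + h)%:C * d) - f (p + t%:C * d) - h%:C * (g * d)) <= e * `|h|.
  move=> e0; have D0 : 0 < cabs d + 1 by rewrite ltr_wpDl// cabs_ge0.
  have [r r0 Hr] := H (e / (cabs d + 1)) (divr_gt0 e0 D0).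
  exists (r / (cabs d + 1)) => [|h hr]; first exact: divr_gt0.
  have hd : cabs (h%:C * d) <= `|h| * (cabs d + 1).
    by rewrite cabsM cabs_real ler_wpM2l// lerDl.
  have := Hr (h%:C * d); rewrite ltr_pdivlMr// in hr.
  have -> : p + (t + h)%:C * d = p + t%:C * d + h%:C * d by rewrite rmorphD /=; ring.
  rewrite (_ : g * (h%:C * d) = h%:C * (g * d)); last by ring.
  have hr' : cabs (h%:C * d) < r.
    exact: le_lt_trans hd hr.
  move=> /(_ hr') => /le_trans; apply.
  rewrite -mulrA ler_pM2l// mulrC ler_pdivrMr//.
have ReC (a : R) (w : C) : complex.Re (a%:C * w) = a * complex.Re w.
  by case: w => x y /=; rewrite mul0r subr0.
have ImC (a : R) (w : C) : complex.Im (a%:C * w) = a * complex.Im w.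
  by case: w => x y /=; rewrite mul0r addr0.
split; apply/is_deriveRP => e e0; have [r r0 Hr] := key e e0; exists r => // h hr;
  apply: le_trans (Hr h hr).
  by rewrite (mulrC (complex.Re _) h) -ReC -!cReN -!cReD le_Re_cabs.
by rewrite (mulrC (complex.Im _) h) -ImC -!cImN -!cImD le_Im_cabs.
Qed.

Lemma real_mean_value (phi psi : R -> R) (M : R) :
  (forall t : R, 0 <= t <= 1 -> is_derive t 1 phi (psi t)) ->
  (forall t : R, 0 <= t <= 1 -> `|psi t| <= M) -> `|phi 1 - phi 0| <= M.
Proof.
move=> Hd HM; have cont : {within `[(0:R), 1], continuous phi}.
  apply: derivable_within_continuous => t; rewrite in_itv /= => Ht.
  by have [] := Hd t Ht.
have [//|c] := @MVT R phi psi 0 1 ltr01 _ cont.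
  by move=> t; rewrite in_itv /= => /andP[/ltW a /ltW b]; apply: Hd; rewrite a.
rewrite in_itv /= subr0 mulr1 => /andP[/ltW a /ltW b] ->.
by apply: HM; rewrite a.
Qed.

(** The real mean value theorem on the real and on the imaginary part; this
    accounts for the factor 2. *)
Lemma mean_value_ineq f f' (p d : C) (M : R) :
  (forall t : R, 0 <= t <= 1 -> is_derive (p + t%:C * d) 1 f (f' (p + t%:C * d))) ->
  (forall t : R, 0 <= t <= 1 -> cabs (f' (p + t%:C * d)) <= M) ->
  cabs (f (p + d) - f p) <= 2 * M * cabs d.
Proof.
move=> Hd HM.
have HM' (t : R) : 0 <= t <= 1 -> cabs (f' (p + t%:C * d) * d) <= M * cabs d.
  by move=> /HM H; rewrite cabsM ler_wpM2r ?cabs_ge0.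
have hr := @real_mean_value (fun s : R => complex.Re (f (p + s%:C * d)))
   (fun s : R => complex.Re (f' (p + s%:C * d) * d)) (M * cabs d).
have hi := @real_mean_value (fun s : R => complex.Im (f (p + s%:C * d)))
   (fun s : R => complex.Im (f' (p + s%:C * d) * d)) (M * cabs d).
have {}hr : `|complex.Re (f (p + d) - f p)| <= M * cabs d.
  have := hr _ _; rewrite mul1r mul0r addr0 -cReN -cReD; apply=> t Ht.
    by have [] := is_derive_segment (Hd t Ht).
  exact: le_trans (le_Re_cabs _) (HM' t Ht).
have {}hi : `|complex.Im (f (p + d) - f p)| <= M * cabs d.
  have := hi _ _; rewrite mul1r mul0r addr0 -cImN -cImD; apply=> t Ht.
    by have [] := is_derive_segment (Hd t Ht).
  exact: le_trans (le_Im_cabs _) (HM' t Ht).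
apply: le_trans (cabs_le_ReIm _) _.
by rewrite -mulrA mulr_natl mulr2n; exact: lerD.
Qed.

Definition slope f (p d : C) (z : C) : C := if z == p then d else (f z - f p) / (z - p).

(** Dividing out a zero costs one derivative: the mean value inequality bounds
    the difference of [f] and its quadratic Taylor polynomial at [p]. *)
Lemma is_derive_slope f f' (p f2 : C) (r : R) : 0 < r ->
  (forall z, cabs (z - p) < r -> is_derive z 1 f (f' z)) ->
  is_derive p 1 f' f2 ->
  is_derive p 1 (slope f p (f' p)) (f2 / 2).
Proof.
move=> r0 Hf /is_deriveCP H2; apply/is_deriveCP => e e0.
have e2 : 0 < e / 2 by rewrite divr_gt0.
have [s s0 Hs] := H2 _ e2.
exists (Num.min s r) => [|h]; first by rewrite lt_min s0.
rewrite lt_min => /andP[hs hr].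
have [->|h0] := eqVneq h 0; first by rewrite addr0 subrr mulr0 subr0 cabs0 mulr0.
have ph : (p + h == p) = false by rewrite -subr_eq0 addrAC subrr add0r (negbTE h0).
have hE : p + h - p = h by ring.
rewrite /slope ph eqxx hE.
pose S w := f w - f' p * (w - p) - f2 / 2 * ((w - p) * (w - p)).
pose S' w := f' w - f' p - f2 * (w - p).
have segh (t : R) : 0 <= t <= 1 -> cabs (t%:C * h) <= cabs h.
  move=> /andP[t0 t1]; rewrite cabsM cabs_real ger0_norm//.
  by rewrite ler_piMl ?cabs_ge0.
have : cabs (S (p + h) - S p) <= 2 * (e / 2 * cabs h) * cabs h.
  apply: (@mean_value_ineq S S') => t Ht.
    have d1 : is_derive (p + t%:C * h) 1 f (f' (p + t%:C * h)).
      apply: Hf; rewrite (_ : p + _ - p = t%:C * h); last by ring.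
      by apply: le_lt_trans (segh t Ht) _.
    have d2 := is_derive_affine 1 (- p) (p + t%:C * h).
    have d3 := is_deriveC_scale (f' p) d2.
    have d4 := is_deriveC_scale (f2 / 2) (is_deriveC_mul d2 d2).
    have d5 := is_deriveC_sub (is_deriveC_sub d1 d3) d4.
    apply: (@is_derive_ext _ S _ _ _ (is_derive_eq d5 _)).
      by move=> w; rewrite /S mul1r.
    by rewrite /S' mul1r; field.
  rewrite /S'; have -> : p + t%:C * h - p = t%:C * h by ring.
  apply: le_trans (Hs _ _) _; first exact: le_lt_trans (segh t Ht) hs.
  by rewrite ler_pM2l// segh.
have -> : S (p + h) - S p = ((f (p + h) - f p) / h - f' p - f2 / 2 * h) * h.
  by rewrite /S; field.
rewrite cabsM ler_pM2r ?cabs_gt0// => /le_trans; apply.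
by rewrite mulrA mulrCA divff// mulr1.
Qed.

End complex_derivative.

(** * Integrals of complex-valued curves *)

Section primitives.
Variable R : realType.
Notation C := (Cx R).

Lemma primitive_segment (g : R -> R) (a b : R) : continuous g -> a < b ->
  exists G : R -> R, forall t : R, a <= t <= b -> is_derive t 1 G (g t).
Proof.
move=> gc ab; pose G x := (\int[lebesgue_measure]_(t in `[(a - 1)%R, x]) g t)%R.
exists G => t /andP[at_ tb].
have int : lebesgue_measure.-integrable `[a - 1, b + 1] (EFin \o g).
  apply: continuous_compact_integrable; first exact: segment_compact.
  exact: continuous_subspaceT.
have tb1 : t < b + 1 by lra.
have at1 : a - 1 < t by lra.
have [dG GE] := continuous_FTC1_closed tb1 int at1 (gc t).
by split; [exact: dG|rewrite -derive1E].
Qed.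

Lemma primitive_unique (g F G : R -> R) (x : R) : F 0 = G 0 ->
  (forall t : R, `|t| <= `|x| -> is_derive t 1 F (g t)) ->
  (forall t : R, `|t| <= `|x| -> is_derive t 1 G (g t)) -> F x = G x.
Proof.
move=> FG0 dF dG.
have sub : `|(F (1 * x) - G (1 * x)) - (F (0 * x) - G (0 * x))| <= 0.
  apply: (@real_mean_value _ (fun t => F (t * x) - G (t * x)) (fun=> 0)) => [t /andP[t0 t1]|]; last by rewrite normr0.
  have tx : `|t * x| <= `|x| by rewrite normrM ger0_norm// ler_piMl.
  have /is_deriveRP H1 := dF _ tx; have /is_deriveRP H2 := dG _ tx.
  apply/is_deriveRP => e e0.
  have x0 : 0 < `|x| + 1 by rewrite ltr_wpDl.
  have e2 : 0 < e / (2 * (`|x| + 1)) by rewrite divr_gt0// mulr_gt0.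
  have [r r0 Hr] := H1 _ e2; have [s s0 Hs] := H2 _ e2.
  exists (Num.min r s / (`|x| + 1)); first by rewrite divr_gt0// lt_min r0.
  move=> h; rewrite ltr_pdivlMr// => hrs.
  have hx : `|h * x| <= `|h| * (`|x| + 1) by rewrite normrM ler_wpM2l// lerDl.
  have {}hrs := le_lt_trans hx hrs; rewrite lt_min in hrs.
  have {Hr}a := Hr (h * x) (andP hrs).1; have {Hs}b := Hs (h * x) (andP hrs).2.
  rewrite mul0r subr0 mulrDl.
  rewrite (_ : _ - _ = (F (t * x + h * x) - F (t * x) - g (t * x) * (h * x)) -
      (G (t * x + h * x) - G (t * x) - g (t * x) * (h * x))); last by ring.
  apply: le_trans (ler_normB _ _) _; apply: le_trans (lerD a b) _.
  rewrite -mulr2n -[_ *+ 2]mulr_natl.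
  apply: (@le_trans _ _ (2 * (e / (2 * (`|x| + 1)) * (`|h| * (`|x| + 1))))).
    by rewrite ler_pM2l// ler_pM2l.
  rewrite le_eqVlt; apply/orP; left; apply/eqP; field.
  exact: lt0r_neq0.
move: sub; rewrite !mul0r !mul1r FG0 subrr subr0 normr_le0 subr_eq0 => /eqP//.
Qed.

(** Primitives on the segments from [- n.+1] to [n.+1], normalized at 0, agree
    where they are both defined, hence glue. *)
Lemma primitive_exists (g : R -> R) : continuous g ->
  exists G : R -> R, forall t : R, is_derive t 1 G (g t).
Proof.
move=> gc.
have /choice[P HP] : forall n : nat, exists G : R -> R, G 0 = 0 /\
    forall t : R, `|t| <= n.+1%:R -> is_derive t 1 G (g t).
  move=> n; have [|G HG] := @primitive_segment g (- n.+1%:R) n.+1%:R gc.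
    by rewrite (lt_trans _ (_ : 0 < _)) ?oppr_lt0.
  exists (fun x => G x - G 0); split; first by rewrite subrr.
  move=> t; rewrite ler_norml => /HG H.
  have := is_deriveB H (is_derive_cst (G 0) t 1); rewrite subr0; exact.
pose N (x : R) := Num.truncn `|x|.
have xN (x : R) : `|x| <= (N x).+1%:R by rewrite ltW// truncnS_gt.
exists (fun x => P (N x) x) => x0.
pose M := (N x0).+1.
have [_ HM] := HP M.
apply: (@near_eq_is_derive _ _ _ (P M)).
- near=> x.
  have xM : (N x <= M)%N.
    rewrite -ltnS /N truncn_lt_nat//.
    apply: (@le_lt_trans _ _ (`|x0| + `|x - x0|)).
      by rewrite addrC -{1}(subrK x0 x) ler_normD.
    rewrite /M -natr1; apply: ltr_leD; first exact: truncnS_gt.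
    by rewrite distrC ltW//; near: x; apply: cvgr_dist_lt.
  have [HM0 _] := HP M; have [HN0 HN] := HP (N x).
  apply: (@primitive_unique g); first by rewrite HM0 HN0.
    by move=> t tx; apply: HM; apply: le_trans tx _; apply: le_trans (xN x) _; rewrite ler_nat.
  by move=> t tx; apply: HN; apply: le_trans tx _.
- apply: HM; apply: le_trans (xN x0) _; by rewrite ler_nat.
Unshelve. all: by end_near. Qed.

(** Some primitive; only differences of its values are used. *)
Definition rprim (g : R -> R) : R -> R :=
  get [set G : R -> R | forall t : R, is_derive t 1 G (g t)].

Definition cint (phi : R -> C) (a b : R) : C :=
  (rprim (fun t => complex.Re (phi t)) b - rprim (fun t => complex.Re (phi t)) a) +i*
  (rprim (fun t => complex.Im (phi t)) b - rprim (fun t => complex.Im (phi t)) a).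

Definition ccont (phi : R -> C) : Prop :=
  continuous (fun t => complex.Re (phi t)) /\ continuous (fun t => complex.Im (phi t)).

Definition cprim (Phi phi : R -> C) : Prop := forall t : R,
  is_derive t 1 (fun t => complex.Re (Phi t)) (complex.Re (phi t)) /\
  is_derive t 1 (fun t => complex.Im (Phi t)) (complex.Im (phi t)).

Lemma rprimP (g : R -> R) : continuous g -> forall t : R, is_derive t 1 (rprim g) (g t).
Proof.
move=> /primitive_exists[G HG].
exact: (@getPex _ [set G : R -> R | forall t : R, is_derive t 1 G (g t)] (ex_intro _ G HG)).
Qed.

Lemma primitive_diff (g F G : R -> R) (a b : R) :
  (forall t : R, is_derive t 1 F (g t)) -> (forall t : R, is_derive t 1 G (g t)) ->
  F b - F a = G b - G a.
Proof.
move=> dF dG.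
have : F b - G b = F a - G a.
  apply: (@is_derive_0_is_cst _ (F - G)) => x.
  by have := is_deriveB (dF x) (dG x); rewrite subrr.
lra.
Qed.

Lemma cprim_ex (phi : R -> C) : ccont phi -> exists Phi, cprim Phi phi.
Proof.
move=> [rc ic].
exists (fun t => rprim (fun t => complex.Re (phi t)) t +i* rprim (fun t => complex.Im (phi t)) t).
by move=> t; split => /=; exact: rprimP.
Qed.

Lemma cintE (Phi phi : R -> C) (a b : R) : ccont phi -> cprim Phi phi ->
  cint phi a b = Phi b - Phi a.
Proof.
move=> [rc ic] H; apply: complex_ext => /=; rewrite ?cReD ?cImD ?cReN ?cImN.
  exact: (primitive_diff a b (rprimP rc) (fun t => (H t).1)).
exact: (primitive_diff a b (rprimP ic) (fun t => (H t).2)).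
Qed.

Lemma eq_cint (phi psi : R -> C) a b : (forall t, phi t = psi t) -> cint phi a b = cint psi a b.
Proof. by move=> /funext->. Qed.

Lemma cprimD (F f G g : R -> C) : cprim F f -> cprim G g ->
  cprim (fun t => F t + G t) (fun t => f t + g t).
Proof.
move=> HF HG t; have [a b] := HF t; have [c d] := HG t; rewrite cReD cImD; split.
  by rewrite (_ : (fun t => _) = (fun t => complex.Re (F t)) + (fun t => complex.Re (G t)));
     [exact: is_deriveD|apply/funext => s; rewrite cReD].
by rewrite (_ : (fun t => _) = (fun t => complex.Im (F t)) + (fun t => complex.Im (G t)));
   [exact: is_deriveD|apply/funext => s; rewrite cImD].
Qed.

Lemma cprimZ (k : C) (F f : R -> C) : cprim F f ->
  cprim (fun t => k * F t) (fun t => k * f t).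
Proof.
move=> HF t; have [a b] := HF t; rewrite cReM cImM; split.
  rewrite (_ : (fun t => _) = (complex.Re k *: (fun t => complex.Re (F t))) - (complex.Im k *: (fun t => complex.Im (F t))));
   [exact: is_deriveB|by apply/funext => s; rewrite cReM].
rewrite (_ : (fun t => _) = (complex.Re k *: (fun t => complex.Im (F t))) + (complex.Im k *: (fun t => complex.Re (F t))));
   [exact: is_deriveD|by apply/funext => s; rewrite cImM].
Qed.

Lemma cprim_affine (al be : C) :
  cprim (fun t => al * t%:C + be * (t ^+ 2 / 2)%:C) (fun t => al + be * t%:C).
Proof.
have Hid : cprim (fun t => t%:C) (fun=> 1).
  by move=> t; split => /=; [exact: is_derive_id|exact: is_derive_cst].
have Hsq : cprim (fun t => (t ^+ 2 / 2)%:C) (fun t => t%:C).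
  move=> t; split => /=; last exact: is_derive_cst.
  apply/is_deriveRP => e e0; exists e => // h he /=.
  rewrite (_ : _ - _ = h / 2 * h); last by field.
  rewrite normrM ler_wpM2r// normrM normfV (ger0_norm (ler0n _ 2)).
  by rewrite ler_pdivrMr//; apply: (le_trans (ltW he)); lra.
move=> t; have := cprimD (cprimZ al Hid) (cprimZ be Hsq) t.
by rewrite mulr1.
Qed.

End primitives.

Arguments cint {R} phi a b : simpl never.

(** * Integrals around rectangles *)

Section contour_integrals.
Variable R : realType.
Notation C := (Cx R).

Lemma cplxE (a b : R) : (a +i* b : C) = a%:C + iC R * b%:C.
Proof. exact: (complexE (a +i* b)). Qed.

Lemma ccontD (f g : R -> C) : ccont f -> ccont g -> ccont (fun t => f t + g t).
Proof.
move=> [a b] [c d]; split.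
  by under eq_fun do rewrite cReD; move=> t; apply: cvgD; [exact: a|exact: c].
by under eq_fun do rewrite cImD; move=> t; apply: cvgD; [exact: b|exact: d].
Qed.

Lemma ccontZ (k : C) (f : R -> C) : ccont f -> ccont (fun t => k * f t).
Proof.
move=> [a b]; split.
  under eq_fun do rewrite cReM; move=> t; apply: cvgB; apply: cvgM; try exact: cvg_cst.
    exact: a.
  exact: b.
under eq_fun do rewrite cImM; move=> t; apply: cvgD; apply: cvgM; try exact: cvg_cst.
  exact: b.
exact: a.
Qed.

Lemma cintD (f g : R -> C) a b : ccont f -> ccont g ->
  cint (fun t => f t + g t) a b = cint f a b + cint g a b.
Proof.
move=> fc gc; have [F HF] := cprim_ex fc; have [G HG] := cprim_ex gc.
rewrite (cintE _ _ fc HF) (cintE _ _ gc HG) (cintE _ _ (ccontD fc gc) (cprimD HF HG)).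
by ring.
Qed.

Lemma cintZ (k : C) (f : R -> C) a b : ccont f -> cint (fun t => k * f t) a b = k * cint f a b.
Proof.
move=> fc; have [F HF] := cprim_ex fc.
by rewrite (cintE _ _ fc HF) (cintE _ _ (ccontZ k fc) (cprimZ k HF)); ring.
Qed.

Lemma cint_cat (f : R -> C) a b c : cint f a c = cint f a b + cint f b c.
Proof. by apply: complex_ext; rewrite ?cReD ?cImD /cint /=; ring. Qed.

Lemma cint_shift (f : R -> C) r a b : ccont f ->
  cint (fun t => f (t + r)) a b = cint f (a + r) (b + r).
Proof.
move=> fc; have [F HF] := cprim_ex fc; rewrite (cintE _ _ fc HF).
have HF' : cprim (fun t => F (t + r)) (fun t => f (t + r)).
  move=> t; have [/is_deriveRP H1 /is_deriveRP H2] := HF (t + r).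
  split; apply/is_deriveRP => e e0; [have [s s0 Hs] := H1 e e0|have [s s0 Hs] := H2 e e0];
  by exists s => // h hs; rewrite (addrAC t h r); exact: Hs.
rewrite (cintE _ _ _ HF')//; case: fc => a1 b1.
split=> t.
  apply: (@cvg_comp _ _ _ (fun t => t + r) (fun t => complex.Re (f t)) _ (nbhs (t + r))).
    by apply: cvgD; [exact: cvg_id|exact: cvg_cst].
  exact: a1.
apply: (@cvg_comp _ _ _ (fun t => t + r) (fun t => complex.Im (f t)) _ (nbhs (t + r))).
  by apply: cvgD; [exact: cvg_id|exact: cvg_cst].
exact: b1.
Qed.

Lemma primitive_bound (g G : R -> R) (a b M : R) : a <= b ->
  (forall t : R, is_derive t 1 G (g t)) -> (forall t : R, a <= t <= b -> `|g t| <= M) ->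
  `|G b - G a| <= M * (b - a).
Proof.
move=> ab dG gM.
have [|c] := @MVT_segment R G g a b ab (fun t _ => dG t).
  by apply: derivable_within_continuous => t _; have [] := dG t.
rewrite in_itv /= => cab ->; rewrite normrM [`|b - a|]ger0_norm ?subr_ge0//.
by rewrite ler_wpM2r ?subr_ge0// gM.
Qed.

Lemma cint_bound (f : R -> C) (a b M : R) : a <= b -> ccont f ->
  (forall t : R, a <= t <= b -> cabs (f t) <= M) -> cabs (cint f a b) <= 2 * M * (b - a).
Proof.
move=> ab fc fM; have [F HF] := cprim_ex fc; rewrite (cintE _ _ fc HF).
apply: le_trans (cabs_le_ReIm _) _; rewrite cReD cImD cReN cImN.
rewrite -mulrA mulr_natl mulr2n; apply: lerD.
  apply: (primitive_bound ab (fun t => (HF t).1)) => t /fM; exact: le_trans (le_Re_cabs _).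
apply: (primitive_bound ab (fun t => (HF t).2)) => t /fM; exact: le_trans (le_Im_cabs _).
Qed.

Lemma cint_affine (al be : C) a b : cint (fun t => al + be * t%:C) a b =
  al * (b%:C - a%:C) + be * ((b%:C ^+ 2 - a%:C ^+ 2) / 2).
Proof.
have H := cprim_affine al be.
have Hc : ccont (fun t : R => al + be * t%:C).
  apply: ccontD; first by split => t; exact: cvg_cst.
  apply: ccontZ; split => t /=; first exact: cvg_id.
  exact: cvg_cst.
by rewrite (cintE _ _ Hc H); field.
Qed.

Lemma continuous_row (f : C -> C) (c : R) : continuous f -> ccont (fun s => f (s +i* c)).
Proof.
move=> fc; have H (s0 : R) : f (s +i* c) @[s --> s0] --> f (s0 +i* c).
  apply: (@cvg_comp _ _ _ (fun s => s +i* c : C) f _ (nbhs (s0 +i* c : C))); last exact: fc.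
  apply/cvgCP => e e0.
  have /cvgrPdist_lt/(_ e e0) : (s : R) @[s --> s0] --> s0 by exact: cvg_id.
  apply: filterS => s; rewrite distrC => se.
  rewrite !cplxE (_ : _ - _ = (s - s0)%:C); last by rewrite rmorphB /=; ring.
  by rewrite cabs_real.
by split=> s; have [] := cvg_ReIm (H s).
Qed.

Lemma continuous_column (f : C -> C) (c : R) : continuous f -> ccont (fun t => f (c +i* t)).
Proof.
move=> fc; have H (s0 : R) : f (c +i* s) @[s --> s0] --> f (c +i* s0).
  apply: (@cvg_comp _ _ _ (fun s => c +i* s : C) f _ (nbhs (c +i* s0 : C))); last exact: fc.
  apply/cvgCP => e e0.
  have /cvgrPdist_lt/(_ e e0) : (s : R) @[s --> s0] --> s0 by exact: cvg_id.
  apply: filterS => s; rewrite distrC => se.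
  rewrite !cplxE (_ : _ - _ = iC R * (s - s0)%:C); last by rewrite rmorphB /=; ring.
  by rewrite cabsM cabs_i mul1r cabs_real.
by split=> s; have [] := cvg_ReIm (H s).
Qed.

Definition rect_int (f : C -> C) (a b c d : R) : C :=
  cint (fun s => f (s +i* c)) a b + iC R * cint (fun t => f (b +i* t)) c d
  - cint (fun s => f (s +i* d)) a b - iC R * cint (fun t => f (a +i* t)) c d.

Lemma rect_int_hcat f a m b c d :
  rect_int f a b c d = rect_int f a m c d + rect_int f m b c d.
Proof.
by rewrite /rect_int (cint_cat _ a m b) (cint_cat (fun s => f (s +i* d)) a m b); ring.
Qed.

Lemma rect_int_vcat f a b c m d :
  rect_int f a b c d = rect_int f a b c m + rect_int f a b m d.
Proof.
by rewrite /rect_int (cint_cat _ c m d) (cint_cat (fun t => f (a +i* t)) c m d); ring.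
Qed.

Lemma rect_intD (f g : C -> C) a b c d : continuous f -> continuous g ->
  rect_int (fun z => f z + g z) a b c d = rect_int f a b c d + rect_int g a b c d.
Proof.
move=> fc gc; rewrite /rect_int.
rewrite !(cintD _ _ (continuous_row _ fc) (continuous_row _ gc)).
by rewrite !(cintD _ _ (continuous_column _ fc) (continuous_column _ gc)); ring.
Qed.

(** Cauchy for functions with a primitive, in the one case needed to start. *)
Lemma rect_int_affine (al be : C) a b c d :
  rect_int (fun z => al + be * z) a b c d = 0.
Proof.
have row (y : R) : cint (fun s => al + be * (s +i* y)) a b =
    (al + be * iC R * y%:C) * (b%:C - a%:C) + be * ((b%:C ^+ 2 - a%:C ^+ 2) / 2).
  rewrite -cint_affine; apply: eq_cint => s; rewrite cplxE; ring.
have col (x : R) : cint (fun t => al + be * (x +i* t)) c d =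
    (al + be * x%:C) * (d%:C - c%:C) + be * iC R * ((d%:C ^+ 2 - c%:C ^+ 2) / 2).
  rewrite -cint_affine; apply: eq_cint => s; rewrite cplxE; ring.
rewrite /rect_int !row !col.
by move: (a%:C) (b%:C) (c%:C) (d%:C) (iC R) => a' b' c' d' i; ring.
Qed.

Lemma rect_int_bound (f : C -> C) a b c d (M : R) : a <= b -> c <= d -> continuous f ->
  (forall s t : R, a <= s <= b -> c <= t <= d -> cabs (f (s +i* t)) <= M) ->
  cabs (rect_int f a b c d) <= 4 * M * ((b - a) + (d - c)).
Proof.
move=> ab cd fc fM.
have h (y : R) : c <= y <= d -> cabs (cint (fun s => f (s +i* y)) a b) <= 2 * M * (b - a).
  by move=> yb; apply: cint_bound (continuous_row y fc) _ => // s sb; exact: fM.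
have v (x : R) : a <= x <= b -> cabs (iC R * cint (fun t => f (x +i* t)) c d) <= 2 * M * (d - c).
  move=> xb; rewrite cabsM cabs_i mul1r.
  by apply: cint_bound (continuous_column x fc) _ => // s sb; exact: fM.
have [cc dd] : c <= c <= d /\ c <= d <= d by rewrite !lexx cd.
have [aa bb] : a <= a <= b /\ a <= b <= b by rewrite !lexx ab.
have h1 := h c cc; have h2 := h d dd; have v1 := v a aa; have v2 := v b bb.
rewrite /rect_int.
apply: le_trans (cabsD _ _) _; rewrite cabsN.
apply: le_trans (lerD (cabsD _ _) (lexx _)) _; rewrite cabsN.
apply: le_trans (lerD (lerD (cabsD _ _) (lexx _)) (lexx _)) _.
lra.
Qed.

End contour_integrals.

(** * Goursat's theorem *)

Section goursat.
Variable R : realType.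
Notation C := (Cx R).

Record rect := Rect { rleft : R; rright : R; rbot : R; rtop : R }.

Definition rect_wf (Q : rect) := rleft Q <= rright Q /\ rbot Q <= rtop Q.
Definition rect_size (Q : rect) : R := (rright Q - rleft Q) + (rtop Q - rbot Q).
Definition in_rect (Q : rect) (s t : R) := rleft Q <= s <= rright Q /\ rbot Q <= t <= rtop Q.
Definition boundary_int (f : C -> C) (Q : rect) : C :=
  rect_int f (rleft Q) (rright Q) (rbot Q) (rtop Q).

(** One of the four quarters keeps a quarter of the integral, as it keeps a
    quarter of the square of the size. *)
Lemma quarter_step (f : C -> C) (e : R) (Q : rect) : rect_wf Q ->
  e * rect_size Q ^+ 2 < cabs (boundary_int f Q) ->
  exists Q', [/\ rect_wf Q', rect_size Q' = rect_size Q / 2,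
    e * rect_size Q' ^+ 2 < cabs (boundary_int f Q'),
    rleft Q <= rleft Q' /\ rright Q' <= rright Q & rbot Q <= rbot Q' /\ rtop Q' <= rtop Q].
Proof.
case: Q => a b c d [/= ab cd]; rewrite /rect_size /boundary_int /= => big.
pose m := (a + b) / 2; pose n := (c + d) / 2.
have [am mb cn nd] : [/\ a <= m, m <= b, c <= n & n <= d] by rewrite /m /n; split; lra.
pose L := (b - a + (d - c)) / 2.
have size2 : [/\ m - a + (n - c) = L, b - m + (n - c) = L,
   m - a + (d - n) = L & b - m + (d - n) = L] by rewrite /m /n /L; split; field.
have [s1 s2 s3 s4] := size2.
have [h1|h1] := ltP (e * L ^+ 2) (cabs (rect_int f a m c n)).
  by exists (Rect a m c n); rewrite /rect_wf /= s1.
have [h2|h2] := ltP (e * L ^+ 2) (cabs (rect_int f m b c n)).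
  by exists (Rect m b c n); rewrite /rect_wf /= s2.
have [h3|h3] := ltP (e * L ^+ 2) (cabs (rect_int f a m n d)).
  by exists (Rect a m n d); rewrite /rect_wf /= s3.
have [h4|h4] := ltP (e * L ^+ 2) (cabs (rect_int f m b n d)).
  by exists (Rect m b n d); rewrite /rect_wf /= s4.
exfalso; move: big; apply/negP; rewrite -leNgt.
rewrite (rect_int_vcat f a b c n d) (rect_int_hcat f a m b c n) (rect_int_hcat f a m b n d).
apply: le_trans (cabsD _ _) _; apply: le_trans (lerD (cabsD _ _) (cabsD _ _)) _.
apply: le_trans (lerD (lerD h1 h2) (lerD h3 h4)) _.
by rewrite /L le_eqVlt; apply/orP; left; apply/eqP; field.
Qed.

(** Subtracting the tangent function does not change the integral and leaves an
    integrand of size at most [e * rect_size Q]. *)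
Lemma rect_int_small (f : C -> C) (z0 D : C) (e r : R) (Q : rect) :
  continuous f -> rect_wf Q -> in_rect Q (complex.Re z0) (complex.Im z0) ->
  rect_size Q < r -> 0 <= e ->
  (forall h : C, cabs h < r -> cabs (f (z0 + h) - f z0 - D * h) <= e * cabs h) ->
  cabs (boundary_int f Q) <= 4 * e * rect_size Q ^+ 2.
Proof.
case: Q => a b c d fc [/= ab cd] [/= za zc]; rewrite /rect_size /boundary_int /= => sr e0 H.
pose g z := f z + ((D * z0 - f z0) + - D * z).
have ac : continuous (fun z : C => (D * z0 - f z0) + - D * z).
  move=> z; exact: is_derive_continuous
    (is_deriveC_add (is_deriveC_cst _ z) (is_deriveC_scale (- D) (is_deriveC_id z))).
have gc : continuous g by move=> z; exact: (cvgD (fc z) (ac z)).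
have -> : rect_int f a b c d = rect_int g a b c d.
  by rewrite /g (rect_intD _ _ _ _ fc ac) rect_int_affine addr0.
rewrite expr2 mulrA -[X in _ <= X * _]mulrA.
apply: rect_int_bound => // s t sb tb.
have zE : s +i* t = z0 + (s +i* t - z0) by rewrite addrC subrK.
have hb : cabs (s +i* t - z0 : C) <= b - a + (d - c).
  apply: le_trans (cabs_le_ReIm _) _; rewrite cReD cImD cReN cImN /=.
  apply: lerD; rewrite ler_norml; apply/andP; split; lra.
rewrite /g (_ : _ + _ = f (z0 + (s +i* t - z0)) - f z0 - D * (s +i* t - z0)); last first.
  by rewrite -zE; ring.
apply: le_trans (H _ _) _; first exact: le_lt_trans hb sr.
by rewrite ler_wpM2l.
Qed.

(** Repeated bisection, so that no regularity of the derivative is needed. *)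
Theorem goursat (f : C -> C) (a b c d : R) : a <= b -> c <= d -> continuous f ->
  (forall s t : R, a <= s <= b -> c <= t <= d -> derivable f (s +i* t) 1) ->
  rect_int f a b c d = 0.
Proof.
move=> ab cd fc fd; apply/eqP; rewrite -cabs_eq0; apply: contraT => nz.
have I0 : 0 < cabs (rect_int f a b c d) by rewrite lt_neqAle eq_sym nz cabs_ge0.
pose Q0 := Rect a b c d; pose L := rect_size Q0.
have L0 : 0 <= L by rewrite /L /rect_size /=; lra.
pose e := cabs (rect_int f a b c d) / (L ^+ 2 + 1).
have den : 0 < L ^+ 2 + 1 by rewrite ltr_wpDl// sqr_ge0.
have e0 : 0 < e by rewrite divr_gt0.
pose good Q := rect_wf Q /\ e * rect_size Q ^+ 2 < cabs (boundary_int f Q).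
have good0 : good Q0.
  split; first by split.
  rewrite -/L /e mulrAC ltr_pdivrMr// ltr_pM2l// ltrDl ltr01//.
have /choice[next Hnext] : forall Q, exists Q', good Q -> [/\ good Q', rect_size Q' = rect_size Q / 2,
    rleft Q <= rleft Q' /\ rright Q' <= rright Q & rbot Q <= rbot Q' /\ rtop Q' <= rtop Q].
  move=> Q; have [[w g]|ng] := pselect (good Q); last by exists Q.
  by have [Q' [w' s' g' x' y']] := quarter_step w g; exists Q'.
pose Qn n := iter n next Q0.
have goodn n : good (Qn n) by elim: n => //= n IH; have [] := Hnext _ IH.
have sizen n : rect_size (Qn n) = L / 2 ^+ n.
  elim: n => [|n IH]; first by rewrite expr0 divr1.
  by have [_ /= -> _ _] := Hnext _ (goodn n); rewrite IH exprS invfM mulrA mulrAC.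
have nested n k : [/\ rleft (Qn n) <= rleft (Qn (n + k)%N), rright (Qn (n + k)%N) <= rright (Qn n),
    rbot (Qn n) <= rbot (Qn (n + k)%N) & rtop (Qn (n + k)%N) <= rtop (Qn n)].
  elim: k => [|k [h1 h2 h3 h4]]; first by rewrite addn0.
  rewrite addnS /=; have [_ _ [x1 x2] [y1 y2]] := Hnext _ (goodn (n + k)%N).
  split; [exact: le_trans h1 _|exact: le_trans h2|exact: le_trans h3 _|exact: le_trans h4].
have wf n : rect_wf (Qn n) by case: (goodn n).
have cross n m : rleft (Qn n) <= rright (Qn m) /\ rbot (Qn n) <= rtop (Qn m).
  have [/subnKC <-|/ltnW/subnKC <-] := leqP n m.
    have [h1 _ h3 _] := nested n (m - n)%N; have [w1 w2] := wf (n + (m - n))%N.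
    by split; [apply: le_trans h1 w1|apply: le_trans h3 w2].
  have [_ h1 _ h3] := nested m (n - m)%N; have [w1 w2] := wf (m + (n - m))%N.
  by split; [apply: le_trans w1 h1|apply: le_trans w2 h3].
have supP (u v : nat -> R) : (forall n m, u n <= v m) -> exists x, forall n, u n <= x <= v n.
  move=> uv; have hs : has_sup (range u).
    by split; [exists (u 0%N), 0%N|exists (v 0%N) => _ [n _ <-]].
  exists (sup (range u)) => n; apply/andP; split.
    by apply: ub_le_sup; [case: hs|exists n].
  by apply: ge_sup => //; [case: hs|move=> _ [m _ <-]].
have [x xP] := supP (rleft \o Qn) (rright \o Qn) (fun n m => (cross n m).1).
have [y yP] := supP (rbot \o Qn) (rtop \o Qn) (fun n m => (cross n m).2).
(* The quarters shrink to x + i y; near it, the tangent approximation within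
   e / 4 contradicts the lower bound e for the ratio to the squared size. *)
have /derivableCP[D /is_deriveCP HD] := fd x y (xP 0%N) (yP 0%N).
have e8 : 0 < e / 4 by rewrite divr_gt0.
have [r r0 Hr] := HD _ e8.
have [n Ln] : exists n, L / 2 ^+ n < r.
  exists (Num.bound (L / r)); rewrite ltr_pdivrMr ?exprn_gt0// -ltr_pdivrMl//.
  rewrite mulrC; apply: (@lt_trans _ _ (Num.bound (L / r))%:R).
    by apply: archi_boundP; rewrite divr_ge0// ltW.
  by rewrite -natrX ltr_nat ltn_expl.
have [_] := goodn n; apply: contraLR => _; rewrite -leNgt.
apply: le_trans (@rect_int_small f (x +i* y) D (e / 4) r _ fc (wf n) _ _ (ltW e8) Hr) _.
- by split; [exact: xP|exact: yP].
- by rewrite sizen.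
- by have -> : 4 * (e / 4) = e by field.
Qed.

End goursat.

(** * Integrals of periodic functions over horizontal segments *)

Section row_integrals.
Variable R : realType.
Notation C := (Cx R).

Definition row (f : C -> C) (t : R) : C := cint (fun s => f (s +i* t)) 0 1.

(** Differentiability off a locally finite set of horizontal lines, those on
    which the isolated singularities lie. *)
Definition row_regular (f : C -> C) : Prop := forall t0 : R, exists2 r : R, 0 < r &
  forall s t : R, 0 < `|t - t0| < r -> derivable f (s +i* t) 1.

(** The integrals along the two vertical sides cancel by periodicity. *)
Lemma row_regular_eq (f : C -> C) (t1 t2 : R) : t1 <= t2 -> continuous f ->
  (forall z, f (z + 1) = f z) ->
  (forall s t : R, t1 <= t <= t2 -> derivable f (s +i* t) 1) -> row f t1 = row f t2.
Proof.
move=> t12 fc per fd.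
have := @goursat R f 0 1 t1 t2 ler01 t12 fc (fun s t _ => fd s t).
rewrite /rect_int.
have -> : cint (fun t => f (1 +i* t)) t1 t2 = cint (fun t => f (0 +i* t)) t1 t2.
  apply: eq_cint => t.
  by rewrite -(per (0 +i* t)); congr f; apply: complex_ext; rewrite ?cReD ?cImD /= ?add0r ?addr0.
by rewrite addrAC addrK => /eqP; rewrite subr_eq0 => /eqP.
Qed.

(** Uniform continuity along a compact segment. *)
Lemma row_continuous (f : C -> C) (t0 e : R) : continuous f -> 0 < e ->
  exists2 r : R, 0 < r & forall t, `|t - t0| < r -> cabs (row f t - row f t0) <= e.
Proof.
move=> fc e0; have e2 : 0 < e / 2 by rewrite divr_gt0.
have /compact_near_coveringP cov := @segment_compact R 0 1.
have : \forall t \near t0, `[(0 : R), 1]%classic `<=`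
    (fun s => cabs (f (s +i* t) - f (s +i* t0)) <= e / 2).
  apply: (cov R (nbhs t0) (fun t s => cabs (f (s +i* t) - f (s +i* t0)) <= e / 2)) => s0 _.
  have /cvgCP/(_ (e / 4)) := fc (s0 +i* t0); rewrite divr_gt0// => /(_ isT).
  move=> /nbhsCP[r r0 Hr].
  have r2 : 0 < r / 2 by rewrite divr_gt0.
  exists ([set s : R | `|s - s0| < r / 2], [set t : R | `|t - t0| < r / 2]).
    split; apply/nbhs_ballP; exists (r / 2) => // w; rewrite /ball /= distrC//.
  move=> [s t] [/= hs ht].
  have near1 (t' : R) : `|t' - t0| < r / 2 -> cabs (f (s +i* t') - f (s0 +i* t0)) < e / 4.
    move=> ht'; apply: Hr; apply: le_lt_trans (cabs_le_ReIm _) _ => /=.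
    by rewrite (splitr r) ltrD.
  have n1 := near1 t ht; have n2 := near1 t0.
  rewrite subrr normr0 in n2; have {}n2 := n2 r2.
  apply: le_trans (cabs_subD _ _ (f (s0 +i* t0))) _.
  rewrite (cabsB (f (s0 +i* t0))); lra.
move=> /nbhs_ballP[r r0 Hr]; exists r => // t tr.
have tH := Hr t; rewrite /ball /= distrC in tH; have {}tH := tH tr.
have c1 := continuous_row t fc; have c2 := continuous_row t0 fc.
have -> : row f t - row f t0 = cint (fun s => f (s +i* t) + -1 * f (s +i* t0)) 0 1.
  by rewrite (cintD _ _ c1 (ccontZ (-1) c2)) (cintZ _ _ _ c2) mulN1r.
have bd := @cint_bound R _ 0 1 (e / 2) ler01 (ccontD c1 (ccontZ (-1) c2)).
apply: le_trans (bd _) _; last lra.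
by move=> s s01; rewrite mulN1r; apply: tH; rewrite /= in_itv.
Qed.

Lemma row_constant (f : C -> C) : continuous f -> (forall z, f (z + 1) = f z) ->
  row_regular f -> forall t t', row f t = row f t'.
Proof.
move=> fc per reg.
(* Goursat on each side of an exceptional line, continuity across it. *)
have loc (t0 : R) : exists2 r : R, 0 < r & forall t, `|t - t0| < r -> row f t = row f t0.
  have [r r0 Hr] := reg t0; exists r => // t tr.
  have [->//|tt0] := eqVneq t t0.
  apply/eqP; rewrite -subr_eq0 -cabs_eq0; apply/eqP/le_anti.
  rewrite cabs_ge0 andbT; apply/ler_addgt0Pr => e e0; rewrite add0r.
  have [d d0 Hd] := row_continuous t0 fc e0.
  pose m := Num.min (1 / 2) (d / (2 * `|t - t0|)).
  have p0 : 0 < `|t - t0| by rewrite normr_gt0 subr_eq0.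
  have m0 : 0 < m by rewrite lt_min divr_gt0//= divr_gt0// mulr_gt0.
  have m1 : m <= 1 / 2 by rewrite ge_min lexx.
  pose t1 := t0 + m * (t - t0).
  have t1d : `|t1 - t0| < d.
    rewrite /t1 addrAC subrr add0r normrM gtr0_norm//.
    have : m <= d / (2 * `|t - t0|) by rewrite ge_min lexx orbT.
    rewrite ler_pdivlMr ?mulr_gt0// => h.
    have : 0 < m * `|t - t0| by rewrite mulr_gt0.
    lra.
  suff -> : row f t = row f t1 by exact: Hd.
  have [lt0|gt0] : t < t0 \/ t0 < t by move: tt0; rewrite neq_lt => /orP.
    have e1 : `|t - t0| = t0 - t by rewrite distrC gtr0_norm ?subr_gt0.
    have b1 : 0 < m * (t0 - t) by rewrite mulr_gt0// subr_gt0.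
    have b2 : m * (t0 - t) <= 1 / 2 * (t0 - t) by rewrite ler_pM2r// subr_gt0.
    apply: row_regular_eq => //; first by rewrite /t1; lra.
    move=> s u /andP[u1 u2]; apply: Hr.
    have ut0 : u < t0 by rewrite /t1 in u2; lra.
    rewrite distrC gtr0_norm ?subr_gt0// ut0/=; lra.
  have e1 : `|t - t0| = t - t0 by rewrite gtr0_norm ?subr_gt0.
  have b1 : 0 < m * (t - t0) by rewrite mulr_gt0// subr_gt0.
  have b2 : m * (t - t0) <= 1 / 2 * (t - t0) by rewrite ler_pM2r// subr_gt0.
  apply/esym; apply: row_regular_eq => //; first by rewrite /t1; lra.
  move=> s u /andP[u1 u2]; apply: Hr.
  have ut0 : t0 < u by rewrite /t1 in u1; lra.
  rewrite gtr0_norm ?subr_gt0// ut0/=; lra.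
move=> t t'; apply: complex_ext;
  [apply: (@is_derive_0_is_cst _ (fun t => complex.Re (row f t)))
  |apply: (@is_derive_0_is_cst _ (fun t => complex.Im (row f t)))] => x;
  have [r r0 Hr] := loc x; apply/is_deriveRP => e e0; exists r => // h hr;
  by rewrite Hr ?subrr ?mul0r ?subr0 ?normr0 ?mulr_ge0 ?(ltW e0)// addrAC subrr add0r.
Qed.

Lemma cint_period (phi : R -> C) (r : R) : ccont phi -> (forall s, phi (s + 1) = phi s) ->
  cint phi r (r + 1) = cint phi 0 1.
Proof.
move=> pc per; have sh := cint_shift 1 0 r pc.
rewrite (eq_cint (psi := phi)) // add0r in sh.
by rewrite (cint_cat phi r 1 (r + 1)) -sh (cint_cat phi 0 r 1) addrC.
Qed.

(** Moving the row at height 0 by [tau] adds [c] to its integral; but this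
    integral does not depend on the height. *)
Lemma quasi_period_eq0 (f : C -> C) (tau c : C) : continuous f ->
  (forall z, f (z + 1) = f z) -> (forall z, f (z + tau) = f z + c) ->
  row_regular f -> c = 0.
Proof.
move=> fc per qper reg.
have c0 := continuous_row 0 fc.
have : row f (complex.Im tau) = row f 0 + c.
  rewrite /row (eq_cint (psi := fun s => f ((s - complex.Re tau) +i* 0) + c)) => [|s]; last first.
    rewrite /= -qper; congr f; by apply: complex_ext; rewrite ?cReD ?cImD /= ?subrK ?add0r.
  have shift_cont : ccont (fun s => f ((s - complex.Re tau) +i* 0)).
    have := @continuous_row R (fun z => f (z - (complex.Re tau)%:C)) 0.
    move=> H; have -> : (fun s => f ((s - complex.Re tau) +i* 0)) =
        (fun s => f ((s +i* 0) - (complex.Re tau)%:C)).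
      by apply/funext => s; congr f; apply: complex_ext; rewrite ?cReD ?cImD ?cReN ?cImN /= ?subr0.
    apply: H => z; apply: (@cvg_comp _ _ _ (fun z => z - (complex.Re tau)%:C : C) f _ (nbhs (z - (complex.Re tau)%:C : C))); last exact: fc.
    exact: (cvgD cvg_id (cvg_cst _)).
  have kc : ccont (fun=> c : C) by split=> t; exact: cvg_cst.
  rewrite (cintD _ _ shift_cont kc).
  rewrite (cint_shift (f := fun s => f (s +i* 0)) (- complex.Re tau) 0 1 c0).
  rewrite add0r (addrC 1) cint_period//; last first.
    by move=> s; rewrite -(per (s +i* 0)); congr f; apply: complex_ext; rewrite ?cReD ?cImD /= ?addr0.
  congr (_ + _).
  have := @cint_affine R c 0 0 1; rewrite (eq_cint (psi := fun=> c)) => [|t]; last by rewrite mul0r addr0.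
  by move=> ->; rewrite mul0r addr0 /= subr0 mulr1.
rewrite (row_constant fc per reg _ 0) => /eqP; rewrite -subr_eq0 opprD addrA subrr add0r oppr_eq0.
by move/eqP.
Qed.

End row_integrals.

(** * Removable singularities *)

Section removable_singularities.
Variable R : realType.
Notation C := (Cx R).

Definition removable (f : C -> C) (z : C) : Prop := exists l : C, f @ z^' --> l.

(** The extension by limits. Only its continuity is established at the filled
    points, and [row_constant] asks for no more there. *)
Definition fill (f : C -> C) (z : C) : C := lim (f @ z^').

Lemma fillP (f : C -> C) (z l : C) : f @ z^' --> l -> fill f z = l.
Proof. by move=> fl; apply: cvg_lim. Qed.

Lemma fill_continuous (f : C -> C) : (forall z, removable f z) -> continuous (fill f).
Proof.
move=> rf z; have [l fl] := rf z; have zl := fillP fl.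
apply/(@cvgCP R C (nbhs z) _ (fill f) (fill f z)) => e e0; rewrite zl; have e2 : 0 < e / 2 by rewrite divr_gt0.
have /cvgCP/(_ _ e2)/dnbhsCP[r r0 Hr] := fl.
apply/nbhsCP; exists r => // w wr.
have [->|wz] := eqVneq w z; first by rewrite zl subrr cabs0.
have [k fk] := rf w; rewrite (fillP fk).
have /cvgCP/(_ _ e2) near1 := fk.
have near2 : \forall u \near w^', u != z /\ cabs (u - z) < r.
  apply/dnbhsCP; exists (Num.min (r - cabs (w - z)) (cabs (w - z))).
    by rewrite lt_min subr_gt0 wr cabs_gt0 subr_eq0.
  move=> u uw; rewrite lt_min => /andP[h1 h2]; split.
    by apply: contraTneq h2 => ->; rewrite cabsB ltxx.
  apply: le_lt_trans (cabs_subD _ _ w) _; lra.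
have [u [[u1 u2] u3]] := filter_ex (filterI near2 near1).
apply: le_lt_trans (cabs_subD _ _ (f u)) _; rewrite (cabsB k) (splitr e).
by apply: ltrD => //; exact: Hr.
Qed.

Lemma fill_eq (f : C -> C) (z d : C) : is_derive z 1 f d -> fill f z = f z.
Proof.
move=> /is_derive_continuous fz; apply: fillP.
exact: cvg_trans (cvg_app _ (@nbhs_dnbhs _ z)) fz.
Qed.

Lemma fill_shift (f : C -> C) (z a c : C) : removable f z ->
  (\forall w \near z^', f (w + a) = f w + c) -> fill f (z + a) = fill f z + c.
Proof.
move=> [l fl] /dnbhsCP[r r0 Hr]; rewrite (fillP fl); apply: fillP.
apply/cvgCP => e e0; have /cvgCP/(_ _ e0)/dnbhsCP[s s0 Hs] := fl.
apply/dnbhsCP; exists (Num.min r s) => [|w wz]; first by rewrite lt_min r0.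
have -> : w - (z + a) = w - a - z by ring.
rewrite lt_min => /andP[h1 h2].
have wz' : w - a != z by rewrite subr_eq.
have := Hr _ wz' h1; rewrite subrK => ->.
by rewrite (_ : _ - _ = f (w - a) - l); [exact: Hs|ring].
Qed.

Lemma removable_shift (f : C -> C) (z a b c : C) : removable f z ->
  (\forall w \near z^', f (w + a) = b * f w + c) -> removable f (z + a).
Proof.
move=> [l fl] /dnbhsCP[r r0 Hr]; exists (b * l + c).
have /cvgCP H : (fun w => b * f w + c) @ z^' --> b * l + c.
  apply: cvgC_add; last exact: cvgC_cst.
  by apply: cvgC_mul; [exact: cvgC_cst|exact: fl].
apply/cvgCP => e e0; have /dnbhsCP[s s0 Hs] := H _ e0.
apply/dnbhsCP; exists (Num.min r s) => [|w wz]; first by rewrite lt_min r0.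
have -> : w - (z + a) = w - a - z by ring.
rewrite lt_min => /andP[h1 h2].
have wz' : w - a != z by rewrite subr_eq.
have := Hr _ wz' h1; rewrite subrK => ->.
exact: Hs.
Qed.

Lemma row_regular_fill (f : C -> C) : row_regular f -> row_regular (fill f).
Proof.
move=> reg t0; have [r r0 Hr] := reg t0; exists r; first exact: r0.
move=> s t /andP[t1 t2]; have /derivableCP[d Hd] : derivable f (s +i* t) 1 by apply: Hr; rewrite t1.
apply/derivableCP; exists d.
have rr : 0 < Num.min `|t - t0| (r - `|t - t0|) by rewrite lt_min t1 subr_gt0.
apply: (is_derive_near rr _ Hd).
move=> [x y]; rewrite lt_min => /andP[h1 h2].
have yt : `|y - t| <= cabs ((x +i* y : C) - (s +i* t)) by exact: (le_Im_cabs ((x +i* y : C) - (s +i* t))).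
have /derivableCP[d' Hd'] : derivable f (x +i* y) 1.
  apply: Hr; apply/andP; split.
    rewrite normr_gt0; apply: contraTneq (le_lt_trans yt h1).
    move=> /eqP; rewrite subr_eq0 => /eqP ->; by rewrite distrC ltxx.
  by have := ler_distD t y t0; lra.
by rewrite (fill_eq Hd').
Qed.

(** The extension over the singularities is continuous everywhere, and its
    integrals over rows are constant although it may fail to be differentiable
    on isolated rows. *)
Lemma additive_period_eq0 (f : C -> C) (tau c : C) : (forall z, removable f z) ->
  row_regular f ->
  (forall z, \forall w \near z^', f (w + 1) = f w) ->
  (forall z, \forall w \near z^', f (w + tau) = f w + c) -> c = 0.
Proof.
move=> rf reg per qper.
apply: (@quasi_period_eq0 R (fill f) tau c).
- exact: fill_continuous.
- move=> z; rewrite -[RHS]addr0; apply: fill_shift => //.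
  by apply: filterS (per z) => w ->; rewrite addr0.
- by move=> z; exact: fill_shift.
- exact: row_regular_fill.
Qed.

End removable_singularities.

(** * The complex exponential *)

Section exponential.
Variable R : realType.
Notation C := (Cx R).
Implicit Types z w : C.

Lemma expC0 : expC 0 = 1 :> C.
Proof. by rewrite /expC /= expR0 cos0 sin0 mulr1 mulr0. Qed.

Lemma expCD z w : expC (z + w) = expC z * expC w.
Proof.
rewrite /expC cReD cImD expRD cosD sinD.
by apply: complex_ext; rewrite ?cReM ?cImM /=; ring.
Qed.

Lemma expCNK z : expC z * expC (- z) = 1.
Proof. by rewrite -expCD subrr expC0. Qed.

Lemma expC_neq0 z : expC z != 0.
Proof. by apply/eqP => h; have /eqP := expCNK z; rewrite h mul0r eq_sym oner_eq0. Qed.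

Lemma expCN z : expC (- z) = (expC z)^-1.
Proof. by apply: (mulfI (expC_neq0 z)); rewrite expCNK divff// expC_neq0. Qed.

Lemma expCB z w : expC (z - w) = expC z / expC w.
Proof. by rewrite expCD expCN. Qed.

Lemma expC_natmul n z : expC (n%:R * z) = expC z ^+ n.
Proof.
elim: n => [|n IH]; first by rewrite mul0r expC0.
by rewrite -natr1 mulrDl mul1r expCD IH exprSr.
Qed.

Lemma cabs_expC z : cabs (expC z) = expR (complex.Re z).
Proof.
rewrite /expC /cabs /= !exprMn -mulrDr cos2Dsin2 mulr1 sqrtr_sqr.
by rewrite ger0_norm// expR_ge0.
Qed.

Lemma cabs_expC_le z : cabs (expC z) <= expR (cabs z).
Proof. by rewrite cabs_expC ler_expR (le_trans (ler_norm _))// le_Re_cabs. Qed.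

(** The addition theorem reduces this to 0, where the remainder is expressed by
    those of the real exponential, cosine and sine. *)
Lemma is_derive_expC z : is_derive z 1 (@expC R) (expC z).
Proof.
have at0 : is_derive (0 : C) 1 (@expC R) 1.
  apply/is_deriveCP => e e0.
  have d1 := @is_derive_expR R 0; have d2 := @is_derive_cos R 0; have d3 := @is_derive_sin R 0.
  rewrite expR0 in d1; rewrite sin0 oppr0 in d2; rewrite cos0 in d3.
  (* The three error terms add up to at most 7 k cabs h. *)
  have [k [k0 k1 ke]] : exists k : R, [/\ 0 < k, k <= 1 / 2 & k <= e / 7].
    exists (Num.min (e / 7) (1 / 2)).
    by split; [rewrite lt_min !divr_gt0|rewrite ge_min lexx orbT|rewrite ge_min lexx].
  move/is_deriveRP : d1 => /(_ _ k0)[r1 r10 H1].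
  move/is_deriveRP : d2 => /(_ _ k0)[r2 r20 H2].
  move/is_deriveRP : d3 => /(_ _ k0)[r3 r30 H3].
  exists (Num.min (Num.min r1 r2) (Num.min r3 k)); first by rewrite !lt_min r10 r20 r30.
  move=> h; rewrite !lt_min => /andP[/andP[hr1 hr2] /andP[hr3 hk]].
  rewrite add0r expC0 mul1r.
  have ha := le_Re_cabs h; have hb := le_Im_cabs h; have h0 := cabs_ge0 h.
  have {}H1 := H1 _ (le_lt_trans ha hr1).
  have {}H2 := H2 _ (le_lt_trans hb hr2).
  have {}H3 := H3 _ (le_lt_trans hb hr3).
  rewrite !add0r expR0 mul1r in H1; rewrite !add0r cos0 mul0r subr0 in H2.
  rewrite !add0r sin0 subr0 mul1r in H3.
  have bound (u v : R) : `|u| <= cabs h -> `|v| <= k * `|u| -> `|v| <= k * cabs h.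
    by move=> uh vu; apply: le_trans vu _; rewrite ler_pM2l.
  have {}H1 := bound _ _ ha H1; have {}H2 := bound _ _ hb H2; have {}H3 := bound _ _ hb H3.
  set a := complex.Re h in ha H1 *; set b := complex.Im h in hb H2 H3 *.
  have kh : k * cabs h <= 1 / 2 * cabs h by rewrite ler_wpM2r.
  have A1 : `|expR a - 1| <= 2 * cabs h.
    move: H1 ha; rewrite !ler_norml => /andP[q1 q2] /andP[q3 q4].
    apply/andP; split; lra.
  have A2 : `|expR a| <= 2.
    by move: A1; rewrite !ler_norml => /andP[q1 q2]; apply/andP; split; lra.
  have -> : expC h - 1 - h = (expR a)%:C * ((cos b - 1)%:C + iC R * (sin b - b)%:C) +
      (expR a - 1 - a)%:C + (expR a - 1)%:C * (iC R * b%:C).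
    rewrite /expC -/a -/b [h in LHS]cartesianE -/a -/b cplxE.
    by rewrite !rmorphB !rmorphM !rmorph1 /=; ring.
  apply: le_trans (cabsD _ _) _; apply: le_trans (lerD (cabsD _ _) (lexx _)) _.
  rewrite !cabsM !cabs_real cabs_i mul1r.
  have U : cabs ((cos b - 1)%:C + iC R * (sin b - b)%:C) <= 2 * (k * cabs h).
    apply: le_trans (cabsD _ _) _; rewrite cabsM cabs_i mul1r !cabs_real; lra.
  have T1 := ler_pM (normr_ge0 (expR a)) (cabs_ge0 _) A2 U.
  have T3 := ler_pM (normr_ge0 (expR a - 1)) (normr_ge0 b) A1 hb.
  have T4 : 2 * cabs h * cabs h <= 2 * (k * cabs h).
    by rewrite -mulrA ler_pM2l// ler_wpM2r// ltW.
  have T5 : k * cabs h <= e / 7 * cabs h by rewrite ler_wpM2r.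
  lra.
have := is_deriveC_scale (expC z) (is_derive_shiftC (f := @expC R) (z := z) (a := - z) _).
rewrite subrr => /(_ _ at0); rewrite mulr1; apply: is_derive_ext => w.
by rewrite -expCD addrC subrK.
Qed.

Lemma expC_pi : expC (piC R * iC R) = -1.
Proof.
by apply: complex_ext; rewrite /expC /piC /iC /= !mul0r !mulr0 !mulr1 ?subrr ?subr0 ?addr0
  expR0 ?cospi ?sinpi ?mul1r ?oppr0.
Qed.

Lemma expC_2pi : expC (2 * piC R * iC R) = 1.
Proof. by rewrite -mulrA (expC_natmul 2) expC_pi sqrrN expr1n. Qed.

Lemma expC_pihalf : expC (piC R * iC R / 2) = iC R.
Proof.
have -> : piC R * iC R / 2 = 0 +i* (pi / 2) :> C.
  rewrite cplxE /piC rmorphM fmorphV rmorph_nat /=.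
  by rewrite -[0%:C]/(0 : C); ring.
by rewrite /expC /= expR0 cos_pihalf sin_pihalf mulr0 mulr1.
Qed.

Lemma expC_intmul (m : int) z : expC z = 1 -> expC (m%:~R * z) = 1.
Proof.
move=> z1; case: m => n; first by rewrite -pmulrn expC_natmul z1 expr1n.
by rewrite NegzE mulrNz mulNr expCN -pmulrn expC_natmul z1 expr1n invr1.
Qed.

Lemma cos_eq1 (x : R) : 0 <= x < pi *+ 2 -> cos x = 1 -> x = 0.
Proof.
move=> /andP[x0 x2] c1.
have s0 : sin x = 0 by apply: cos1sin0; rewrite c1 normr1.
have [xpi|pix] := ltP x pi.
  have [//|xn0] := eqVneq x 0.
  have : 0 < sin x by apply: sin_gt0_pi; rewrite xpi andbT lt_neqAle eq_sym xn0.
  by rewrite s0 ltxx.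
have [xpi|xpi] := eqVneq x pi; first by move: c1; rewrite xpi cospi; lra.
have : 0 < sin (x - pi).
  apply: sin_gt0_pi; rewrite subr_gt0 lt_neqAle eq_sym xpi pix /=.
  by rewrite ltrBlDr -mulr2n.
by rewrite sinB cospi sinpi s0 mulr0 subr0 mul0r ltxx.
Qed.

(** The modulus determines the real part; after subtraction of a multiple of
    2 pi the imaginary part lies in the interval where the cosine is 1 only at 0. *)
Lemma expC_eq1 z : expC z = 1 -> exists m : int, z = m%:~R * (2 * piC R * iC R).
Proof.
move=> z1.
have re0 : complex.Re z = 0.
  by apply: expR_inj; rewrite expR0 -cabs_expC z1 cabs1.
have pi2 : 0 < pi *+ 2 :> R by rewrite mulrn_wgt0 ?pi_gt0.
pose m := Num.floor (complex.Im z / (pi *+ 2)).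
exists m; set w := _ * _.
have w1 : expC w = 1 by apply: expC_intmul; exact: expC_2pi.
have wE : w = 0 +i* (m%:~R * (pi *+ 2)).
  rewrite cplxE /w /piC rmorphM rmorph_int rmorphMn /= -[0%:C]/(0 : C).
  by rewrite mulr2n; ring.
have zw1 : expC (z - w) = 1 by rewrite expCB z1 w1 divr1.
have zwE : z - w = 0 +i* (complex.Im z - m%:~R * (pi *+ 2)).
  by apply: complex_ext; rewrite wE ?cReD ?cImD ?cReN ?cImN /= ?re0 ?subr0.
apply/eqP; rewrite -subr_eq0 zwE; apply/eqP; congr (_ +i* _).
apply: cos_eq1; last by move: zw1; rewrite zwE /expC /= expR0 mul1r => -[].
have := ge_floor (complex.Im z / (pi *+ 2)); have := lt_succ_floor (complex.Im z / (pi *+ 2)).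
rewrite -/m ltr_pdivrMr// ler_pdivlMr// rmorphD /= mulrDl mul1r => h1 h2.
by apply/andP; split; lra.
Qed.

End exponential.

Arguments expC : simpl never.

(** * Dominated series of complex numbers *)

Section complex_series.
Variable R : realType.
Notation C := (Cx R).

Definition dominated (u : nat -> C) (M : nat -> R) : Prop :=
  cvgn (series M) /\ forall n, cabs (u n) <= M n.

Lemma series_ord (V : zmodType) (u : nat -> V) n : series u n = \sum_(i < n) u i.
Proof. by rewrite seriesEord. Qed.

Lemma series0 (V : zmodType) (u : nat -> V) : series u 0%N = 0.
Proof. by rewrite series_ord big_ord0. Qed.

Lemma series_Re (u : nat -> C) n : complex.Re (series u n) = series (fun k => complex.Re (u k)) n.
Proof.
elim: n => [|n IH]; first by rewrite !series0.
by rewrite !seriesSr cReD IH.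
Qed.

Lemma series_Im (u : nat -> C) n : complex.Im (series u n) = series (fun k => complex.Im (u k)) n.
Proof.
elim: n => [|n IH]; first by rewrite !series0.
by rewrite !seriesSr cImD IH.
Qed.

Lemma dominated_ge0 u M n : dominated u M -> 0 <= M n.
Proof. by move=> [_ uM]; exact: le_trans (cabs_ge0 _) (uM n). Qed.

Lemma dominated_real (v M : nat -> R) : cvgn (series M) -> (forall n, `|v n| <= M n) ->
  cvgn (series v).
Proof.
move=> Mc vM; apply: normed_cvg; apply: (series_le_cvg _ _ vM) => // n.
exact: le_trans (normr_ge0 _) (vM n).
Qed.

Lemma sumC_cvg u M : dominated u M -> series u @ \oo --> sumC u.
Proof.
move=> [Mc uM].
have cr : cvgn (series (fun k => complex.Re (u k))).
  by apply: dominated_real Mc _ => n; exact: le_trans (le_Re_cabs _) (uM n).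
have ci : cvgn (series (fun k => complex.Im (u k))).
  by apply: dominated_real Mc _ => n; exact: le_trans (le_Im_cabs _) (uM n).
have H : series u @ \oo --> (limn (series (fun k => complex.Re (u k))) +i*
    limn (series (fun k => complex.Im (u k))) : C).
  apply: cvgC_ReIm => /=.
    by under eq_fun do rewrite series_Re.
  by under eq_fun do rewrite series_Im.
by rewrite /sumC (cvg_lim _ H).
Qed.

Lemma sumC_unique u (l : C) : series u @ \oo --> l -> sumC u = l.
Proof. by move=> H; rewrite /sumC (cvg_lim _ H). Qed.

Lemma series_le_limn (M : nat -> R) N : cvgn (series M) -> (forall n, 0 <= M n) ->
  series M N <= limn (series M).
Proof.
move=> Mc M0; apply: nondecreasing_cvgn_le Mc N.
by apply: nondecreasing_series => n _ _.
Qed.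

Lemma cabs_series_diff u M n k : dominated u M ->
  cabs (series u (n + k)%N - series u n) <= series M (n + k)%N - series M n.
Proof.
move=> [_ uM]; elim: k => [|k IH]; first by rewrite addn0 !subrr cabs0.
rewrite addnS !seriesSr addrAC [in leRHS]addrAC.
by apply: le_trans (cabsD _ _) _; exact: lerD.
Qed.

Lemma sumC_tail u M N : dominated u M ->
  cabs (sumC u - series u N) <= limn (series M) - series M N.
Proof.
move=> D; have M0 n := dominated_ge0 n D; have [Mc _] := D.
apply/ler_addgt0Pr => e e0.
have /cvgCP/(_ e e0) := sumC_cvg D => -[m _ Hm].
pose n := (N + m)%N; have := Hm n (leq_addl _ _) => /= h.
apply: le_trans (cabs_subD _ _ (series u n)) _; rewrite cabsB addrC.
apply: lerD; last exact: ltW.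
apply: le_trans (cabs_series_diff N m D) _.
by rewrite lerD2r; exact: series_le_limn.
Qed.

(** Dominated convergence for series: the tails are uniformly small, and for
    the finitely many other terms limits can be taken one by one. *)
Lemma tannery (T : Type) (F : set_system T) {FF : Filter F} (u : T -> nat -> C)
    (v : nat -> C) (M : nat -> R) : cvgn (series M) ->
  (\forall t \near F, forall n, cabs (u t n) <= M n) -> (forall n, cabs (v n) <= M n) ->
  (forall n, (fun t => u t n) @ F --> v n) ->
  (fun t => sumC (u t)) @ F --> sumC v.
Proof.
move=> Mc uM vM uv; have Dv : dominated v M by [].
apply/cvgCP => e e0; have e3 : 0 < e / 3 by rewrite divr_gt0.
have /cvgrPdist_lt/(_ _ e3)[N _ /(_ N (leqnn N)) /= HN] := Mc.
have part : (fun t => series (u t) N) @ F --> series v N.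
  elim: {HN}N => [|N IH].
    rewrite series0; under eq_fun do rewrite series0.
    exact: cvgC_cst.
  rewrite seriesSr; under eq_fun do rewrite seriesSr.
  by apply: cvgC_add; [exact: IH|exact: uv].
have /cvgCP/(_ _ e3) := part; move: uM; apply: filterS2 => t uM close.
have Du : dominated (u t) M by [].
have t1 := sumC_tail N Du; have t2 := sumC_tail N Dv.
have hn := ler_norm (limn (series M) - series M N).
apply: (@le_lt_trans _ _ (cabs (sumC (u t) - series (u t) N) +
   (cabs (series (u t) N - series v N) + cabs (series v N - sumC v)))).
  apply: le_trans (cabs_subD _ _ (series (u t) N)) _; rewrite lerD2l.
  exact: cabs_subD.
rewrite (cabsB (series v N)); move: hn HN t1 t2 close.
by set m := limn _ - _; move=> *; lra.
Qed.

Lemma dominatedZ (a : C) u M : dominated u M ->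
  dominated (fun n => a * u n) (fun n => cabs a * M n).
Proof.
move=> [Mc uM]; split=> [|n]; last by rewrite cabsM ler_wpM2l ?cabs_ge0.
exact: (is_cvg_seriesZ (k := cabs a) Mc).
Qed.

Lemma dominatedD u M v N : dominated u M -> dominated v N ->
  dominated (fun n => u n + v n) (fun n => M n + N n).
Proof.
move=> [Mc uM] [Nc vN]; split=> [|n]; last exact: le_trans (cabsD _ _) (lerD _ _).
exact: (is_cvg_seriesD Mc Nc).
Qed.

Lemma sumCD u M v N : dominated u M -> dominated v N ->
  @sumC R (fun n => u n + v n) = sumC u + sumC v.
Proof.
move=> Du Dv; apply: sumC_unique.
have -> : series (fun n => u n + v n) = (fun n => series u n + series v n).
  exact: seriesD.
by apply: cvgC_add; [exact: sumC_cvg Du|exact: sumC_cvg Dv].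
Qed.

Lemma sumCZ (a : C) u M : dominated u M -> @sumC R (fun n => a * u n) = a * sumC u.
Proof.
move=> Du; apply: sumC_unique.
have -> : series (fun n => a * u n) = (fun n => a * series u n).
  by apply/funext => n; rewrite !series_ord mulr_sumr.
by apply: cvgC_mul; [exact: cvgC_cst|exact: sumC_cvg Du].
Qed.

Lemma dominatedS u M : dominated u M -> dominated (fun n => u n.+1) (fun n => M n.+1).
Proof.
move=> [Mc uM]; split=> //; move/cvg_ex : Mc => [l Ml].
apply/cvg_ex; exists (l - M 0%N).
have -> : series (fun n => M n.+1) = (fun n => series M n.+1 - M 0%N).
  apply/funext => n; rewrite !series_ord big_ord_recl /= [M 0%N + _]addrC addrK.
  by apply: eq_bigr => i _.
apply: cvgB; last exact: cvg_cst.
by rewrite (cvg_shiftS (series M)).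
Qed.

Lemma sumC_head (u : nat -> C) M : dominated u M -> sumC u = u 0%N + @sumC R (fun n => u n.+1).
Proof.
move=> Du; apply: sumC_unique.
have H : (fun n => u 0%N + series (fun k => u k.+1) n) @ \oo --> u 0%N + @sumC R (fun k => u k.+1).
  by apply: cvgC_add; [exact: cvgC_cst|exact: sumC_cvg (dominatedS Du)].
rewrite -(cvg_shiftS (series u)).
rewrite (_ : (fun n => series u n.+1) = (fun n => u 0%N + series (fun k => u k.+1) n))//.
by apply/funext => n; rewrite !series_ord big_ord_recl /=.
Qed.

Lemma eq_sumC (u v : nat -> C) : (forall n, u n = v n) -> sumC u = sumC v.
Proof. by move=> /funext->. Qed.

End complex_series.

(** * Rapidly convergent sums of exponentials *)

Opaque sumC.

Section exponential_sums.
Variable R : realType.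
Notation C := (Cx R).
Implicit Types (c a : nat -> C) (z : C).

Definition expsum c a z : C := sumC (fun n => c n * expC (a n * z)).

(** Coefficients decaying faster than every geometric sequence, and
    frequencies growing at most linearly: the series then converges, with all
    its termwise derivatives, locally uniformly on the whole plane. *)
Definition fast c : Prop :=
  forall B : R, 0 <= B -> cvgn (series (fun n => cabs (c n) * B ^+ n)).

Definition lin_growth a : Prop :=
  exists2 A : R, 0 <= A & forall n, cabs (a n) <= A * n.+1%:R.

Lemma leS_expn2 n : n.+1%:R <= 2 ^+ n :> R.
Proof. by rewrite -natrX ler_nat ltn_expl. Qed.

(** A linear factor is absorbed by doubling the base of the geometric sequence. *)
Lemma fast_mul c a : fast c -> lin_growth a -> fast (fun n => c n * a n).
Proof.
move=> fc [A A0 aA] B B0.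
have B2 : 0 <= 2 * B by rewrite mulr_ge0.
have H : cvgn (series (A *: (fun n => cabs (c n) * (2 * B) ^+ n))).
  by apply: is_cvg_seriesZ; exact: fc.
have {}H : cvgn (series (fun n => A * (cabs (c n) * (2 * B) ^+ n))) := H.
apply: (series_le_cvg _ _ _ H) => n.
- by rewrite mulr_ge0 ?cabs_ge0 ?exprn_ge0.
- by rewrite /= mulr_ge0// mulr_ge0 ?cabs_ge0 ?exprn_ge0.
- rewrite (_ : A * _ = cabs (c n) * (A * 2 ^+ n) * B ^+ n); last by rewrite exprMn; ring.
  rewrite ler_wpM2r ?exprn_ge0// cabsM ler_wpM2l ?cabs_ge0//.
  by apply: le_trans (aA n) _; rewrite ler_wpM2l// leS_expn2.
Qed.

Lemma expsum_majorant c a (r : R) : fast c -> lin_growth a -> 0 <= r ->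
  exists M : nat -> R, forall z, cabs z <= r -> dominated (fun n => c n * expC (a n * z)) M.
Proof.
move=> fc [A A0 aA] r0; pose K := expR (A * r).
have H : cvgn (series (fun n => K * (cabs (c n) * K ^+ n))).
  exact: (@is_cvg_seriesZ R _ K (fc K (expR_ge0 _))).
exists (fun n => K * (cabs (c n) * K ^+ n)) => z zr; split=> // n.
rewrite (_ : K * (cabs (c n) * K ^+ n) = cabs (c n) * K ^+ n.+1); last by rewrite exprS; ring.
rewrite cabsM ler_wpM2l ?cabs_ge0//; apply: le_trans (cabs_expC_le _) _.
rewrite /K -expRM_natl ler_expR cabsM.
apply: le_trans (ler_pM (cabs_ge0 _) (cabs_ge0 _) (aA n) zr) _.
by rewrite le_eqVlt; apply/orP; left; apply/eqP; ring.
Qed.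

Lemma expsum_dominated c a z : fast c -> lin_growth a ->
  exists M, dominated (fun n => c n * expC (a n * z)) M.
Proof.
move=> fc la; have [M HM] := expsum_majorant fc la (cabs_ge0 z).
by exists M; exact: HM.
Qed.

Lemma is_derive_quotP (f : C -> C) (z d : C) :
  is_derive z 1 f d <-> (fun h => (f (z + h) - f z) / h) @ 0^' --> d.
Proof.
have quotE (h : C) : h != 0 ->
    cabs ((f (z + h) - f z) / h - d) * cabs h = cabs (f (z + h) - f z - d * h).
  by move=> h0; rewrite -cabsM mulrBl divfK.
split=> [/is_deriveCP H|/cvgCP H].
  apply/cvgCP => e e0; have e2 : 0 < e / 2 by rewrite divr_gt0.
  have [r r0 Hr] := H _ e2; apply/dnbhsCP; exists r => // h h0; rewrite subr0 => hr.
  rewrite -(ltr_pM2r (_ : 0 < cabs h)) ?cabs_gt0// quotE//.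
  apply: le_lt_trans (Hr h hr) _; rewrite ltr_pM2r ?cabs_gt0//; lra.
apply/is_deriveCP => e e0; have /dnbhsCP[r r0 Hr] := H e e0.
exists r => // h hr; have [->|h0] := eqVneq h 0.
  by rewrite addr0 subrr mulr0 subr0 cabs0 mulr0.
rewrite -quotE// ler_pM2r ?cabs_gt0// ltW// Hr// subr0//.
Qed.

Lemma is_derive_expterm (k a z : C) :
  is_derive z 1 (fun w => k * expC (a * w)) (k * a * expC (a * z)).
Proof.
have d1 : is_derive z 1 (fun w => a * w) a.
  have := is_deriveC_scale a (is_deriveC_id z); by rewrite mulr1.
have := is_deriveC_scale k (is_deriveC_comp d1 (is_derive_expC (a * z))).
by rewrite (_ : k * (_ * _) = k * a * expC (a * z)); last ring.
Qed.

(** Termwise differentiation by dominated convergence: by the mean value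
    inequality, twice a majorant of the differentiated series dominates the
    difference quotients. *)
Lemma is_derive_expsum c a z : fast c -> lin_growth a ->
  is_derive z 1 (expsum c a) (expsum (fun n => c n * a n) a z).
Proof.
move=> fc la; have fca := fast_mul fc la; apply/is_derive_quotP.
have r0 : 0 <= cabs z + 1 by rewrite addr_ge0 ?cabs_ge0.
have [M HM] := expsum_majorant fca la r0.
pose u (h : C) n := (c n * expC (a n * (z + h)) - c n * expC (a n * z)) / h.
have -> : (fun h => (expsum c a (z + h) - expsum c a z) / h) = (fun h => sumC (u h)).
  apply/funext => h; have [N1 D1] := expsum_dominated (z + h) fc la.
  have [N2 D2] := expsum_dominated z fc la.
  rewrite /expsum -mulN1r -(sumCZ (-1) D2) -(sumCD D1 (dominatedZ (-1) D2)).
  rewrite mulrC -(sumCZ _ (dominatedD D1 (dominatedZ (-1) D2))).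
  by apply: eq_sumC => n; rewrite /u mulN1r mulrC.
have zle : cabs z <= cabs z + 1 by rewrite lerDl.
have Mc : cvgn (series M) by case: (HM z zle).
have M0 n : 0 <= M n := dominated_ge0 n (HM z zle).
apply: (@tannery R C _ _ u _ (fun n => 2 * M n)).
- exact: (@is_cvg_seriesZ R _ 2 Mc).
- apply/dnbhsCP; exists 1 => // h h0; rewrite subr0 => h1 n.
  have := @mean_value_ineq R (fun w => c n * expC (a n * w))
    (fun w => c n * a n * expC (a n * w)) z h (M n).
  move=> /(_ (fun t _ => is_derive_expterm _ _ _)) mv.
  rewrite /u cabsM cabsV ler_pdivrMr ?cabs_gt0//; apply: mv => t /andP[t0 t1].
  have zt : cabs (z + t%:C * h) <= cabs z + 1.
    apply: le_trans (cabsD _ _) _; rewrite lerD2l cabsM cabs_real ger0_norm//.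
    by apply: mulr_ile1; rewrite ?cabs_ge0// ltW.
  by have [_ H] := HM _ zt; exact: H.
- move=> n; have [_ H] := HM z zle; apply: le_trans (H n) _.
  by rewrite ler_peMl// ler1n.
- by move=> n; have /is_derive_quotP := is_derive_expterm (c n) (a n) z.
Qed.

(** Beyond some rank the Gaussian factor is smaller than [(2 * B) ^- n], which
    leaves the geometric series of ratio 1/2. *)
Lemma fast_gauss c (K r : R) : 0 <= r < 1 -> (forall n, cabs (c n) <= K * r ^+ (n * n)) -> fast c.
Proof.
move=> /andP[r0 r1] cK B B0.
have K0 : 0 <= K.
  by have := le_trans (cabs_ge0 _) (cK 0%N); rewrite muln0 expr0 mulr1.
pose B2 := Num.max 1 (2 * B).
have B21 : 1 <= B2 by rewrite le_max lexx.
have B2B : 2 * B <= B2 by rewrite le_max lexx orbT.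
have [N HN] : exists N, r ^+ N * B2 <= 1.
  have : (fun n => r ^+ n) @ \oo --> (0 : R) by apply: cvg_expr; rewrite ger0_norm.
  move=> /cvgrPdist_lt/(_ (B2^-1)); rewrite invr_gt0 (lt_le_trans _ B21)// => /(_ isT)[N _ HN].
  exists N; have := HN N (leqnn N); rewrite /= sub0r normrN ger0_norm ?exprn_ge0// => /ltW.
  by rewrite -ler_pdivlMr ?div1r// (lt_le_trans _ B21).
have key n : r ^+ (n * n) * (2 * B) ^+ n <= B2 ^+ N.
  rewrite exprM -exprMn.
  have le2 : r ^+ n * (2 * B) <= r ^+ n * B2 by rewrite ler_wpM2l ?exprn_ge0.
  have ge0 : 0 <= r ^+ n * (2 * B) by rewrite !mulr_ge0 ?exprn_ge0.
  have [Nn|nN] := leqP N n.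
    apply: (@le_trans _ _ 1); last exact: exprn_ege1.
    apply: exprn_ile1 => //; apply: le_trans le2 _; apply: le_trans HN.
    by rewrite ler_wpM2r ?(le_trans _ B21)//; apply: ler_wiXn2l => //; exact: ltW.
  apply: (@le_trans _ _ (B2 ^+ n)); last by apply: ler_weXn2l => //; exact: ltnW.
  apply: lerXn2r; rewrite ?nnegrE//; first exact: le_trans B21.
  by apply: le_trans le2 _; rewrite ler_piMl ?(le_trans _ B21)// exprn_ile1// ltW.
have Hg := @is_cvg_geometric_series R (K * B2 ^+ N) (1 / 2) _.
have {}Hg : cvgn (series (geometric (K * B2 ^+ N) (1 / 2))).
  by apply: Hg; rewrite ger0_norm//; lra.
apply: (series_le_cvg _ _ _ Hg) => n.
- by rewrite mulr_ge0 ?cabs_ge0 ?exprn_ge0.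
- by rewrite /= !mulr_ge0 ?exprn_ge0// (le_trans _ B21).
- apply: (@le_trans _ _ (K * r ^+ (n * n) * B ^+ n)).
    by rewrite ler_wpM2r ?exprn_ge0.
  have -> : K * r ^+ (n * n) * B ^+ n = K * (r ^+ (n * n) * (2 * B) ^+ n) * (1 / 2) ^+ n.
    rewrite -!mulrA; do 2 congr (_ * _); rewrite -exprMn; congr (_ ^+ n).
    by field.
  rewrite /=; apply: ler_wpM2r; first by rewrite exprn_ge0.
  by rewrite ler_wpM2l.
Qed.

End exponential_sums.

(** * Infinite products *)

Section infinite_products.
Variable R : realType.
Notation C := (Cx R).
Implicit Types (u : nat -> C) (m : nat -> R).

Definition pprod u N : C := \prod_(i < N) (1 + u i).

(** The infinite product, as the series of the increments of its partial
    products; this puts dominated convergence at its disposal. *)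
Definition prodC u : C := 1 + sumC (fun k => pprod u k * u k).

Lemma pprodS u N : pprod u N.+1 = pprod u N * (1 + u N).
Proof. by rewrite /pprod big_ord_recr. Qed.

Lemma pprod_series u N : pprod u N = 1 + series (fun k => pprod u k * u k) N.
Proof.
elim: N => [|N IH]; first by rewrite /pprod big_ord0 series0 addr0.
by rewrite seriesSr addrA -IH pprodS mulrDr mulr1.
Qed.

Lemma cabs_pprod_le u m N : dominated u m -> cabs (pprod u N) <= expR (limn (series m)).
Proof.
move=> D; have m0 n := dominated_ge0 n D; have [mc um] := D.
apply: (@le_trans _ _ (expR (series m N))); last by rewrite ler_expR series_le_limn.
elim: N => [|N IH]; first by rewrite /pprod big_ord0 cabs1 series0 expR0.
rewrite pprodS cabsM seriesSr expRD; apply: ler_pM; rewrite ?cabs_ge0//.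
apply: le_trans (cabsD _ _) _; rewrite cabs1; apply: le_trans (expR_ge1Dx _).
by rewrite lerD2l.
Qed.

Lemma dominated_pprod u m : dominated u m ->
  dominated (fun k => pprod u k * u k) (fun k => expR (limn (series m)) * m k).
Proof.
move=> D; have [mc um] := D; split=> [|n]; first exact: (@is_cvg_seriesZ R _ _ mc).
by rewrite cabsM; apply: ler_pM; rewrite ?cabs_ge0//; exact: cabs_pprod_le D.
Qed.

Lemma pprod_cvg u m : dominated u m -> pprod u @ \oo --> prodC u.
Proof.
move=> D.
have H : (fun N => 1 + series (fun k => pprod u k * u k) N) @ \oo --> prodC u.
  by apply: cvgC_add; [exact: cvgC_cst|exact: sumC_cvg (dominated_pprod D)].
by rewrite -(funext (pprod_series u)) in H.
Qed.

Lemma prodC_unique u m (l : C) : dominated u m -> pprod u @ \oo --> l -> prodC u = l.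
Proof. by move=> /pprod_cvg D; exact: cvg_unique. Qed.

(** The bound is linear in a tail of the majorant, so that sufficiently late
    partial products stay close to 1. *)
Lemma pprod_near1 u m n k : dominated u m -> series m (n + k)%N - series m n <= 1 / 2 ->
  cabs (pprod (fun i => u (n + i)%N) k - 1) <= 2 * (series m (n + k)%N - series m n).
Proof.
move=> D; have m0 i := dominated_ge0 i D; have [mc um] := D.
elim: k => [|k IH]; first by rewrite addn0 /pprod big_ord0 !subrr cabs0 mulr0.
rewrite addnS seriesSr => small; have mk := m0 (n + k)%N.
have {}IH := IH _; have small' : series m (n + k)%N - series m n <= 1 / 2 by lra.
have {}IH := IH small'.
rewrite pprodS; set P := pprod _ _ in IH *.
have -> : P * (1 + u (n + k)%N) - 1 = (P - 1) + ((P - 1) * u (n + k)%N + u (n + k)%N) by ring.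
apply: le_trans (cabsD _ _) _.
have h : cabs ((P - 1) * u (n + k)%N + u (n + k)%N) <= 2 * m (n + k)%N.
  apply: le_trans (cabsD _ _) _; rewrite cabsM.
  have P1 : cabs (P - 1) <= 1 by lra.
  have := um (n + k)%N; have := ler_pM (cabs_ge0 _) (cabs_ge0 _) P1 (um (n + k)%N).
  lra.
lra.
Qed.

Lemma pprod_cat u n k : pprod u (n + k)%N = pprod u n * pprod (fun i => u (n + i)%N) k.
Proof. by rewrite /pprod big_split_ord. Qed.

(** Far enough the products stay within 1/2 of 1; the finitely many earlier
    factors do not vanish. *)
Lemma pprod_lower u m : dominated u m -> (forall i, 1 + u i != 0) ->
  exists2 e : R, 0 < e & forall N, e <= cabs (pprod u N).
Proof.
move=> D nz; have m0 i := dominated_ge0 i D; have [mc um] := D.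
have /cvgrPdist_lt/(_ (1 / 4)) := mc; rewrite divr_gt0// => /(_ isT)[n _ Hn].
have pn0 N : 0 < cabs (pprod u N).
  rewrite cabs_gt0; apply/prodf_neq0 => i _; exact: nz.
have tail k : cabs (pprod u n) / 2 <= cabs (pprod u (n + k)%N).
  have s1 : series m (n + k)%N - series m n <= 1 / 4.
    have := Hn n (leqnn n); rewrite /= ltr_norml => /andP[_ h].
    by have := series_le_limn (n + k)%N mc m0; lra.
  have s2 : series m (n + k)%N - series m n <= 1 / 2 by lra.
  have near1 := pprod_near1 D s2.
  rewrite pprod_cat cabsM ler_pM2l//; set P := pprod _ k in near1 *.
  have : cabs (1 : C) <= cabs (1 - P) + cabs P by rewrite -{1}(subrK P 1) cabsD.
  by rewrite cabs1 cabsB; lra.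
have [e e0 He] : exists2 e : R, 0 < e & forall N, (N < n)%N -> e <= cabs (pprod u N).
  elim: (n) => [|k [e e0 He]]; first by exists 1.
  exists (Num.min e (cabs (pprod u k))); first by rewrite lt_min e0 pn0.
  move=> N; rewrite ltnS leq_eqVlt => /orP[/eqP->|/He eN]; first by rewrite ge_min lexx orbT.
  by rewrite ge_min eN.
exists (Num.min e (cabs (pprod u n) / 2)); first by rewrite lt_min e0 divr_gt0.
move=> N; have [/He eN|nN] := ltnP N n; first by rewrite ge_min eN.
by rewrite ge_min -(subnKC nN) tail orbT.
Qed.

Lemma prodC_neq0 u m : dominated u m -> (forall i, 1 + u i != 0) -> prodC u != 0.
Proof.
move=> D nz; have [e e0 He] := pprod_lower D nz.
apply/eqP => P0; have /cvgCP/(_ e e0)[N _ /(_ N (leqnn N)) /=] := pprod_cvg D.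
by rewrite P0 subr0 ltNge He.
Qed.

(** A bound on all the partial products turns a majorant of the factors into a
    majorant of the increments, to which dominated convergence applies. *)
Lemma prodC_continuous (T : Type) (F : set_system T) {FF : Filter F} (u : T -> nat -> C)
    (v : nat -> C) m : cvgn (series m) ->
  (\forall t \near F, forall n, cabs (u t n) <= m n) -> (forall n, cabs (v n) <= m n) ->
  (forall n, (fun t => u t n) @ F --> v n) ->
  (fun t => prodC (u t)) @ F --> prodC v.
Proof.
move=> mc um vm uv; apply: cvgC_add; first exact: cvgC_cst.
apply: (tannery (M := fun k => expR (limn (series m)) * m k)).
- exact: (@is_cvg_seriesZ R _ _ mc).
- apply: filterS um => t um n; exact: (dominated_pprod (conj mc um)).2.
- by move=> n; exact: (dominated_pprod (conj mc vm)).2.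
- move=> n; apply: cvgC_mul; last exact: uv.
  elim: n => [|n IH].
    rewrite {2}/pprod big_ord0; under eq_fun do rewrite /pprod big_ord0.
    exact: cvgC_cst.
  rewrite pprodS; under eq_fun do rewrite pprodS.
  apply: cvgC_mul; first exact: IH.
  by apply: cvgC_add; [exact: cvgC_cst|exact: uv].
Qed.

Lemma prodCM u m v n w : dominated u m -> dominated v n ->
  (forall i, (1 + u i) * (1 + v i) = 1 + w i) ->
  pprod w @ \oo --> prodC u * prodC v.
Proof.
move=> Du Dv uvw.
have H : (fun N => pprod u N * pprod v N) @ \oo --> prodC u * prodC v.
  by apply: cvgC_mul; [exact: pprod_cvg Du|exact: pprod_cvg Dv].
rewrite (_ : pprod w = fun N => pprod u N * pprod v N)//.
apply/funext => N; rewrite /pprod -big_split /=; by apply: eq_bigr => i _; rewrite uvw.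
Qed.

Lemma geometric_dominated (a p : C) : cabs p < 1 ->
  dominated (fun n => a * p ^+ n) (fun n => cabs a * cabs p ^+ n).
Proof.
move=> p1; split=> [|n]; last by rewrite cabsM cabsX.
by apply: (@is_cvg_geometric_series R (cabs a) (cabs p)); rewrite ger0_norm ?cabs_ge0.
Qed.

End infinite_products.

(** * Gauss's finite triple product *)

Section finite_triple_product.
Variables (F : fieldType) (q : F).

Definition qpoch (p : F) n : F := \prod_(i < n) (1 - p ^+ i.+1).

Lemma qpochS p n : qpoch p n.+1 = qpoch p n * (1 - p ^+ n.+1).
Proof. by rewrite /qpoch big_ord_recr. Qed.

Lemma qpoch0 p : qpoch p 0 = 1.
Proof. by rewrite /qpoch big_ord0. Qed.

(** The product of the [1 + q ^+ (2 * i).+1 * 'X] for [i < a] and of the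
    [1 + q ^+ (2 * i).+1 / 'X] for [i < b], made a polynomial by multiplying it by
    ['X^b]. *)
Definition gauss_poly a b : {poly F} :=
  (\prod_(i < a) (1 + q ^+ (2 * i).+1 *: 'X)) * \prod_(i < b) ('X + (q ^+ (2 * i).+1)%:P).

Lemma gauss_polySl a b : gauss_poly a.+1 b = gauss_poly a b * (1 + q ^+ (2 * a).+1 *: 'X).
Proof. by rewrite /gauss_poly big_ord_recr /= mulrAC. Qed.

Lemma gauss_polySr a b : gauss_poly a b.+1 = gauss_poly a b * ('X + (q ^+ (2 * b).+1)%:P).
Proof. by rewrite /gauss_poly big_ord_recr /= mulrA. Qed.

Lemma coef_mul_affine (P : {poly F}) c j :
  (P * ('X + c%:P))`_j = (if j is i.+1 then P`_i else 0) + c * P`_j.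
Proof. by rewrite mulrDr coefD coefMX coefMC mulrC; case: j. Qed.

Lemma coef_mul_affine' (P : {poly F}) c j :
  (P * (1 + c *: 'X))`_j = P`_j + c * (if j is i.+1 then P`_i else 0).
Proof. by rewrite mulrDr mulr1 coefD -scalerAr coefZ coefMX; case: j. Qed.

Lemma gauss_poly_big a b j : (a + b < j)%N -> (gauss_poly a b)`_j = 0.
Proof.
elim: b j => [|b IH] j.
  elim: a j => [|a IHa] j; first by rewrite /gauss_poly !big_ord0 mulr1 coef1; case: j.
  case: j => // j; rewrite addSn ltnS => h.
  by rewrite gauss_polySl coef_mul_affine' !IHa ?mulr0 ?addr0//; exact: ltnW.
case: j => // j; rewrite addnS ltnS => h.
by rewrite gauss_polySr coef_mul_affine !IH ?mulr0 ?addr0//; exact: ltnW.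
Qed.

Lemma gauss_poly_coef0 a b : (gauss_poly a b)`_0 = q ^+ (b * b).
Proof.
elim: b => [|b IH].
  elim: a => [|a IHa]; first by rewrite /gauss_poly !big_ord0 mulr1 coef1.
  by rewrite gauss_polySl coef_mul_affine' IHa mulr0 addr0.
rewrite gauss_polySr coef_mul_affine IH add0r -exprD; congr (_ ^+ _).
by rewrite mulSn mulnS; lia.
Qed.

Let qp := qpoch (q ^+ 2).

Lemma qpS n : qp n.+1 = qp n * (1 - q ^+ (2 * n.+1)).
Proof. by rewrite /qp qpochS exprM. Qed.

(** The coefficients are Gaussian binomials times a power of [q]; denominators
    are cleared so that the identity is a polynomial one. *)
Lemma gauss_poly_coef a b j : (j <= a + b)%N ->
  (gauss_poly a b)`_j * q ^+ (2 * (j * b)) * qp j * qp (a + b - j) =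
  q ^+ (j * j + b * b) * qp (a + b).
Proof.
elim: b j => [|b IH] j.
  rewrite addn0; elim: a j => [|a IHa] j.
    by rewrite leqn0 => /eqP->; rewrite gauss_poly_coef0 !muln0 addn0 expr0 /qp qpoch0 !mul1r.
  case: j => [_|j]; first by rewrite gauss_poly_coef0 /qp qpoch0 subn0 !muln0 addn0 expr0 !mul1r.
  rewrite ltnS => ja; rewrite gauss_polySl coef_mul_affine' !muln0 !addn0 !mulr1 subSS.
  have step : (gauss_poly a 0)`_j.+1 * qp j.+1 * qp (a - j) =
      (1 - q ^+ (2 * (a - j))) * q ^+ (j.+1 * j.+1) * qp a.
    have [->|lt] := eqVneq j a.
      by rewrite gauss_poly_big ?addn0// !mul0r subnn muln0 expr0 subrr !mul0r.
    have ja' : (j < a)%N by rewrite ltn_neqAle lt.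
    have H := IHa _ ja'; rewrite !muln0 !addn0 mulr1 in H; rewrite -[RHS]mulrA -H.
    rewrite -(subnSK ja') (qpS (a - j.+1)); ring.
  have := IHa _ ja; rewrite !muln0 !addn0 mulr1 => H.
  rewrite !mulrDl step.
  have -> : q ^+ (2 * a).+1 * (gauss_poly a 0)`_j * qp j.+1 * qp (a - j) =
     q ^+ (2 * a).+1 * (1 - q ^+ (2 * j.+1)) * ((gauss_poly a 0)`_j * qp j * qp (a - j)).
    by rewrite qpS; ring.
  rewrite H qpS.
  have -> : (2 * a).+1 = ((2 * (a - j)) + (2 * j).+1)%N by lia.
  have -> : (2 * a.+1 = 2 * (a - j) + 2 * j.+1)%N by lia.
  have -> : (j.+1 * j.+1 = j * j + (2 * j).+1)%N by lia.
  rewrite !exprD; ring.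
rewrite addnS; case: j => [_|j].
  by rewrite gauss_poly_coef0 /qp qpoch0 subn0 mul0n muln0 add0n !mulr1.
rewrite ltnS => jab; rewrite gauss_polySr coef_mul_affine subSS.
have step : (gauss_poly a b)`_j.+1 * q ^+ (2 * (j.+1 * b)) * qp j.+1 * qp (a + b - j) =
    (1 - q ^+ (2 * (a + b - j))) * q ^+ (j.+1 * j.+1 + b * b) * qp (a + b).
  have [->|lt] := eqVneq j (a + b)%N.
    by rewrite gauss_poly_big// !mul0r subnn muln0 expr0 subrr !mul0r.
  have ja' : (j < a + b)%N by rewrite ltn_neqAle lt.
  have H := IH _ ja'; rewrite -[RHS]mulrA -H.
  rewrite -(subnSK ja') (qpS (a + b - j.+1)); ring.
have H := IH _ jab.
rewrite !mulrDl.
have -> : (gauss_poly a b)`_j * q ^+ (2 * (j.+1 * b.+1)) * qp j.+1 * qp (a + b - j) =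
   q ^+ (2 * (j + b).+1) * (1 - q ^+ (2 * j.+1)) *
     ((gauss_poly a b)`_j * q ^+ (2 * (j * b)) * qp j * qp (a + b - j)).
  have -> : (2 * (j.+1 * b.+1) = 2 * (j + b).+1 + 2 * (j * b))%N by lia.
  by rewrite qpS exprD; ring.
have -> : q ^+ (2 * b).+1 * (gauss_poly a b)`_j.+1 * q ^+ (2 * (j.+1 * b.+1)) * qp j.+1 * qp (a + b - j) =
   q ^+ ((2 * b).+1 + 2 * j.+1) *
    ((gauss_poly a b)`_j.+1 * q ^+ (2 * (j.+1 * b)) * qp j.+1 * qp (a + b - j)).
  have -> : (2 * (j.+1 * b.+1) = 2 * j.+1 + 2 * (j.+1 * b))%N by lia.
  by rewrite !exprD; ring.
rewrite H step qpS.
have -> : (2 * (a + b).+1 = 2 * (a + b - j) + 2 * j.+1)%N by lia.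
have -> : (j.+1 * j.+1 + b.+1 * b.+1 = (2 * (j + b).+1) + (j * j + b * b))%N by lia.
have -> : (j.+1 * j.+1 + b * b = (2 * j).+1 + (j * j + b * b))%N by lia.
have -> : (2 * (j + b).+1 = 2 * j + (2 * b).+2)%N by lia.
have -> : (2 * j.+1 = (2 * j).+2)%N by lia.
have D k : q ^+ (2 * k) = q ^+ k * q ^+ k by rewrite mul2n -addnn exprD.
rewrite !exprD !exprS expr0 !D; ring.
Qed.

Hypothesis q0 : q != 0.
Hypothesis qp_neq0 : forall n, qp n != 0.

(** The factor by which a coefficient of the finite triple product differs from
    that of the theta series; it tends to 1 as [N] grows. *)
Definition gauss_ratio N n : F := qp (N + N) * qp N / (qp (N + n) * qp (N - n)).

Lemma gauss_poly_upper N n : (n <= N)%N ->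
  qp N * (gauss_poly N N)`_(N + n) = q ^+ (n * n) * gauss_ratio N n.
Proof.
move=> nN; have h : (N + n <= N + N)%N by rewrite leq_add2l.
have := gauss_poly_coef h.
have -> : (N + N - (N + n) = N - n)%N by lia.
have -> : ((N + n) * (N + n) + N * N = n * n + 2 * ((N + n) * N))%N by lia.
move=> H; have qn : q ^+ (2 * ((N + n) * N)) != 0 by rewrite expf_neq0.
apply: (mulIf (mulf_neq0 qn (mulf_neq0 (qp_neq0 (N + n)) (qp_neq0 (N - n))))).
have -> : qp N * (gauss_poly N N)`_(N + n) *
   (q ^+ (2 * ((N + n) * N)) * (qp (N + n) * qp (N - n))) =
   qp N * ((gauss_poly N N)`_(N + n) * q ^+ (2 * ((N + n) * N)) * qp (N + n) * qp (N - n)) by ring.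
rewrite H exprD /gauss_ratio; field.
by rewrite !qp_neq0.
Qed.

Lemma gauss_poly_lower N n : (n <= N)%N ->
  qp N * (gauss_poly N N)`_(N - n) = q ^+ (n * n) * gauss_ratio N n.
Proof.
move=> nN; have h : (N - n <= N + N)%N by lia.
have := gauss_poly_coef h.
have -> : (N + N - (N - n) = N + n)%N by lia.
have -> : ((N - n) * (N - n) + N * N = n * n + 2 * ((N - n) * N))%N by nia.
move=> H; have qn : q ^+ (2 * ((N - n) * N)) != 0 by rewrite expf_neq0.
apply: (mulIf (mulf_neq0 qn (mulf_neq0 (qp_neq0 (N - n)) (qp_neq0 (N + n))))).
have -> : qp N * (gauss_poly N N)`_(N - n) *
   (q ^+ (2 * ((N - n) * N)) * (qp (N - n) * qp (N + n))) =
   qp N * ((gauss_poly N N)`_(N - n) * q ^+ (2 * ((N - n) * N)) * qp (N - n) * qp (N + n)) by ring.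
rewrite H exprD /gauss_ratio; field.
by rewrite !qp_neq0.
Qed.

(** Evaluate the polynomial at [w]: its coefficients are symmetric about the
    middle one. *)
Lemma finite_triple_product N (w w' : F) : w * w' = 1 ->
  \prod_(i < N) ((1 - q ^+ (2 * i.+1)) * ((1 + w * q ^+ (2 * i).+1) * (1 + w' * q ^+ (2 * i).+1))) =
  gauss_ratio N 0 +
  \sum_(n < N) q ^+ (n.+1 * n.+1) * gauss_ratio N n.+1 * (w ^+ n.+1 + w' ^+ n.+1).
Proof.
move=> ww.
have w0 : w != 0 by apply: contra_eq_neq ww => ->; rewrite mul0r eq_sym oner_neq0.
have wX k : w ^+ k * w' ^+ k = 1 by rewrite -exprMn ww expr1n.
apply: (mulfI (expf_neq0 N w0)).
have -> : w ^+ N * \prod_(i < N) ((1 - q ^+ (2 * i.+1)) *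
   ((1 + w * q ^+ (2 * i).+1) * (1 + w' * q ^+ (2 * i).+1))) = qp N * (gauss_poly N N).[w].
  rewrite -[in w ^+ N](card_ord N) -prodr_const -big_split /= /qp /qpoch /gauss_poly.
  rewrite hornerM !horner_prod -!big_split /=; apply: eq_bigr => i _.
  rewrite !hornerE exprM.
  have -> : w + q ^+ (2 * i).+1 = w * (1 + w' * q ^+ (2 * i).+1).
    by rewrite mulrDr mulr1 mulrA ww mul1r.
  rewrite /=; ring.
rewrite (@horner_coef_wide _ (N + N).+1); last first.
  by apply/leq_sizeP => j; exact: gauss_poly_big.
rewrite mulr_sumr -(addnS N N) big_split_ord /= big_ord_recl /= addn0.
have Nw (k : nat) : (k <= N)%N -> w ^+ (N - k) = w ^+ N * w' ^+ k.
  by move=> kN; rewrite -{2}(subnK kN) exprD -mulrA wX mulr1.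
rewrite mulrDr mulr_sumr addrCA.
have -> : qp N * ((gauss_poly N N)`_N * w ^+ N) = w ^+ N * gauss_ratio N 0.
  by have := @gauss_poly_upper N 0 (leq0n N); rewrite addn0 muln0 mul1r => <-; ring.
congr (_ + _).
rewrite (reindex_inj rev_ord_inj) /= -big_split /=; apply: eq_bigr => i _.
rewrite /bump /= add1n.
rewrite Nw ?ltn_ord// (exprD w N i.+1) !mulrA gauss_poly_lower ?ltn_ord// gauss_poly_upper ?ltn_ord//.
rewrite /gauss_ratio; ring.
Qed.

End finite_triple_product.

(** * Jacobi's triple product *)

Section triple_product.
Variable R : realType.
Notation C := (Cx R).

(** Truncation only replaces terms by 0, so that the same majorant serves. *)
Lemma tannery_partial (u : nat -> nat -> C) (v : nat -> C) (M : nat -> R) :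
  cvgn (series M) -> (forall N n, cabs (u N n) <= M n) -> (forall n, cabs (v n) <= M n) ->
  (forall n, (fun N => u N n) @ \oo --> v n) ->
  (fun N => series (u N) N) @ \oo --> sumC v.
Proof.
move=> Mc uM vM uv; pose u' N n := if (n < N)%N then u N n else 0.
have -> : (fun N => series (u N) N) = (fun N => sumC (u' N)).
  apply/funext => N; apply/esym/sumC_unique; apply/cvgCP => e e0.
  exists N => // m /= Nm.
  rewrite (_ : series (u' N) m = series (u N) N) ?subrr ?cabs0//.
  rewrite !series_ord -(subnKC Nm) big_split_ord /= [X in _ + X]big1 ?addr0 => [|i _].
    by apply: eq_bigr => i _; rewrite /u' ltn_ord.
  by rewrite /u' ltnNge leq_addr.
apply: (tannery Mc) => //.
  apply: nearW => N n; rewrite /u'; case: ifP => // _.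
  by rewrite cabs0; exact: le_trans (cabs_ge0 _) (vM n).
move=> n; apply/cvgCP => e e0; have /cvgCP/(_ e e0)[N0 _ H] := uv n.
exists (maxn N0 n.+1) => // N /=; rewrite geq_max => /andP[h1 h2].
by rewrite /u' h2; exact: H.
Qed.

Variable q : C.
Hypothesis q0 : q != 0.
Hypothesis q1 : cabs q < 1.
Let p := q ^+ 2.

Lemma cabs_p : cabs p < 1.
Proof. by rewrite /p cabsX exprn_ilt1// ?cabs_ge0. Qed.

Lemma dominated_qpoch :
  dominated (fun k => - p ^+ k.+1) (fun k => cabs p * cabs p ^+ k).
Proof.
have [c m] := geometric_dominated (- p) cabs_p.
by rewrite cabsN in c m; split => // n; rewrite exprS -mulNr; exact: m.
Qed.

Definition euler_phi : C := prodC (fun k => - p ^+ k.+1).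

Lemma pow_neq1 k : 1 - q ^+ k.+1 != 0.
Proof.
rewrite subr_eq0; apply/eqP => h.
have : cabs (q ^+ k.+1) < 1 by rewrite cabsX exprn_ilt1 ?cabs_ge0.
by rewrite -h cabs1 ltxx.
Qed.

Lemma qfactor_neq0 k : 1 + - p ^+ k.+1 != 0.
Proof. by rewrite /p -exprM mulnS; exact: pow_neq1. Qed.

Lemma euler_phi_neq0 : euler_phi != 0.
Proof. exact: prodC_neq0 dominated_qpoch qfactor_neq0. Qed.

Lemma qpoch_neq0 n : qpoch p n != 0.
Proof. by apply/prodf_neq0 => i _; exact: qfactor_neq0. Qed.

Lemma qpoch_cvg : qpoch p @ \oo --> euler_phi.
Proof. exact: pprod_cvg dominated_qpoch. Qed.

Lemma cvg_subseq (u : nat -> C) (l : C) (s : nat -> nat) :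
  u @ \oo --> l -> (forall m, exists N, forall n, (N <= n)%N -> (m <= s n)%N) ->
  (fun n => u (s n)) @ \oo --> l.
Proof.
move=> /cvgCP ul Hs; apply/cvgCP => e e0; have [m _ Hm] := ul e e0.
by have [N HN] := Hs m; exists N => // n /= /HN; exact: Hm.
Qed.

Lemma gauss_ratio_cvg n : (fun N => gauss_ratio q N n) @ \oo --> (1 : C).
Proof.
have phi0 := euler_phi_neq0.
have -> : (1 : C) = euler_phi * euler_phi * (euler_phi * euler_phi)^-1.
  by rewrite divff// mulf_neq0.
apply: cvgC_mul; first apply: cvgC_mul.
- by apply: (cvg_subseq (s := fun N => (N + N)%N) qpoch_cvg) => m; exists m => k mk; lia.
- exact: qpoch_cvg.
apply: cvgC_inv; first by rewrite mulf_neq0.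
apply: cvgC_mul.
- by apply: (cvg_subseq (s := fun N => (N + n)%N) qpoch_cvg) => m; exists m => k mk; lia.
- by apply: (cvg_subseq (s := fun N => (N - n)%N) qpoch_cvg) => m; exists (m + n)%N => k mk; lia.
Qed.

Lemma gauss_ratio_bounded : exists2 K : R, 1 <= K & forall N n, cabs (gauss_ratio q N n) <= K.
Proof.
have D := dominated_qpoch.
have [e e0 He] := pprod_lower D qfactor_neq0.
set B := expR (limn (series (fun k => cabs p * cabs p ^+ k))).
have HB n : cabs (qpoch p n) <= B by exact: (cabs_pprod_le n D).
exists (Num.max 1 (B * B / (e * e))) => [|N n]; first by rewrite le_max lexx.
rewrite le_max; apply/orP; right.
rewrite /gauss_ratio cabsM cabsV !cabsM; apply: ler_pM; rewrite ?invr_ge0 ?mulr_ge0 ?cabs_ge0//.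
  by apply: ler_pM; rewrite ?cabs_ge0.
rewrite lef_pV2 ?posrE ?mulr_gt0 ?cabs_gt0 ?qpoch_neq0//.
exact: (ler_pM (ltW e0) (ltW e0) (He _) (He _)).
Qed.

Lemma fast_square k : fast (fun n => q ^+ (n * n + k * n)).
Proof.
apply: (@fast_gauss R _ 1 (cabs q)); first by rewrite cabs_ge0.
move=> n; rewrite cabsX mul1r; apply: ler_wiXn2l; rewrite ?cabs_ge0 ?(ltW q1)//.
exact: leq_addr.
Qed.

Lemma dominated_pow c (w : C) : fast c ->
  dominated (fun n => c n * w ^+ n) (fun n => cabs (c n) * cabs w ^+ n).
Proof. by move=> fc; split=> [|n]; [apply: fc; exact: cabs_ge0|rewrite cabsM cabsX]. Qed.

Lemma dominated_square (w : C) : exists M, dominated (fun n => q ^+ (n.+1 * n.+1) * w ^+ n.+1) M.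
Proof.
have D := dominatedS (dominated_pow w (@fast_square 0)).
eexists; case: D => Mc uM; split; first exact: Mc.
by move=> n; have := uM n; rewrite mul0n addn0.
Qed.

Lemma dominated_qprod (w : C) :
  dominated (fun k => w * q ^+ (2 * k).+1) (fun k => cabs (w * q) * cabs p ^+ k).
Proof.
have [c m] := geometric_dominated (w * q) cabs_p.
by split=> // n; have := m n; rewrite -mulrA exprS /p exprM.
Qed.

(** The limit of the finite form: on the side of the sum by dominated
    convergence, the ratios of q-factorials being bounded and tending to 1. *)
Theorem jacobi_triple_product (w w' : C) : w * w' = 1 ->
  1 + sumC (fun n => q ^+ (n.+1 * n.+1) * (w ^+ n.+1 + w' ^+ n.+1)) =
  euler_phi * (prodC (fun k => w * q ^+ (2 * k).+1) * prodC (fun k => w' * q ^+ (2 * k).+1)).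
Proof.
move=> ww; pose lhs N := gauss_ratio q N 0 +
  series (fun n => q ^+ (n.+1 * n.+1) * gauss_ratio q N n.+1 * (w ^+ n.+1 + w' ^+ n.+1)) N.
have L1 : lhs @ \oo --> (1 + sumC (fun n => q ^+ (n.+1 * n.+1) * (w ^+ n.+1 + w' ^+ n.+1)) : C).
  apply: cvgC_add; first exact: gauss_ratio_cvg.
  have [K K1 HK] := gauss_ratio_bounded.
  have [M1 D1] := dominated_square w; have [M2 D2] := dominated_square w'.
  have [c m] := dominatedD D1 D2.
  apply: (tannery_partial (M := fun n => K * (M1 n + M2 n))).
  - exact: (@is_cvg_seriesZ R _ K c).
  - move=> N n; have mn := m n; rewrite -mulrDr in mn.
    rewrite (_ : _ * _ = gauss_ratio q N n.+1 *
      (q ^+ (n.+1 * n.+1) * (w ^+ n.+1 + w' ^+ n.+1))); last by ring.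
    by rewrite cabsM; apply: ler_pM; rewrite ?cabs_ge0.
  - move=> n; have mn := m n; rewrite -mulrDr in mn; apply: le_trans mn _.
    by rewrite ler_peMl// addr_ge0 ?(dominated_ge0 _ D1) ?(dominated_ge0 _ D2).
  - move=> n; set b := w ^+ n.+1 + w' ^+ n.+1.
    have H : (fun N => q ^+ (n.+1 * n.+1) * gauss_ratio q N n.+1 * b) @ \oo -->
        q ^+ (n.+1 * n.+1) * 1 * b.
      apply: cvgC_mul; last exact: cvgC_cst.
      by apply: cvgC_mul; [exact: cvgC_cst|exact: gauss_ratio_cvg].
    by rewrite mulr1 in H.
have L2 : lhs @ \oo --> euler_phi * (prodC (fun k => w * q ^+ (2 * k).+1) * prodC (fun k => w' * q ^+ (2 * k).+1)).
  have H : (fun N => qpoch p N * (pprod (fun k => w * q ^+ (2 * k).+1) N *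
     pprod (fun k => w' * q ^+ (2 * k).+1) N)) @ \oo -->
     euler_phi * (prodC (fun k => w * q ^+ (2 * k).+1) * prodC (fun k => w' * q ^+ (2 * k).+1)).
    apply: cvgC_mul; first exact: qpoch_cvg.
    by apply: cvgC_mul; [exact: pprod_cvg (dominated_qprod w)|exact: pprod_cvg (dominated_qprod w')].
  rewrite (_ : lhs = (fun N => qpoch p N * (pprod (fun k => w * q ^+ (2 * k).+1) N *
     pprod (fun k => w' * q ^+ (2 * k).+1) N)))//.
  apply/funext => N; rewrite /lhs series_ord -(finite_triple_product q0 qpoch_neq0)//.
  by rewrite /qpoch /pprod -!big_split /=; apply: eq_bigr => i _; rewrite /p exprM.
exact: cvg_unique L1 L2.
Qed.

End triple_product.

(** * Theta functions and shifts by half periods *)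

Local Opaque sumC expC.

Definition epi (R : realType) (z : Cx R) : Cx R := expC (piC R * iC R * z).
Definition epi2 (R : realType) (z : Cx R) : Cx R := expC (2 * piC R * iC R * z).

Section theta_functions.
Variable R : realType.
Notation C := (Cx R).
Variable tau : C.
Hypothesis tau_im : 0 < complex.Im tau.
Local Notation P := (piC R).
Local Notation I := (iC R).
Local Notation q := (nome tau).
Local Notation q4 := (nome4 tau).
Local Notation E := (@epi2 R).
Local Notation e := (@epi R).

Lemma nome_neq0 : q != 0. Proof. exact: expC_neq0. Qed.
Lemma nome4_neq0 : q4 != 0. Proof. exact: expC_neq0. Qed.

Lemma nome_lt1 : cabs q < 1.
Proof.
rewrite cabs_expC -expR0 ltr_expR.
rewrite (_ : complex.Re _ = - (pi * complex.Im tau)) ?oppr_lt0 ?mulr_gt0 ?pi_gt0//.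
by rewrite !cReM cImM /=; ring.
Qed.

Lemma nome4X4 : q4 ^+ 4 = q.
Proof. by rewrite /nome4 -expC_natmul /nome; congr expC; field. Qed.

Lemma eNK (z : C) : e z * e (- z) = 1.
Proof. by rewrite /epi -expCD -mulrDr subrr mulr0 expC0. Qed.

Lemma eD (a b : C) : e (a + b) = e a * e b.
Proof. by rewrite /epi mulrDr expCD. Qed.

Lemma invI : I^-1 = - I.
Proof.
have I0 : I != 0 by rewrite -cabs_eq0 cabs_i oner_eq0.
by apply: (mulfI I0); rewrite divff// mulrN iC2 opprK.
Qed.

Lemma ENK (z : C) : E z * E (- z) = 1.
Proof. by rewrite /epi2 -expCD -mulrDr subrr mulr0 expC0. Qed.

Lemma E_e (z : C) : E z = e z ^+ 2.
Proof. by rewrite /epi2 /epi -expC_natmul; congr expC; ring. Qed.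

Lemma e_half : e (1 / 2) = I.
Proof. by rewrite /epi -[RHS]expC_pihalf; congr expC; field. Qed.

Lemma e_Nhalf : e (- (1 / 2)) = - I.
Proof.
by apply: (mulfI (expC_neq0 _ : e (1 / 2) != 0)); rewrite eNK e_half mulrN iC2 opprK.
Qed.

Lemma e_1 : e 1 = -1.
Proof. by rewrite /epi mulr1 expC_pi. Qed.

Lemma e_tauhalf : e (tau / 2) = q4 ^+ 2.
Proof. by rewrite /epi /nome4 -expC_natmul; congr expC; field. Qed.

Lemma e_Ntauhalf : e (- (tau / 2)) = (q4 ^+ 2)^-1.
Proof. by rewrite -e_tauhalf /epi mulrN expCN. Qed.

Lemma cosC_pow (k : nat) (z w : C) : I * w = k%:R * (P * I * z) ->
  cosC w = (e z ^+ k + e (- z) ^+ k) / 2.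
Proof.
by move=> h; rewrite /cosC h /epi -!expC_natmul; congr ((_ + expC _) / 2); ring.
Qed.

Lemma sinC_pow (k : nat) (z w : C) : I * w = k%:R * (P * I * z) ->
  sinC w = (e z ^+ k - e (- z) ^+ k) / (2 * I).
Proof.
by move=> h; rewrite /sinC h /epi -!expC_natmul; congr ((_ - expC _) / _); ring.
Qed.

Lemma fast_theta1 (k : C) (s : nat -> nat) :
  fast (fun n => k * ((-1) ^+ s n * q ^+ (n * n.+1))).
Proof.
apply: (@fast_gauss R _ (cabs k) (cabs q)); first by rewrite cabs_ge0 nome_lt1.
move=> n; rewrite cabsM ler_wpM2l ?cabs_ge0// cabsM !cabsX cabsN cabs1 expr1n mul1r.
by apply: ler_wiXn2l; rewrite ?cabs_ge0 ?(ltW nome_lt1)// leq_mul.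
Qed.

Lemma dominated_odd (k : C) (w : C) (s : bool) :
  exists M, dominated (fun n => k * ((-1) ^+ (s * n)%N * q ^+ (n * n.+1)) * w ^+ (2 * n).+1) M.
Proof.
have fc := @fast_theta1 k (fun n => (s * n)%N).
have D := dominatedZ w (dominated_pow (w ^+ 2) fc).
eexists; case: D => Mc uM; split; first exact: Mc.
move=> n; have := uM n; rewrite -exprM.
by rewrite (_ : w * (k * _ * w ^+ (2 * n)) = k * ((-1) ^+ (s * n)%N * q ^+ (n * n.+1)) * w ^+ (2 * n).+1);
   last (rewrite exprS; ring).
Qed.

Lemma theta2_series (z : C) : theta2 tau z =
  q4 * sumC (fun n => q ^+ (n * n.+1) * (e z ^+ (2 * n).+1 + e (- z) ^+ (2 * n).+1)).
Proof.
have [M1 D1] := dominated_odd 1 (e z) false; have [M2 D2] := dominated_odd 1 (e (- z)) false.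
rewrite /theta2.
rewrite (@eq_sumC R _ (fun n => 2^-1 * (1 * ((-1) ^+ (false * n)%N * q ^+ (n * n.+1)) * e z ^+ (2 * n).+1 +
   1 * ((-1) ^+ (false * n)%N * q ^+ (n * n.+1)) * e (- z) ^+ (2 * n).+1))).
  rewrite (sumCZ _ (dominatedD D1 D2)) mulrACA divff ?pnatr_eq0// mul1r.
  by congr (_ * _); apply: eq_sumC => n; rewrite mul0n expr0; ring.
move=> n; rewrite (@cosC_pow (2 * n).+1 z); last by ring.
by rewrite mul0n expr0; ring.
Qed.

Lemma theta3_series (z : C) : theta3 tau z =
  1 + sumC (fun n => q ^+ (n.+1 * n.+1) * (E z ^+ n.+1 + E (- z) ^+ n.+1)).
Proof.
have [M1 D1] := dominated_square nome_lt1 (E z).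
have [M2 D2] := dominated_square nome_lt1 (E (- z)).
rewrite /theta3; congr (_ + _).
rewrite (@eq_sumC R _ (fun n => 2^-1 * (q ^+ (n.+1 * n.+1) * E z ^+ n.+1 +
   q ^+ (n.+1 * n.+1) * E (- z) ^+ n.+1))).
  rewrite (sumCZ _ (dominatedD D1 D2)) mulrA divff ?pnatr_eq0// mul1r.
  by apply: eq_sumC => n; ring.
move=> n; rewrite (@cosC_pow (2 * n.+1) z); last by rewrite natrM; ring.
by rewrite !E_e -!exprM mulnn; ring.
Qed.

Lemma theta4_theta3 (z : C) : theta4 tau z = theta3 tau (z + 1 / 2).
Proof.
rewrite /theta4 /theta3; congr (1 + 2 * _); apply: eq_sumC => n.
rewrite -mulrA mulrCA; congr (_ * _).
rewrite (@cosC_pow (2 * n.+1) z); last by rewrite natrM; ring.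
rewrite (@cosC_pow (2 * n.+1) (z + 1 / 2)); last by rewrite natrM; ring.
have half : e (1 / 2) ^+ 2 = -1 by rewrite e_half expr2 iC2.
have halfN : e (- (1 / 2)) ^+ 2 = -1 by rewrite e_Nhalf sqrrN expr2 iC2.
by rewrite opprD !eD !exprMn ![e _ ^+ (2 * n.+1)]exprM half halfN; ring.
Qed.

Lemma theta1_theta2 (z : C) : theta1 tau z = theta2 tau (z - 1 / 2).
Proof.
rewrite /theta1 /theta2; congr (_ * _); apply: eq_sumC => n.
rewrite -mulrA mulrCA; congr (_ * _).
rewrite (@sinC_pow (2 * n).+1 z); last by ring.
rewrite (@cosC_pow (2 * n).+1 (z - 1 / 2)); last by ring.
have Ik : I ^+ (2 * n).+1 = (-1) ^+ n * I by rewrite exprSr exprM expr2 iC2.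
have Ik' : (- I) ^+ (2 * n).+1 = - ((-1) ^+ n * I) by rewrite exprSr exprM sqrrN expr2 iC2 mulrN.
rewrite opprB [1 / 2 - z]addrC !eD e_half e_Nhalf !exprMn Ik Ik'.
rewrite invfM invI; ring.
Qed.

Lemma theta3_even (z : C) : theta3 tau (- z) = theta3 tau z.
Proof.
rewrite !theta3_series opprK; apply: (f_equal (fun x => 1 + x)); apply: eq_sumC => n.
by rewrite [E (- z) ^+ _ + _]addrC.
Qed.

Lemma theta2_even (z : C) : theta2 tau (- z) = theta2 tau z.
Proof.
rewrite !theta2_series opprK; apply: (f_equal (fun x => q4 * x)); apply: eq_sumC => n.
by rewrite [e (- z) ^+ _ + _]addrC.
Qed.

Lemma dominated_theta2 (w w' : C) :
  exists M, dominated (fun n => q ^+ (n * n.+1) * (w ^+ (2 * n).+1 + w' ^+ (2 * n).+1)) M.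
Proof.
have [M1 D1] := dominated_odd 1 w false; have [M2 D2] := dominated_odd 1 w' false.
have [Mc uM] := dominatedD D1 D2; exists (fun n => M1 n + M2 n); split; first exact: Mc.
by move=> n; have := uM n; rewrite mul0n expr0 !mul1r -mulrDr.
Qed.

Lemma e_add1 (z : C) : e (z + 1) = - e z.
Proof. by rewrite eD e_1 mulrN1. Qed.

Lemma e_Nadd1 (z : C) : e (- (z + 1)) = - e (- z).
Proof.
rewrite opprD eD (_ : e (-1) = -1) ?mulrN1//.
by rewrite /epi mulrN1 expCN expC_pi invrN1.
Qed.

Lemma theta3_add1 (z : C) : theta3 tau (z + 1) = theta3 tau z.
Proof.
rewrite !theta3_series; apply: (f_equal (fun x => 1 + x)); apply: eq_sumC => n.
by rewrite !E_e e_add1 e_Nadd1 !sqrrN.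
Qed.

Lemma theta2_add1 (z : C) : theta2 tau (z + 1) = - theta2 tau z.
Proof.
have [M D] := dominated_theta2 (e z) (e (- z)).
rewrite (theta2_series z) (theta2_series (z + 1)) -mulrN; apply: (f_equal (fun x => q4 * x)).
rewrite -mulN1r; apply: etrans (sumCZ (-1) D); apply: eq_sumC => n.
rewrite e_add1 e_Nadd1; move: (e z) (e (- z)) => x y.
rewrite !exprS !exprM !sqrrN; ring.
Qed.

(** Both series run over all integers, folded about the middle. The shift by
    [tau / 2] moves the fold by one half, so that exactly one term changes sides. *)
Lemma theta2_theta3 (z : C) : theta2 tau z = q4 * e z * theta3 tau (z + tau / 2).
Proof.
have q0 := nome_neq0; have q40 := nome4_neq0.
have eq2 : q4 ^+ 2 * q4 ^+ 2 = q by rewrite -exprD nome4X4.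
have Ep : E (z + tau / 2) = e z ^+ 2 * q by rewrite E_e eD e_tauhalf exprMn -eq2; ring.
have En : E (- (z + tau / 2)) = e (- z) ^+ 2 / q.
  by rewrite E_e opprD eD e_Ntauhalf exprMn -eq2; field.
have [M1 D1] := dominated_odd 1 (e z) false; have [M2 D2] := dominated_odd 1 (e (- z)) false.
have [M3 D3] := dominated_square nome_lt1 (E (z + tau / 2)).
have [M4 D4] := dominated_square nome_lt1 (E (- (z + tau / 2))).
pose A n := q ^+ (n * n.+1) * e z ^+ (2 * n).
have eA : forall n, e z * A n = 1 * ((-1) ^+ (false * n)%N * q ^+ (n * n.+1)) * e z ^+ (2 * n).+1.
  by move=> n; rewrite /A mul0n expr0 exprS; ring.
have e0 : e z != 0 := expC_neq0 _.
have [MA DA] : exists M, dominated A M.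
  have D := dominatedZ (e z)^-1 D1; eexists; case: D => Mc uM; split; first exact: Mc.
  by move=> n; have := uM n; rewrite -eA mulKf.
rewrite theta2_series theta3_series -mulrA; congr (_ * _).
rewrite (@eq_sumC R _ (fun n => e z * A n + e z * (q ^+ (n.+1 * n.+1) * E (- (z + tau / 2)) ^+ n.+1))).
  have DA' := dominatedZ (e z) DA; have D4' := dominatedZ (e z) D4.
  rewrite (sumCD DA' D4') (sumCZ _ DA) (sumCZ _ D4) -mulrDr; congr (_ * _).
  rewrite (sumC_head DA) {1}/A mul0n muln0 !expr0 mulr1 -addrA; congr (_ + _).
  rewrite -(sumCD (dominatedS DA) D4); apply: eq_sumC => n.
  rewrite mulrDr; congr (_ + _); rewrite /A Ep exprMn -exprM.
  by rewrite (_ : (n.+1 * n.+2 = n.+1 * n.+1 + n.+1)%N) ?exprD; [ring|lia].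
move=> n; rewrite eA mul0n expr0 !mul1r mulrDr; congr (_ + _).
rewrite En exprMn -exprM exprVn (_ : (n.+1 * n.+1 = n * n.+1 + n.+1)%N); last by lia.
rewrite exprD (_ : (2 * n.+1 = (2 * n).+1.+1)%N); last by lia.
rewrite [e (- z) ^+ (2 * n).+2]exprS.
have qn : q ^+ n.+1 != 0 by rewrite expf_neq0.
transitivity (q ^+ (n * n.+1) * (e z * e (- z)) * e (- z) ^+ (2 * n).+1 * (q ^+ n.+1 / q ^+ n.+1)).
  by rewrite eNK divff//; ring.
ring.
Qed.

Lemma theta2_tauhalf (z : C) : theta2 tau (z + tau / 2) = q4^-1 * e (- z) * theta3 tau z.
Proof.
rewrite -theta2_even opprD theta2_theta3 subrK theta3_even eD e_Ntauhalf.
by congr (_ * _); field; exact: nome4_neq0.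
Qed.

Lemma theta1_add1 (z : C) : theta1 tau (z + 1) = - theta1 tau z.
Proof. by rewrite !theta1_theta2 -theta2_add1; congr theta2; ring. Qed.

Lemma theta1_odd (z : C) : theta1 tau (- z) = - theta1 tau z.
Proof.
by rewrite !theta1_theta2 -theta2_even -theta2_add1; congr theta2; field.
Qed.

Lemma theta2_theta1 (z : C) : theta2 tau z = theta1 tau (z + 1 / 2).
Proof. by rewrite theta1_theta2 addrK. Qed.

(** Up to factors without zeros, all theta functions are shifts of the first
    one by half periods; this determines their zeros. *)
Lemma theta3_theta1 (z : C) : theta1 tau (z + 1 / 2 + tau / 2) = q4^-1 * e (- z) * theta3 tau z.
Proof. by rewrite addrAC -theta2_theta1 theta2_tauhalf. Qed.

Lemma theta4_theta1 (z : C) : theta1 tau (z + tau / 2) = q4^-1 * (I * e (- z)) * theta4 tau z.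
Proof.
have -> : z + tau / 2 = (z - 1 / 2) + 1 / 2 + tau / 2 by field.
rewrite theta3_theta1 opprB eD e_half theta4_theta3.
have -> : z + 1 / 2 = (z - 1 / 2) + 1 by field.
by rewrite theta3_add1.
Qed.

Lemma theta2_addtau (z : C) : theta2 tau (z + tau) = q^-1 * e (- z) ^+ 2 * theta2 tau z.
Proof.
have -> : z + tau = (z + tau / 2) + tau / 2 by field.
rewrite theta2_tauhalf [in RHS]theta2_theta3 opprD eD e_Ntauhalf -nome4X4.
transitivity (q4^-1 * (e (- z) * (q4 ^+ 2)^-1) * (e z * e (- z)) * theta3 tau (z + tau / 2)).
  by rewrite eNK mulr1.
by field; exact: nome4_neq0.
Qed.

Lemma theta1_addtau (z : C) : theta1 tau (z + tau) = - (q^-1 * e (- z) ^+ 2) * theta1 tau z.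
Proof.
rewrite !theta1_theta2 addrAC theta2_addtau opprB addrC eD e_half exprMn expr2 iC2; ring.
Qed.

End theta_functions.

(** * Lattices and the zeros of theta functions *)

Section lattices.
Variable R : realType.
Notation C := (Cx R).
Variable tau : C.

Lemma lattice0 : lattice tau 0.
Proof. by exists 0, 0; rewrite mul0r addr0. Qed.

Lemma latticeD z w : lattice tau z -> lattice tau w -> lattice tau (z + w).
Proof. by move=> [m [n ->]] [m' [n' ->]]; exists (m + m'), (n + n'); rewrite !rmorphD /=; ring. Qed.

Lemma latticeN z : lattice tau z -> lattice tau (- z).
Proof. by move=> [m [n ->]]; exists (- m), (- n); rewrite !rmorphN /=; ring. Qed.

Lemma latticeB z w : lattice tau z -> lattice tau w -> lattice tau (z - w).
Proof. by move=> zl wl; apply: latticeD => //; exact: latticeN. Qed.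

Lemma lattice_int (m : int) : lattice tau m%:~R.
Proof. by exists m, 0; rewrite mul0r addr0. Qed.

Lemma lattice1 : lattice tau 1.
Proof. exact: (lattice_int 1). Qed.

Lemma lattice_tau : lattice tau tau.
Proof. by exists 0, 1; rewrite add0r mul1r. Qed.

Lemma int_shift_ind (Q : C -> Prop) (a z : C) : (forall w, Q w <-> Q (w + a)) -> Q z ->
  forall m : int, Q (z + m%:~R * a).
Proof.
move=> Qa Qz m.
have pos (n : nat) : Q (z + n%:R * a).
  elim: n => [|n IH]; first by rewrite mul0r addr0.
  by rewrite -natr1 mulrDl mul1r addrA; exact: (Qa _).1 IH.
have neg (n : nat) : Q (z - n%:R * a).
  elim: n => [|n IH]; first by rewrite mul0r subr0.
  by apply: (Qa _).2; rewrite -natr1 mulrDl mul1r opprD addrA subrK.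
case: m => n; first by rewrite -pmulrn.
by rewrite NegzE mulrNz mulNr -pmulrn.
Qed.

Lemma lattice_shift_ind (Q : C -> Prop) (z l : C) : (forall w, Q w <-> Q (w + 1)) ->
  (forall w, Q w <-> Q (w + tau)) -> lattice tau l -> Q z -> Q (z + l).
Proof.
move=> Q1 Qt [m [n ->]] Qz; rewrite addrA.
by apply: int_shift_ind => //; rewrite -[m%:~R]mulr1; exact: int_shift_ind.
Qed.

End lattices.

Section theta_zeros.
Variable R : realType.
Notation C := (Cx R).
Variable tau : C.
Hypothesis tau_im : 0 < complex.Im tau.
Local Notation P := (piC R).
Local Notation I := (iC R).
Local Notation q := (nome tau).
Local Notation q4 := (nome4 tau).
Local Notation E := (@epi2 R).
Local Notation e := (@epi R).
Let p := q ^+ 2.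
Let p1 : cabs p < 1 := cabs_p (nome_lt1 tau_im).

Lemma pi_neq0 : P != 0.
Proof. by rewrite -cabs_gt0 /piC cabs_real normr_gt0 gt_eqF// pi_gt0. Qed.

Lemma I_neq0 : I != 0.
Proof. by rewrite -cabs_gt0 cabs_i. Qed.

Lemma ED (a b : C) : E (a + b) = E a * E b.
Proof. by rewrite /epi2 mulrDr expCD. Qed.

Lemma E_0 : E 0 = 1.
Proof. by rewrite /epi2 mulr0 expC0. Qed.

Lemma E_tau : E tau = p.
Proof. by rewrite E_e. Qed.

Lemma E_eq1 z : E z = 1 -> exists m : int, z = m%:~R.
Proof.
move=> /expC_eq1[m h]; exists m.
have k0 : 2 * P * I != 0 by rewrite !mulf_neq0 ?pi_neq0 ?I_neq0 ?pnatr_eq0.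
by apply: (mulfI k0); rewrite h mulrC.
Qed.

Lemma E_nat_tau (k : nat) : E (k%:R * tau) = p ^+ k.
Proof. by rewrite -E_tau /epi2 -expC_natmul; congr (@expC R _); ring. Qed.

Lemma dominated_theta_factor (w : C) :
  dominated (fun k => - w * p ^+ k) (fun k => cabs w * cabs p ^+ k).
Proof. by have := geometric_dominated (- w) p1; rewrite cabsN. Qed.

Lemma dominated_theta_factorS (w : C) :
  dominated (fun k => - w * p ^+ k.+1) (fun k => cabs w * cabs p ^+ k.+1).
Proof. exact: dominatedS (dominated_theta_factor w). Qed.

Lemma theta3_product z : theta3 tau z = euler_phi q *
  (prodC (fun k => E z * q ^+ (2 * k).+1) * prodC (fun k => E (- z) * q ^+ (2 * k).+1)).
Proof.
rewrite theta3_series//; apply: jacobi_triple_product; last exact: ENK.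
- exact: nome_neq0.
- exact: nome_lt1.
Qed.

Lemma theta1_product z : theta1 tau z = - I * q4 * e z * euler_phi q *
  (prodC (fun k => - E z * p ^+ k.+1) * prodC (fun k => - E (- z) * p ^+ k)).
Proof.
have q0 := nome_neq0 tau; have q40 := nome4_neq0 tau.
have eq2 : q4 ^+ 2 * q4 ^+ 2 = q by rewrite -exprD nome4X4.
rewrite theta1_theta2// theta2_theta3// theta3_product.
have Ep : E (z - 1 / 2 + tau / 2) = - E z * q.
  rewrite !E_e !eD e_Nhalf e_tauhalf !exprMn sqrrN -eq2 expr2 [I ^+ 2]expr2 iC2; ring.
have En : E (- (z - 1 / 2 + tau / 2)) = - E (- z) / q.
  rewrite !E_e !opprD opprK !eD e_half e_Ntauhalf !exprMn -eq2 [I ^+ 2]expr2 iC2; field.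
  exact: q40.
rewrite Ep En eD e_Nhalf.
have -> : (fun k => - E z * q * q ^+ (2 * k).+1) = (fun k => - E z * p ^+ k.+1).
  by apply/funext => k; rewrite /p -exprM -mulrA -exprS; congr (_ * _ ^+ _); lia.
have -> : (fun k => - E (- z) / q * q ^+ (2 * k).+1) = (fun k => - E (- z) * p ^+ k).
  by apply/funext => k; rewrite /p -exprM exprS mulrA divfK.
ring.
Qed.

(** A convergent product vanishes only if one of its factors does, and the
    factors of the triple product vanish only at lattice points. *)
Lemma theta1_zero_lattice z : theta1 tau z = 0 -> lattice tau z.
Proof.
rewrite theta1_product => /eqP.
have phi0 := euler_phi_neq0 (nome_lt1 tau_im).
rewrite !mulf_eq0 oppr_eq0 (negbTE I_neq0) (negbTE (nome4_neq0 tau)) (negbTE phi0).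
rewrite (negbTE (expC_neq0 _ : e z != 0)) /= => /orP[/eqP h|/eqP h].
  have [[k Hk]|nz] := pselect (exists k : nat, 1 + - E z * p ^+ k.+1 = 0).
    have : E (z + k.+1%:R * tau) = 1.
      by apply/eqP; rewrite eq_sym -subr_eq0 ED E_nat_tau -mulNr Hk.
    move=> /E_eq1[m zm]; exists m, (- (k.+1 : int)).
    by rewrite -zm rmorphN /= -pmulrn; ring.
  have nz' k : 1 + - E z * p ^+ k.+1 != 0 by apply/eqP => Hk; apply: nz; exists k.
  by have := prodC_neq0 (dominated_theta_factorS (E z)) nz'; rewrite h eqxx.
have [[k Hk]|nz] := pselect (exists k : nat, 1 + - E (- z) * p ^+ k = 0).
  have : E (- z + k%:R * tau) = 1.
    by apply/eqP; rewrite eq_sym -subr_eq0 ED E_nat_tau -mulNr Hk.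
  move=> /E_eq1[m zm]; exists (- m), (k : int).
  by rewrite rmorphN /= -zm -pmulrn; ring.
have nz' k : 1 + - E (- z) * p ^+ k != 0 by apply/eqP => Hk; apply: nz; exists k.
by have := prodC_neq0 (dominated_theta_factor (E (- z))) nz'; rewrite h eqxx.
Qed.

Lemma theta1_0 : theta1 tau 0 = 0.
Proof.
have := theta1_odd tau_im 0; rewrite oppr0 => /eqP.
by rewrite -subr_eq0 opprK -mulr2n -mulr_natl mulf_eq0 pnatr_eq0 /= => /eqP.
Qed.

Lemma theta1_eq0 z : (theta1 tau z = 0) <-> lattice tau z.
Proof.
split; first exact: theta1_zero_lattice.
move=> zl; rewrite -[z]add0r.
apply: (@lattice_shift_ind R tau (fun w => theta1 tau w = 0)) => // [w|w|].
- by rewrite theta1_add1//; split=> [->|/eqP]; rewrite ?oppr0// oppr_eq0 => /eqP.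
- rewrite theta1_addtau//; split=> [->|/eqP]; first by rewrite mulr0.
  rewrite mulf_eq0 oppr_eq0 mulf_eq0 invr_eq0 (negbTE (nome_neq0 tau)) /=.
  by rewrite expf_eq0 (negbTE (expC_neq0 _ : e (- w) != 0)) andbF /= => /eqP.
- exact: theta1_0.
Qed.

(** Two derivatives, as the second one makes [theta1 tau z / z] differentiable
    at 0. *)
Lemma theta1_twice_derivable : exists T1 T2 : C -> C,
  (forall z : C, is_derive z 1 (theta1 tau) (T1 z)) /\ (forall z : C, is_derive z 1 T1 (T2 z)).
Proof.
pose k : C := 2 * q4 * (2 * I)^-1.
pose c n : C := k * ((-1) ^+ n * q ^+ (n * n.+1)).
pose a (s : C) n : C := s * ((2 * n).+1%:R * P * I).
have fc : fast c := @fast_theta1 R tau tau_im k id.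
have la s : lin_growth (a s).
  exists (cabs s * (2 * cabs P)) => [|n]; first by rewrite !mulr_ge0 ?cabs_ge0.
  rewrite /a !cabsM cabs_i mulr1 cabs_nat.
  rewrite (_ : _ * n.+1%:R = cabs s * ((2 * n.+1)%:R * cabs P)); last by rewrite natrM; ring.
  rewrite ler_wpM2l ?cabs_ge0// ler_wpM2r ?cabs_ge0// ler_nat; lia.
have thE z : theta1 tau z = expsum c (a 1) z - expsum c (a (-1)) z.
  have [M1 D1] := expsum_dominated z fc (la 1); have [M2 D2] := expsum_dominated z fc (la (-1)).
  have DD := dominatedD D1 (dominatedZ (-1) D2).
  transitivity (sumC (fun n => c n * expC (a 1 n * z) + -1 * (c n * expC (a (-1) n * z)))); last first.
    by rewrite (sumCD D1 (dominatedZ (-1) D2)) (sumCZ (-1) D2) mulN1r.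
  have q42 : 2 * q4 != 0 by rewrite mulf_neq0 ?pnatr_eq0 ?nome4_neq0.
  rewrite /theta1; apply: (mulfI (invr_neq0 q42)); rewrite mulKf// -(sumCZ _ DD).
  apply: eq_sumC => n; rewrite (@sinC_pow R (2 * n).+1 z); last by ring.
  rewrite /epi -(expC_natmul _ (P * I * z)) -(expC_natmul _ (P * I * - z)) /c /a.
  rewrite (_ : 1 * _ * z = (2 * n).+1%:R * (P * I * z)); last by ring.
  rewrite (_ : -1 * _ * z = (2 * n).+1%:R * (P * I * - z)); last by ring.
  move: (expC ((2 * n).+1%:R * (P * I * z))) (expC ((2 * n).+1%:R * (P * I * - z))) => x y.
  have q40 := nome4_neq0 tau; have I0 := I_neq0; rewrite /k.
  move: (q ^+ (n * n.+1)) ((-1) ^+ n : C) q40 I0 => u v; move: q4 I => r i r0 i0.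
  by field; rewrite r0 i0.
exists (fun z => expsum (fun n => c n * a 1 n) (a 1) z - expsum (fun n => c n * a (-1) n) (a (-1)) z).
exists (fun z => expsum (fun n => c n * a 1 n * a 1 n) (a 1) z -
   expsum (fun n => c n * a (-1) n * a (-1) n) (a (-1)) z).
split=> z.
  have := is_deriveC_sub (is_derive_expsum z fc (la 1)) (is_derive_expsum z fc (la (-1))).
  by apply: is_derive_ext => w; rewrite thE.
exact: (is_deriveC_sub (is_derive_expsum z (fast_mul fc (la 1)) (la 1))
  (is_derive_expsum z (fast_mul fc (la (-1))) (la (-1)))).
Qed.

End theta_zeros.

(** * Jacobi's derivative formula *)

Local Opaque sumC expC theta1 theta2 theta3 theta4 nome nome4 prodC.

Section jacobi_derivative.
Variable R : realType.
Notation C := (Cx R).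
Variable tau : C.
Hypothesis tau_im : 0 < complex.Im tau.
Local Notation P := (piC R).
Local Notation I := (iC R).
Local Notation q := (nome tau).
Local Notation q4 := (nome4 tau).
Local Notation E := (@epi2 R).
Local Notation e := (@epi R).
Let p := q ^+ 2.
Let p1 : cabs p < 1 := cabs_p (nome_lt1 tau_im).
Let phi := euler_phi q.
Let psi : C := prodC (fun k => p ^+ k.+1).
Let chi : C := prodC (fun k => - p ^+ (2 * k).+1).

Lemma prodC_head (u : nat -> C) m : dominated u m ->
  prodC u = (1 + u 0%N) * prodC (fun k => u k.+1).
Proof.
move=> D; apply: (prodC_unique D).
have H : (fun N => (1 + u 0%N) * pprod (fun k => u k.+1) N) @ \oo --> (1 + u 0%N) * prodC (fun k => u k.+1).
  by apply: cvgC_mul; [exact: cvgC_cst|exact: pprod_cvg (dominatedS D)].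
rewrite -(cvg_shiftS (pprod u)).
rewrite (_ : (fun n => pprod u n.+1) = (fun N => (1 + u 0%N) * pprod (fun k => u k.+1) N))//.
by apply/funext => n; rewrite /pprod big_ord_recl.
Qed.

Lemma dominated_psi : dominated (fun k => p ^+ k.+1) (fun k => cabs p * cabs p ^+ k).
Proof.
have [c m] := geometric_dominated p p1; split=> // n.
by have := m n; rewrite -exprS.
Qed.

Lemma dominated_chi : dominated (fun k => - p ^+ (2 * k).+1) (fun k => cabs p * cabs p ^+ k).
Proof.
have [c m] := geometric_dominated p p1; split=> // n.
rewrite cabsN cabsX exprS ler_wpM2l ?cabs_ge0//.
by apply: ler_wiXn2l; rewrite ?cabs_ge0 ?(ltW p1)//; lia.
Qed.

(** Euler's theorem that partitions into distinct parts and partitions into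
    odd parts are equinumerous: [psi] counts the former, [chi^-1] the latter. *)
Lemma euler_psi_chi : psi * chi = 1.
Proof.
have L1 : (fun N => pprod (fun k => - p ^+ k.+1) N * (pprod (fun k => p ^+ k.+1) N *
    pprod (fun k => - p ^+ (2 * k).+1) N)) @ \oo --> phi * (psi * chi).
  apply: cvgC_mul; first exact: pprod_cvg (dominated_qpoch (nome_lt1 tau_im)).
  by apply: cvgC_mul; [exact: pprod_cvg dominated_psi|exact: pprod_cvg dominated_chi].
have L2 : (fun N => qpoch p (N + N)) @ \oo --> phi.
  apply: (cvg_subseq (s := fun N => (N + N)%N) (qpoch_cvg (nome_lt1 tau_im))) => m.
  by exists m => k mk; lia.
have same : (fun N => pprod (fun k => - p ^+ k.+1) N * (pprod (fun k => p ^+ k.+1) N *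
    pprod (fun k => - p ^+ (2 * k).+1) N)) = (fun N => qpoch p (N + N)).
  apply/funext; elim=> [|N IH]; first by rewrite /pprod /qpoch !big_ord0 !mulr1.
  rewrite addSn addnS 2!qpochS -IH !pprodS.
  have -> : ((N + N).+1 = (2 * N).+1)%N by lia.
  have -> : ((2 * N).+2 = N.+1 + N.+1)%N by lia.
  by rewrite (exprD p N.+1 N.+1); ring.
rewrite same in L1.
have H : phi * (psi * chi) = phi by exact: cvg_unique L1 L2.
have phi0 : phi != 0 := euler_phi_neq0 (nome_lt1 tau_im).
by apply: (mulfI phi0); rewrite mulr1; exact: H.
Qed.

Lemma theta2_0 : theta2 tau 0 = 2 * q4 * phi * psi ^+ 2.
Proof.
have q0 := nome_neq0 tau.
have eq2 : q4 ^+ 2 * q4 ^+ 2 = q by rewrite -exprD nome4X4.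
rewrite theta2_theta3// add0r theta3_product// /epi mulr0 expC0 mulr1 -/phi.
have -> : E (tau / 2) = q by rewrite E_e e_tauhalf expr2 eq2.
have -> : E (- (tau / 2)) = q^-1 by rewrite E_e e_Ntauhalf expr2 -invfM eq2.
have -> : (fun k => q * q ^+ (2 * k).+1) = (fun k => p ^+ k.+1).
  by apply/funext => k; rewrite /p -exprM -exprS; apply: (f_equal (fun n => q ^+ n)); lia.
have -> : (fun k => q^-1 * q ^+ (2 * k).+1) = (fun k => p ^+ k).
  by apply/funext => k; rewrite /p -exprM exprS mulKf.
have D : dominated (fun k => p ^+ k) (fun k => cabs 1 * cabs p ^+ k).
  by have [c m] := geometric_dominated 1 p1; split=> // n; have := m n; rewrite mul1r.
rewrite (prodC_head D) expr0 -/psi; ring.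
Qed.

Lemma theta34_0 : theta3 tau 0 * theta4 tau 0 = phi ^+ 2 * chi ^+ 2.
Proof.
rewrite theta4_theta3// add0r !theta3_product// oppr0 E_0 -/phi.
have -> : E (1 / 2) = -1 by rewrite E_e e_half expr2 iC2.
have -> : E (- (1 / 2)) = -1 by rewrite E_e e_Nhalf sqrrN expr2 iC2.
have q1 := nome_lt1 tau_im.
have := prodCM (dominated_qprod q1 1) (dominated_qprod q1 (-1)) (w := fun k => - p ^+ (2 * k).+1).
have sq : forall i, (1 + 1 * q ^+ (2 * i).+1) * (1 + -1 * q ^+ (2 * i).+1) = 1 + - p ^+ (2 * i).+1.
  by move=> i; rewrite /p -exprM (mulnC 2 (2 * i).+1) exprM; ring.
move=> /(_ sq) H; rewrite /chi (prodC_unique dominated_chi H); ring.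
Qed.

Lemma theta1_quotient (h : C) : (theta1 tau (0 + h) - theta1 tau 0) / h =
  (- I * q4 * phi) * (e h * (prodC (fun k => - E h * p ^+ k.+1) *
     prodC (fun k => - E (- h) * p ^+ k.+1))) * ((- E (- (0 + h)) - - E (- 0)) / h).
Proof.
rewrite theta1_0// subr0 add0r theta1_product// oppr0 E_0.
rewrite (prodC_head (dominated_theta_factor tau_im (E (- h)))) expr0 mulr1 -/phi -/p.
ring.
Qed.

Lemma E_continuous0 (s : C) : E (s * h) @[h --> 0^'] --> (1 : C).
Proof.
have H : is_derive (0 : C) 1 (fun w => 1 * expC (2 * P * I * s * w)) (1 * (2 * P * I * s) * expC (2 * P * I * s * 0)).
  exact: is_derive_expterm.
have := is_derive_continuous H; rewrite mulr0 expC0 mulr1.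
rewrite (_ : (fun w => _) = (fun h => E (s * h))); last first.
  by apply/funext => h; rewrite mul1r /epi2 mulrA.
by apply: cvg_trans; apply: cvg_app; exact: nbhs_dnbhs.
Qed.

Lemma theta_factor_cvg (s : C) : (s = 1 \/ s = -1) ->
  prodC (fun k => - E (s * h) * p ^+ k.+1) @[h --> 0^'] --> phi.
Proof.
move=> s1; have lim1 := E_continuous0 s.
have [c m] := dominated_theta_factorS tau_im (- 2).
have c2 : cabs (- 2 : C) = 2 by rewrite cabsN cabs_nat.
rewrite /phi /euler_phi.
apply: (prodC_continuous c).
- have /cvgCP/(_ 1 ltr01) := lim1; apply: filterS => h h1 n.
  rewrite cabsM cabsN cabsX ler_wpM2r ?exprn_ge0 ?cabs_ge0// c2.
  rewrite -(subrK 1 (E (s * h))); apply: le_trans (cabsD _ _) _; rewrite cabs1; lra.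
- move=> n; rewrite cabsN cabsX c2 ler_peMl ?exprn_ge0 ?cabs_ge0//; lra.
- move=> n; rewrite -[X in _ --> X]mulN1r.
  apply: cvgC_mul; last exact: cvgC_cst.
  have H : (fun h => 0 - E (s * h)) @ 0^' --> (0 - 1 : C).
    by apply: cvgC_sub; [exact: cvgC_cst|exact: lim1].
  by rewrite sub0r (_ : (fun h => _) = (fun h => - E (s * h))) in H;
     last by apply/funext => h; rewrite sub0r.
Qed.

(** The factor of the product of [theta1] that vanishes at 0 is divided by the
    increment. Up to elementary constants the rest tends to [phi ^+ 3], and
    Euler's identity gives the same value for the product of the three other
    functions. *)
Theorem theta1_deriv0 : is_derive (0 : C) 1 (theta1 tau)
  (P * theta2 tau 0 * theta3 tau 0 * theta4 tau 0).
Proof.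
have -> : P * theta2 tau 0 * theta3 tau 0 * theta4 tau 0 =
   (- I * q4 * phi) * (1 * (phi * phi)) * (2 * P * I).
  rewrite -(mulrA (P * _)) theta34_0 theta2_0.
  transitivity (P * 2 * q4 * phi ^+ 3 * (psi * chi) ^+ 2); first by ring.
  rewrite euler_psi_chi expr1n.
  transitivity (- (I * I) * 2 * P * q4 * phi ^+ 3); last by ring.
  by rewrite iC2; ring.
apply/is_derive_quotP; rewrite (funext theta1_quotient).
apply: cvgC_mul.
  apply: cvgC_mul; first exact: cvgC_cst.
  apply: cvgC_mul.
    have H := E_continuous0 (1 / 2).
    rewrite (_ : (fun h => _) = e) in H => //.
    by apply/funext => h; rewrite /epi2 /epi; apply: (f_equal (@expC R)); field.
  apply: cvgC_mul.
    have H := theta_factor_cvg (or_introl (erefl (1 : C))).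
    rewrite (_ : (fun h => _) = (fun h => prodC (fun k => - E h * p ^+ k.+1))) in H => //.
    by apply/funext => h; rewrite mul1r.
  have H := theta_factor_cvg (or_intror (erefl (-1 : C))).
  rewrite (_ : (fun h => _) = (fun h => prodC (fun k => - E (- h) * p ^+ k.+1))) in H => //.
  by apply/funext => h; rewrite mulN1r.
have := is_derive_expterm (-1) (- (2 * P * I)) 0.
rewrite mulr0 expC0 (_ : -1 * - (2 * P * I) * 1 = 2 * P * I); last by ring.
move=> H; have /is_derive_quotP : is_derive (0 : C) 1 (fun w => - E (- w)) (2 * P * I).
  by apply: is_derive_ext H => w; rewrite mulN1r /epi2 mulNr mulrN.
exact.
Qed.

End jacobi_derivative.

(** * Quasi-periodic functions with simple poles *)

Section kernels.
Variable R : realType.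
Notation C := (Cx R).

Lemma is_derive_invC (f : C -> C) z d : f z != 0 -> is_derive z 1 f d ->
  is_derive z 1 (fun w => (f w)^-1) (- d / (f z) ^+ 2).
Proof.
move=> f0 [df fd].
have d1 : derivable (fun w : C => (f w)^-1) z 1 by exact: derivableV.
split=> //; have -> := @deriveV C C f z 1 f0 df.
by rewrite fd scaleCE mulrC mulrN mulNr.
Qed.

Lemma derivable_invC (f : C -> C) z : f z != 0 -> derivable f z 1 ->
  derivable (fun w : C => (f w)^-1) z 1.
Proof.
by move=> f0 /derivableCP[d Hd]; apply/derivableCP; eexists; exact: is_derive_invC Hd.
Qed.

Lemma derivable_mulC (f g : C -> C) z : derivable f z 1 -> derivable g z 1 ->
  derivable (fun w : C => f w * g w) z 1.
Proof.
move=> /derivableCP[d Hd] /derivableCP[d' Hd']; apply/derivableCP.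
by eexists; exact: is_deriveC_mul Hd Hd'.
Qed.

Lemma derivable_addC (f g : C -> C) z : derivable f z 1 -> derivable g z 1 ->
  derivable (fun w : C => f w + g w) z 1.
Proof.
move=> /derivableCP[d Hd] /derivableCP[d' Hd']; apply/derivableCP.
by eexists; exact: is_deriveC_add Hd Hd'.
Qed.

Lemma derivable_subC (f g : C -> C) z : derivable f z 1 -> derivable g z 1 ->
  derivable (fun w : C => f w - g w) z 1.
Proof.
move=> /derivableCP[d Hd] /derivableCP[d' Hd']; apply/derivableCP.
by eexists; exact: is_deriveC_sub Hd Hd'.
Qed.

Lemma derivable_scaleC (a : C) (f : C -> C) z : derivable f z 1 ->
  derivable (fun w : C => a * f w) z 1.
Proof.
by move=> /derivableCP[d Hd]; apply/derivableCP; eexists; exact: is_deriveC_scale Hd.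
Qed.

Lemma derivable_affC (f : C -> C) (a b z : C) : derivable f (a * z + b) 1 ->
  derivable (fun w : C => f (a * w + b)) z 1.
Proof.
move=> /derivableCP[d Hd]; apply/derivableCP; eexists.
exact: is_deriveC_comp (is_derive_affine a b z) Hd.
Qed.

Lemma derivable_shiftC (f : C -> C) (b z : C) : derivable f (z + b) 1 ->
  derivable (fun w : C => f (w + b)) z 1.
Proof.
by move=> /derivableCP[d Hd]; apply/derivableCP; exists d; exact: is_derive_shiftC.
Qed.

Lemma derivable_cont (f : C -> C) z : derivable f z 1 -> f @ z --> f z.
Proof. by move=> /derivableCP[d]; exact: is_derive_continuous. Qed.

Lemma derivable_dcont (f : C -> C) z : derivable f z 1 -> f @ z^' --> f z.
Proof.
move=> /derivable_cont; apply: cvg_trans; apply: cvg_app; exact: nbhs_dnbhs.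
Qed.

Lemma near_neq0 (f : C -> C) z : f @ z --> f z -> f z != 0 ->
  exists2 r : R, 0 < r & forall w, cabs (w - z) < r -> f w != 0.
Proof.
move=> fc f0; have /cvgCP/(_ (cabs (f z))) := fc; rewrite cabs_gt0 => /(_ f0)/nbhsCP[r r0 Hr].
exists r => // w /Hr; apply: contraTneq => ->.
by rewrite sub0r cabsN ltxx.
Qed.

Lemma quotient_removable (N : C -> C) (p : C) : derivable N p 1 -> N p = 0 ->
  removable (fun z => N z / (z - p)) p.
Proof.
move=> /derivableCP[d /is_derive_quotP/cvgCP H] Np; exists d.
apply/cvgCP => e e0; have /dnbhsCP[r r0 Hr] := H e e0.
apply/dnbhsCP; exists r => // w wp wr.
have := Hr (w - p); rewrite subr0 subr_eq0 => /(_ wp wr).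
by rewrite (addrC p) subrK Np subr0.
Qed.

Lemma removable_near (f g : C -> C) p : (\forall z \near p^', f z = g z) ->
  removable f p -> removable g p.
Proof.
move=> fg [l /cvgCP fl]; exists l; apply/cvgCP => e e0.
by have := fl e e0; move: fg; apply: filterS2 => z ->.
Qed.

Lemma removable_derivable (f : C -> C) p : derivable f p 1 -> removable f p.
Proof. by move=> /derivable_dcont fp; exists (f p). Qed.

Lemma removable_mul (f g : C -> C) p : removable f p -> removable g p ->
  removable (fun z => f z * g z) p.
Proof. by move=> [l fl] [k gk]; exists (l * k); apply: cvgC_mul; [exact: fl|exact: gk]. Qed.

Lemma removable_sub (f g : C -> C) p : removable f p -> removable g p ->
  removable (fun z => f z - g z) p.
Proof. by move=> [l fl] [k gk]; exists (l - k); apply: cvgC_sub; [exact: fl|exact: gk]. Qed.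

Variable tau : C.
Hypothesis tau_im : 0 < complex.Im tau.

(** A section, with one simple pole of residue 1, of the flat line bundle with
    character [s], [m]. The value 0 at the poles is a convention that makes it a
    function on the whole plane. *)
Record kernel_spec (s m : C) (W : C -> C) : Prop := {
  kernel_add1 : forall z, W (z + 1) = s * W z;
  kernel_addtau : forall z, W (z + tau) = m * W z;
  kernel_lattice : forall z, lattice tau z -> W z = 0;
  kernel_derivable : forall z, ~ lattice tau z -> derivable W z 1;
  kernel_pole : exists g : C -> C, exists2 r : R, 0 < r &
    [/\ g 0 = 1, forall z, cabs z < r -> derivable g z 1
      & forall z, z != 0 -> cabs z < r -> W z = g z / z] }.

Lemma lattice_rows (p z : C) : lattice tau (z - p) ->
  exists n : int, complex.Im z = complex.Im p + n%:~R * complex.Im tau.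
Proof.
move=> [m [n h]]; exists n; have -> : z = p + (m%:~R + n%:~R * tau) by rewrite -h addrC subrK.
rewrite !cImD cImM.
have -> (k : int) : (k%:~R : C) = (k%:~R : R)%:C by rewrite rmorph_int.
have -> (k : int) : (k%:~R : C) = (k%:~R : R)%:C by rewrite rmorph_int.
by rewrite /= mul0r add0r addr0.
Qed.

Lemma isolated_rows (c d t0 : R) : 0 < d -> exists2 r : R, 0 < r &
  forall t, 0 < `|t - t0| < r -> forall n : int, t != c + n%:~R * d.
Proof.
move=> d0; pose k := Num.floor ((t0 - c) / d).
have k1 : k%:~R * d <= t0 - c by rewrite -ler_pdivlMr// ge_floor.
have k2 : t0 - c < (k%:~R + 1) * d.
  by rewrite -ltr_pdivrMr// -[1]/(1%:~R : R) -rmorphD; exact: lt_succ_floor.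
have [r [r0 ra rb]] : exists r : R, [/\ 0 < r, (t0 - c = k%:~R * d \/ r <= t0 - c - k%:~R * d)
   /\ r <= d & r <= (k%:~R + 1) * d - (t0 - c)].
  have [h|h] := eqVneq (t0 - c) (k%:~R * d).
    exists d; split=> //; first by split; [left|].
    by rewrite h; lra.
  exists (Num.min (t0 - c - k%:~R * d) ((k%:~R + 1) * d - (t0 - c))).
  split; last by rewrite ge_min lexx orbT.
    by rewrite lt_min !subr_gt0 k2 lt_neqAle eq_sym h k1.
  split; first by right; rewrite ge_min lexx.
  by rewrite ge_min; apply/orP; left; lra.
exists r => // t /andP[t1 t2] n; apply/eqP => tE.
have [nk|kn] := leP n k; last first.
  have : (k%:~R + 1) * d <= n%:~R * d.
    by rewrite ler_pM2r// -[1]/(1%:~R : R) -rmorphD ler_int lezD1.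
  move: t2; rewrite ltr_norml => /andP[_]; lra.
have nkd : n%:~R * d <= k%:~R * d by rewrite ler_pM2r// ler_int.
case: ra => -[h|h] rd; last by move: t2; rewrite ltr_norml => /andP[]; lra.
move: nk; rewrite le_eqVlt => /orP[/eqP nk|nk].
  by move: t1; rewrite tE nk (_ : _ - t0 = 0) ?normr0 ?ltxx//; lra.
have : (n%:~R + 1) * d <= k%:~R * d.
  by rewrite ler_pM2r// -[1]/(1%:~R : R) -rmorphD ler_int lezD1.
by move: t2; rewrite ltr_norml => /andP[]; lra.
Qed.

Definition off_poles (ps : seq C) (z : C) : Prop := forall p, p \in ps -> ~ lattice tau (z - p).

Lemma row_regular_off (f : C -> C) (ps : seq C) :
  (forall z, off_poles ps z -> derivable f z 1) -> row_regular f.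
Proof.
move=> fd t0.
have [r r0 Hr] : exists2 r : R, 0 < r & forall s t : R, 0 < `|t - t0| < r -> off_poles ps (s +i* t).
  elim: ps {fd} => [|p ps [r r0 Hr]]; first by exists 1.
  have [r' r'0 Hr'] := @isolated_rows (complex.Im p) _ t0 tau_im.
  exists (Num.min r r'); first by rewrite lt_min r0.
  move=> s t; rewrite lt_min => /andP[t1 /andP[t2 t3]] x.
  rewrite inE => /orP[/eqP->|xp]; last by apply: Hr xp; rewrite t1.
  move=> /lattice_rows[n /= tE].
  by have := Hr' t _ n; rewrite t1 t3 => /(_ isT)/eqP.
by exists r; [exact: r0|move=> s t ht; apply: fd; exact: Hr].
Qed.

Variables T1 T2 : C -> C.
Hypothesis T1P : forall z : C, is_derive z 1 (theta1 tau) (T1 z).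
Hypothesis T2P : forall z : C, is_derive z 1 T1 (T2 z).
Hypothesis d0 : T1 0 != 0.
Local Notation th := (theta1 tau).
Local Notation q := (nome tau).
Local Notation e := (@epi R).
Let d := T1 0.
Let sl := slope th 0 d.

Lemma theta_slope z : th z = z * sl z.
Proof.
rewrite /sl /slope theta1_0// subr0; case: eqVneq => [->|z0].
  by rewrite mul0r theta1_0.
by rewrite subr0 mulrC divfK.
Qed.

Lemma slope0 : sl 0 = d.
Proof. by rewrite /sl /slope eqxx. Qed.

Lemma slope_derivable z : derivable sl z 1.
Proof.
have [->|z0] := eqVneq z 0.
  apply/derivableCP; exists (T2 0 / 2); apply: (is_derive_slope (r := 1)) => //.
have thd : derivable (fun w : C => th w * (1 * w + 0)^-1) z 1.
  apply: derivable_mulC; first by apply/derivableCP; exists (T1 z).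
  apply: derivable_invC; first by rewrite mul1r addr0.
  by apply/derivableCP; exists 1; exact: is_derive_affine.
move: thd => /derivableCP[k Hk]; apply/derivableCP; exists k.
have z1 : 0 < cabs z by rewrite cabs_gt0.
apply: (is_derive_near z1 _ Hk) => w wz.
rewrite mul1r addr0 /sl /slope; case: eqVneq => [w0|_]; last by rewrite theta1_0// !subr0.
by move: wz; rewrite w0 sub0r cabsN ltxx.
Qed.

Lemma slope_near0 : exists2 r : R, 0 < r & forall z, cabs z < r -> sl z != 0.
Proof.
have [|r r0 Hr] := near_neq0 (derivable_cont (slope_derivable (z := 0))).
  by rewrite slope0.
by exists r => // z zr; apply: Hr; rewrite subr0.
Qed.

Lemma theta_derivable z : derivable th z 1.
Proof. by apply/derivableCP; exists (T1 z). Qed.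

Lemma theta_neq0 z : ~ lattice tau z -> th z != 0.
Proof. by move=> zl; apply/eqP => /(theta1_eq0 tau_im). Qed.

Lemma lattice_open z : ~ lattice tau z ->
  exists2 r : R, 0 < r & forall w, cabs (w - z) < r -> ~ lattice tau w.
Proof.
move=> zl; have [|r r0 Hr] := near_neq0 (derivable_cont (theta_derivable (z := z))).
  exact: theta_neq0.
by exists r => // w /Hr /eqP wt /(theta1_eq0 tau_im).
Qed.

Lemma lattice_isolated z : exists2 r : R, 0 < r &
  forall w, w != z -> cabs (w - z) < r -> ~ lattice tau w.
Proof.
have [zl|zl] := pselect (lattice tau z); last first.
  by have [r r0 Hr] := lattice_open zl; exists r => // w _; exact: Hr.
have [r r0 Hr] := slope_near0; exists r => // w wz wr wl.
have /(theta1_eq0 tau_im)/eqP := latticeB wl zl.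
by rewrite theta_slope mulf_eq0 subr_eq0 (negbTE wz) (negbTE (Hr _ wr)).
Qed.

Lemma near_off_lattice (p z : C) : \forall w \near z^', ~ lattice tau (w - p).
Proof.
have [r r0 Hr] := lattice_isolated (z - p).
apply/dnbhsCP; exists r => // w wz wr; apply: Hr.
  by rewrite (inj_eq (addIr _)).
by rewrite (_ : w - p - (z - p) = w - z); last ring.
Qed.

Lemma T1_add1 z : T1 (z + 1) = - T1 z.
Proof.
have h := is_derive_shiftC (T1P (z + 1)).
have h' := is_deriveC_scale (-1) (T1P z).
rewrite mulN1r in h'; apply: is_derive_unique h _.
by apply: is_derive_ext h' => w; rewrite theta1_add1// mulN1r.
Qed.

Lemma T1_addtau z : T1 (z + tau) =
  - q^-1 * e (- z) ^+ 2 * (T1 z - 2 * piC R * iC R * th z).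
Proof.
have h := is_derive_shiftC (T1P (z + tau)).
have d1 := is_derive_expterm (- q^-1) (- (2 * piC R * iC R)) z.
have d2 := is_deriveC_mul d1 (T1P z).
have eE w : expC (- (2 * piC R * iC R) * w) = e (- w) ^+ 2.
  by rewrite /epi -expC_natmul; apply: (f_equal (@expC R)); ring.
have d3 : is_derive z 1 (fun w => th (w + tau))
   (- q^-1 * e (- z) ^+ 2 * (T1 z - 2 * piC R * iC R * th z)).
  apply: is_derive_ext (is_derive_eq d2 _) => [w|].
    by rewrite theta1_addtau// eE mulNr.
  by rewrite !eE; ring.
exact: is_derive_unique h d3.
Qed.

(** The logarithmic derivative of [theta1]: its single pole compensates a
    residue, at the price of an additive constant under [tau]. *)
Definition zeta z := T1 z / th z.

Lemma zeta_add1 z : zeta (z + 1) = zeta z.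
Proof. by rewrite /zeta T1_add1 theta1_add1// invrN mulrNN. Qed.

Lemma zeta_addtau z : ~ lattice tau z -> zeta (z + tau) = zeta z - 2 * piC R * iC R.
Proof.
move=> /theta_neq0 t0; rewrite /zeta T1_addtau theta1_addtau//.
have q0 := nome_neq0 tau; have e0 : e (- z) != 0 := expC_neq0 _.
by field; rewrite t0 q0 e0.
Qed.

Lemma zeta_derivable z : ~ lattice tau z -> derivable zeta z 1.
Proof.
move=> zl; apply: derivable_mulC; first by apply/derivableCP; exists (T2 z).
by apply: derivable_invC; [exact: theta_neq0|exact: theta_derivable].
Qed.

(** Pairing [f] with the kernel [- W (- z)] of the inverse character, and
    cancelling the pole at [p] with [zeta], gives a function to which
    [additive_period_eq0] applies; its additive constant is 2 pi i times [f p]. *)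
Lemma vanishing (s m : C) (W f : C -> C) (ps : seq C) : s != 0 -> m != 0 ->
  kernel_spec s m W ->
  (forall z, f (z + 1) = s * f z) -> (forall z, f (z + tau) = m * f z) ->
  (forall z, removable f z) -> (forall z, off_poles ps z -> derivable f z 1) ->
  forall p, off_poles ps p -> f p = 0.
Proof.
move=> s0 m0 [W1 Wt Wl Wd [g [r r0 [g0 gd gW]]]] f1 ft fr fd p pp.
pose k z := - W (- z).
have k1 z : k (z + 1) = s^-1 * k z.
  apply: (mulfI s0); rewrite mulVKf// /k mulrN -W1; congr (- W _); ring.
have kt z : k (z + tau) = m^-1 * k z.
  apply: (mulfI m0); rewrite mulVKf// /k mulrN -Wt; congr (- W _); ring.
pose G z := f z * k (z - p) - f p * zeta (z - p).
have G1 z : G (z + 1) = G z.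
  by rewrite /G f1 addrAC k1 zeta_add1 mulrACA divff// mul1r.
have Gt z : ~ lattice tau (z - p) -> G (z + tau) = G z + 2 * piC R * iC R * f p.
  move=> zl; rewrite /G ft addrAC kt zeta_addtau// mulrACA divff// mul1r; ring.
have kd z : ~ lattice tau z -> derivable k z 1.
  move=> zl; have H : derivable (fun w : C => -1 * W (-1 * w + 0)) z 1.
    apply: derivable_scaleC; apply: derivable_affC; apply: Wd.
    by rewrite addr0 mulN1r => /latticeN; rewrite opprK.
  rewrite (_ : k = fun w => -1 * W (-1 * w + 0))//.
  by apply/funext => w; rewrite addr0 !mulN1r.
have pd (h : C -> C) z : derivable h (z - p) 1 -> derivable (fun w : C => h (w - p)) z 1.
  exact: derivable_shiftC.
have Gd z : off_poles (p :: ps) z -> derivable G z 1.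
  move=> zp; have zl : ~ lattice tau (z - p) by apply: zp; rewrite inE eqxx.
  have zps : off_poles ps z by move=> x xp; apply: zp; rewrite inE xp orbT.
  apply: derivable_subC; last by apply/derivable_scaleC/pd/zeta_derivable.
  by apply: derivable_mulC; [exact: fd|apply/pd/kd].
have Gp : removable G p.
  have [r' r'0 Hr'] := slope_near0.
  pose N z := f z * g (-1 * z + p) - f p * (T1 (z - p) / sl (z - p)).
  apply: (@removable_near (fun z => N z / (z - p))).
    apply/dnbhsCP; exists (Num.min r r'); first by rewrite lt_min r0.
    move=> w wp; rewrite lt_min => /andP[wr wr'].
    have wp0 : w - p != 0 by rewrite subr_eq0.
    have wr2 : cabs (- (w - p)) < r by rewrite cabsN.
    have sl0 := Hr' _ wr'.
    rewrite /G /k /zeta theta_slope gW ?oppr_eq0// /N.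
    have -> : -1 * w + p = - (w - p) by ring.
    by field; rewrite wp0 sl0.
  apply: quotient_removable; last first.
    by rewrite /N mulN1r addNr subrr g0 slope0 -/d divff// !mulr1 subrr.
  apply: derivable_subC.
    apply: derivable_mulC; first exact: fd.
    by apply: derivable_affC; apply: gd; rewrite mulN1r addNr cabs0.
  apply/derivable_scaleC/(pd (fun z => T1 z / sl z)).
  apply: derivable_mulC; first by apply/derivableCP; exists (T2 (p - p)).
  by apply: derivable_invC; [rewrite subrr slope0|exact: slope_derivable].
have Gr z : removable G z.
  have [zl|zl] := pselect (lattice tau (z - p)); last first.
    apply: removable_sub.
      by apply: removable_mul; [exact: fr|apply/removable_derivable/pd/kd].
    by apply/removable_derivable/derivable_scaleC/pd/zeta_derivable.
  have -> : z = p + (z - p) by rewrite addrC subrK.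
  apply: (@lattice_shift_ind R tau (removable G) p (z - p) _ _ zl Gp).
    move=> w; split=> h.
      by apply: (removable_shift (b := 1) (c := 0) h); apply: nearW => v; rewrite G1 mul1r addr0.
    rewrite -(addrK 1 w); apply: (removable_shift (b := 1) (c := 0) h).
    by apply: nearW => v; rewrite -{2}(subrK 1 v) G1 mul1r addr0.
  move=> w; split=> h.
    apply: (removable_shift (b := 1) (c := 2 * piC R * iC R * f p) h).
    by apply: filterS (near_off_lattice p w) => v vl; rewrite Gt// mul1r.
  rewrite -(addrK tau w); apply: (removable_shift (b := 1) (c := - (2 * piC R * iC R * f p)) h).
  apply: filterS (near_off_lattice p (w + tau)) => v vl.
  rewrite -[in RHS](subrK tau v) Gt ?mul1r ?addrK//.
  move=> h'; apply: vl; rewrite (_ : v - p = v - tau - p + tau); last by ring.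
  exact: latticeD h' (lattice_tau tau).
have c0 : 2 * piC R * iC R * f p = 0.
  apply: (@additive_period_eq0 R G tau) => //.
  - exact: row_regular_off Gd.
  - by move=> z; apply: nearW => w; exact: G1.
  - by move=> z; apply: filterS (near_off_lattice p z) => w wl; exact: Gt.
apply/eqP; move/eqP: c0; rewrite !mulf_eq0 pnatr_eq0 (negbTE (pi_neq0 R)) (negbTE (I_neq0 R)) //.
Qed.

End kernels.

(** * Kronecker's function *)

Section kronecker.
Variable R : realType.
Notation C := (Cx R).
Variable tau : C.
Hypothesis tau_im : 0 < complex.Im tau.
Local Notation P := (piC R).
Local Notation I := (iC R).
Local Notation q4 := (nome4 tau).
Local Notation e := (@epi R).
Local Notation th := (theta1 tau).

(** [1] and [tau] are independent over the reals. *)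
Lemma lattice_coords (a b : R) : lattice tau (a%:C + b%:C * tau) ->
  exists m n : int, a = m%:~R /\ b = n%:~R.
Proof.
move=> [m [n h]]; exists m, n.
have intC (k : int) : (k%:~R : C) = (k%:~R : R)%:C by rewrite rmorph_int.
have hi : b * complex.Im tau = n%:~R * complex.Im tau.
  have := f_equal (@complex.Im R) h.
  by rewrite !intC !cImD !cImM /= !mul0r !addr0 !add0r.
have bn : b = n%:~R by apply: (mulIf (lt0r_neq0 tau_im)).
split=> //; have := f_equal (@complex.Re R) h.
by rewrite !intC !cReD !cReM /= !mul0r !subr0 bn => /addIr.
Qed.

Lemma half_not_int (m : int) : (1 / 2 : R) <> m%:~R.
Proof.
move=> h; have : (1%:~R : R) = (m * 2)%:~R.
  by rewrite intrM -h (_ : (2 : int)%:~R = 2 :> R)// div1r mulVf ?pnatr_eq0.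
by move=> /eqP; rewrite eqr_int => /eqP; lia.
Qed.

Lemma halfC : (1 / 2 : C) = (1 / 2 : R)%:C.
Proof. by rewrite rmorphM rmorph1 fmorphV rmorph_nat. Qed.

Lemma half_off_lattice : ~ lattice tau (1 / 2).
Proof.
move=> h; have := @lattice_coords (1 / 2) 0; rewrite -halfC mul0r addr0 => /(_ h).
by move=> [m [n [/half_not_int]]].
Qed.

Lemma halftau_off_lattice : ~ lattice tau (tau / 2).
Proof.
move=> h; have := @lattice_coords 0 (1 / 2); rewrite -halfC add0r.
have -> : 1 / 2 * tau = tau / 2 by field.
by move=> /(_ h)[m [n [_ /half_not_int]]].
Qed.

Lemma halfsum_off_lattice : ~ lattice tau (1 / 2 + tau / 2).
Proof.
move=> h; have := @lattice_coords (1 / 2) (1 / 2); rewrite -halfC.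
have -> : 1 / 2 * tau = tau / 2 by field.
by move=> /(_ h)[m [n [/half_not_int]]].
Qed.

Lemma off_lattice_eq (z w : C) : lattice tau (z - w) \/ lattice tau (z + w) ->
  ~ lattice tau w -> ~ lattice tau z.
Proof.
move=> h wl zl; apply: wl; case: h => h.
  rewrite (_ : w = z - (z - w)); [exact: latticeB|ring].
rewrite (_ : w = (z + w) - z); [exact: latticeB|ring].
Qed.

Lemma th_neq0 z : ~ lattice tau z -> th z != 0.
Proof. by move=> zl; apply/eqP => /(theta1_eq0 tau_im). Qed.

Lemma theta4_even z : theta4 tau (- z) = theta4 tau z.
Proof.
have zE : z + 1 / 2 = - (- z + 1 / 2) + 1 by field.
by rewrite !theta4_theta3// zE theta3_add1// theta3_even.
Qed.

Lemma theta2_0_neq0 : theta2 tau 0 != 0.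
Proof. by rewrite theta2_theta1// add0r; apply: th_neq0 half_off_lattice. Qed.

Lemma theta3_0_neq0 : theta3 tau 0 != 0.
Proof.
have := th_neq0 halfsum_off_lattice; rewrite -{1}(add0r (1 / 2)) theta3_theta1//.
by rewrite mulf_eq0 => /norP[].
Qed.

Lemma theta4_neq0 z : ~ lattice tau (z + tau / 2) -> theta4 tau z != 0.
Proof. by move=> /th_neq0; rewrite theta4_theta1// mulf_eq0 => /norP[]. Qed.

Lemma theta4_0_neq0 : theta4 tau 0 != 0.
Proof. by apply: theta4_neq0; rewrite add0r; exact: halftau_off_lattice. Qed.

Definition theta1'0 : C := P * theta2 tau 0 * theta3 tau 0 * theta4 tau 0.

Lemma theta1'0_neq0 : theta1'0 != 0.
Proof.
rewrite /theta1'0; apply: mulf_neq0 theta4_0_neq0; apply: mulf_neq0 theta3_0_neq0.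
by apply: mulf_neq0 theta2_0_neq0; exact: pi_neq0.
Qed.

Lemma theta_data : exists T1 T2 : C -> C,
  [/\ forall z : C, is_derive z 1 th (T1 z), forall z : C, is_derive z 1 T1 (T2 z)
    & T1 0 = theta1'0].
Proof.
have [T1 [T2 [h1 h2]]] := theta1_twice_derivable tau_im.
exists T1, T2; split => //; exact: is_derive_unique (h1 0) (theta1_deriv0 tau_im).
Qed.

(** [vanishing] for the derivatives of [theta1]; the normalization at 0 is
    Jacobi's derivative formula. *)
Lemma no_section (s m : C) (W f : C -> C) (ps : seq C) : s != 0 -> m != 0 ->
  kernel_spec tau s m W ->
  (forall z, f (z + 1) = s * f z) -> (forall z, f (z + tau) = m * f z) ->
  (forall z, removable f z) -> (forall z, off_poles tau ps z -> derivable f z 1) ->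
  forall p, off_poles tau ps p -> f p = 0.
Proof.
have [T1 [T2 [h1 h2 h3]]] := theta_data.
have d0 : T1 0 != 0 by rewrite h3 theta1'0_neq0.
exact: (vanishing tau_im h1 h2 d0).
Qed.

Lemma off_lattice_near (p z : C) : \forall w \near z^', ~ lattice tau (w - p).
Proof.
have [T1 [T2 [h1 h2 h3]]] := theta_data.
have d0 : T1 0 != 0 by rewrite h3 theta1'0_neq0.
exact: (near_off_lattice tau_im h1 h2 d0).
Qed.

Lemma off_lattice_open (z : C) : ~ lattice tau z ->
  exists2 r : R, 0 < r & forall w, cabs (w - z) < r -> ~ lattice tau w.
Proof.
have [T1 [T2 [h1 h2 h3]]] := theta_data.
exact: (lattice_open tau_im h1).
Qed.

Definition half_shift (j : bool) : C := if j then tau / 2 else 0.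

(** Kronecker's function, twisted by an exponential when [j] holds so that it
    is antiperiodic under 1. *)
Definition kron (j : bool) (u z : C) : C :=
  e (- z) ^+ j * (theta1'0 * th (u - half_shift j + z) / (th (u - half_shift j) * th z)).

Lemma is_derive_epi (z : C) : is_derive z 1 (fun w => e (- w)) (- (P * I) * e (- z)).
Proof.
have := is_derive_expterm 1 (- (P * I)) z; rewrite mul1r.
rewrite (_ : expC (- (P * I) * z) = e (- z)); last by rewrite /epi mulrN mulNr.
by apply: is_derive_ext => w; rewrite mul1r /epi mulrN mulNr.
Qed.

Lemma derivable_epiX (j : bool) (z : C) : derivable (fun w : C => e (- w) ^+ j) z 1.
Proof.
case: j => /=; first by apply/derivableCP; eexists; exact: is_derive_epi.
by apply/derivableCP; exists 0; exact: is_deriveC_cst.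
Qed.

Lemma kron_spec (j : bool) (u : C) : ~ lattice tau (u - half_shift j) ->
  kernel_spec tau ((-1) ^+ j) (e (- u) ^+ 2) (kron j u).
Proof.
move=> ul; have tu := th_neq0 ul.
have [T1 [T2 [h1 h2 h3]]] := theta_data.
have d0 : T1 0 != 0 by rewrite h3 theta1'0_neq0.
set u' := u - half_shift j in ul tu *.
have shd (z : C) : derivable (fun w : C => th (u' + w)) z 1.
  have : derivable th (z + u') 1 by apply/derivableCP; exists (T1 (z + u')).
  move=> H; have := derivable_shiftC H.
  by rewrite (_ : (fun w : C => th (w + u')) = (fun w => th (u' + w)))//; apply/funext => w; rewrite addrC.
split.
- move=> z; rewrite /kron -/u' addrA !theta1_add1// e_Nadd1 (exprNn (e (- z))) !mulrN invrN mulrNN; ring.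
- move=> z; rewrite /kron -/u' addrA !theta1_addtau// (opprD z tau) (opprD u' z) !eD.
  have q40 := nome4_neq0 tau; have z0 : e (- z) != 0 := expC_neq0 _.
  have qE := nome4X4 tau; have q0 := nome_neq0 tau.
  have e2 : e (- u') ^+ 2 * e (- tau) ^+ j = e (- u) ^+ 2.
    rewrite /u' opprB /half_shift; case: (j) => /=; last by rewrite add0r mulr1.
    rewrite eD exprMn e_tauhalf mulrAC expr1 (_ : e (- tau) = (q4 ^+ 2 * q4 ^+ 2)^-1).
      by field; exact: q40.
    by rewrite -exprD qE /epi mulrN expCN.
  rewrite exprMn -e2; have [tz|tz] := eqVneq (th z) 0.
    by rewrite tz !mulr0 invr0 !mulr0.
  by field; rewrite tu z0 tz q0.
- by move=> z /(theta1_eq0 tau_im) tz; rewrite /kron tz mulr0 invr0 !mulr0.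
- move=> z zl; have tz := th_neq0 zl.
  apply: derivable_mulC; first exact: derivable_epiX.
  apply: derivable_mulC; first exact: derivable_scaleC.
  apply: derivable_invC; first by rewrite mulf_neq0.
  by apply: derivable_scaleC; apply/derivableCP; exists (T1 z).
have [r r0 Hr] := slope_near0 tau_im h1 h2 d0.
exists (fun z => e (- z) ^+ j * (theta1'0 * th (u' + z) / (th u' * slope th 0 (T1 0) z))).
exists r => //; split.
- rewrite slope0 addr0 oppr0 /epi mulr0 expC0 expr1n mul1r h3.
  by field; rewrite theta1'0_neq0 tu.
- move=> z /Hr sz; apply: derivable_mulC; first exact: derivable_epiX.
  apply: derivable_mulC; first exact: derivable_scaleC.
  apply: derivable_invC; first by rewrite mulf_neq0.
  by apply: derivable_scaleC; exact: (slope_derivable tau_im h1 h2).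
- move=> z z0 /Hr sz; rewrite /kron -/u' (theta_slope tau_im T1 z).
  by field; rewrite sz z0 tu.
Qed.

(** At the three half periods the numerator is one of the even theta functions,
    and the kernels become odd functions of [y]. *)
Lemma kron_half (y : C) : kron false (1 / 2) y =
  theta1'0 * theta2 tau y / (theta2 tau 0 * th y).
Proof.
rewrite /kron expr0 mul1r /half_shift subr0 (theta2_theta1 tau y) (theta2_theta1 tau 0) add0r.
by rewrite [1 / 2 + y]addrC.
Qed.

Lemma kron_halftau (y : C) : kron true 0 y =
  theta1'0 * theta4 tau y / (theta4 tau 0 * th y).
Proof.
have sh (z : C) : th (0 - tau / 2 + z) = - (q4^-1 * (I * e z) * theta4 tau z).
  rewrite (_ : 0 - tau / 2 + z = - (- z + tau / 2)); last by ring.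
  by rewrite theta1_odd// theta4_theta1// opprK theta4_even.
have := sh 0; rewrite addr0 => sh0.
rewrite /kron expr1 /half_shift sh sh0 /epi mulr0 expC0 -/(epi y) -/(epi (- y)).
have k0 := nome4_neq0 tau; have i0 := I_neq0 R; have t0 := theta4_0_neq0.
have [->|ty] := eqVneq (th y) 0; first by rewrite !mulr0 invr0 !mulr0.
transitivity ((e y * e (- y)) * (theta1'0 * theta4 tau y / (theta4 tau 0 * th y))).
  by field; rewrite ty t0 i0 k0.
by rewrite eNK mul1r.
Qed.

Lemma kron_halfsum (y : C) : kron true (1 / 2) y =
  theta1'0 * theta3 tau y / (theta3 tau 0 * th y).
Proof.
have sh (z : C) : th (1 / 2 - tau / 2 + z) = q4^-1 * e z * theta3 tau z.
  rewrite -[X in th X]opprK theta1_odd// -theta1_add1//.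
  rewrite (_ : - (1 / 2 - tau / 2 + z) + 1 = - z + 1 / 2 + tau / 2); last by field.
  by rewrite theta3_theta1// opprK theta3_even.
have := sh 0; rewrite addr0 => sh0.
rewrite /kron expr1 /half_shift sh sh0 /epi mulr0 expC0 -/(epi y) -/(epi (- y)).
have k0 := nome4_neq0 tau; have t0 := theta3_0_neq0.
have [->|ty] := eqVneq (th y) 0; first by rewrite !mulr0 invr0 !mulr0.
transitivity ((e y * e (- y)) * (theta1'0 * theta3 tau y / (theta3 tau 0 * th y))).
  by field; rewrite ty t0 k0.
by rewrite eNK mul1r.
Qed.

Lemma kron_cvg (j : bool) (c y : C) : ~ lattice tau (c - half_shift j) -> ~ lattice tau y ->
  kron j (x / 2 + c) y @[x --> 0^'] --> kron j c y.
Proof.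
move=> cl yl; have tc := th_neq0 cl; have ty := th_neq0 yl.
have [T1 [T2 [h1 _ _]]] := theta_data.
have lin (b : C) : (fun x : C => th (2^-1 * x + b)) @ 0^' --> th b.
  have : derivable (fun x : C => th (2^-1 * x + b)) 0 1.
    by apply: derivable_affC; apply/derivableCP; exists (T1 (2^-1 * 0 + b)).
  by move=> /derivable_dcont; rewrite mulr0 add0r.
have H : (fun x : C => e (- y) ^+ j * (theta1'0 * th (2^-1 * x + (c - half_shift j + y)) *
    (th (2^-1 * x + (c - half_shift j)) * th y)^-1)) @ 0^' --> kron j c y.
  apply: cvgC_mul; first exact: cvgC_cst.
  apply: cvgC_mul; first by apply: cvgC_mul; [exact: cvgC_cst|exact: lin].
  apply: cvgC_inv; first by rewrite mulf_neq0.
  by apply: cvgC_mul; [exact: lin|exact: cvgC_cst].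
move: H; rewrite (_ : (fun x : C => _) = (fun x => kron j (x / 2 + c) y))//.
apply/funext => x; rewrite /kron.
by rewrite !addrA [2^-1 * x]mulrC.
Qed.

End kronecker.

(** * Two-by-two matrices *)

Section matrices.
Variable R : realType.
Notation C := (Cx R).

Lemma I2P (P : 'I_2 -> Prop) : P 0 -> P 1 -> forall i, P i.
Proof.
move=> p0 p1 i; case: (unliftP 0 i) => [i' ->|->//]; rewrite (ord1 i').
by rewrite (_ : lift _ _ = 1)//; exact: val_inj.
Qed.

Lemma mx2P (A B : 'M[C]_2) : A 0 0 = B 0 0 -> A 0 1 = B 0 1 -> A 1 0 = B 1 0 ->
  A 1 1 = B 1 1 -> A = B.
Proof.
move=> h1 h2 h3 h4; apply/matrixP => i j.
by move: i; apply: I2P; move: j; apply: I2P.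
Qed.

Lemma mx2E (a b c d : C) : (mx2 a b c d 0 0 = a) * (mx2 a b c d 0 1 = b) *
  (mx2 a b c d 1 0 = c) * (mx2 a b c d 1 1 = d).
Proof. by rewrite !mxE. Qed.

Lemma mulmx2E (A B : 'M[C]_2) i j : (A *m B) i j = A i 0 * B 0 j + A i 1 * B 1 j.
Proof.
rewrite mxE big_ord_recl big_ord1 (_ : lift _ _ = 1)//; exact: val_inj.
Qed.

Lemma scalemx2E (a : C) (A : 'M[C]_2) i j : (a *: A) i j = a * A i j.
Proof. by rewrite mxE. Qed.

Lemma cvg_mx (T : Type) (F : set_system T) (FF : Filter F) (m n : nat)
    (f : T -> 'M[C]_(m, n)) (l : 'M[C]_(m, n)) :
  (forall i j, (fun x => f x i j) @ F --> l i j) -> f @ F --> l.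
Proof.
move=> H A [P HP PA]; have : \forall x \near F, forall i j, P i j (f x i j).
  apply: filter_forall => i; apply: filter_forall => j; exact: (H i j (P i j) (HP i j)).
by apply: filterS => x Px; apply: PA.
Qed.

End matrices.

(** * The four components of a section *)

Section sections.
Variable R : realType.
Notation C := (Cx R).
Variable tau : C.
Local Notation e := (@epi R).

(** Coordinates that diagonalize the gluing of the bundles, which exchanges the
    two diagonal entries and, up to exponentials, the two others: their sums and
    differences, the exponentials being absorbed. *)
Definition component (j i : bool) (A : 'M[C]_2) (z : C) : C :=
  if j then e (- z) * A 0 1 + (-1) ^+ i * (e (z + tau) * A 1 0)
  else A 0 0 + (-1) ^+ i * A 1 1.

Definition of_components (c : bool -> bool -> C) (z : C) : 'M[C]_2 :=
  mx2 ((c false false + c false true) / 2) (e z * (c true false + c true true) / 2)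
    (e (- (z + tau)) * (c true false - c true true) / 2) ((c false false - c false true) / 2).

Lemma componentK j i c z : component j i (of_components c z) z = c j i.
Proof.
rewrite /component !mx2E; case: j; last by case: i; field.
transitivity (e z * e (- z) * ((c true false + c true true) / 2) +
    (-1) ^+ i * (e (z + tau) * e (- (z + tau)) * ((c true false - c true true) / 2))).
  by field.
by rewrite !eNK; case: i; field.
Qed.

Lemma of_componentsK A z : of_components (fun j i => component j i A z) z = A.
Proof.
have h1 := eNK z; have h2 := eNK (z + tau).
apply: mx2P; rewrite mx2E /component ?expr1 ?expr0.
- by field.
- transitivity (e z * e (- z) * A 0 1); first by field.
  by rewrite h1 mul1r.
- transitivity (e (z + tau) * e (- (z + tau)) * A 1 0); first by field.
  by rewrite h2 mul1r.
- by field.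
Qed.

Lemma componentZ j i a A z : component j i (a *: A) z = a * component j i A z.
Proof. by rewrite /component !mxE; case: j; ring. Qed.

Lemma of_componentsZ a c z : of_components (fun j i => a * c j i) z = a *: of_components c z.
Proof. by apply: mx2P; rewrite scalemx2E !mx2E; ring. Qed.

Lemma Phi_rel x1 x2 (z : C) (A B : 'M[C]_2) :
  A *m Phi tau x1 z = Phi tau x2 z *m B <->
  [/\ A 0 0 = e (- (x2 - x1)) * B 1 1, A 1 1 = e (- (x2 - x1)) * B 0 0,
      A 0 1 = e (- (x2 - x1)) * e (z + tau) ^+ 2 * B 1 0
    & A 1 0 = e (- (x2 - x1)) * e (- (z + tau)) ^+ 2 * B 0 1].
Proof.
have PhiE x : Phi tau x z = e (- x) *: mx2 0 1 (e (- (z + tau)) ^+ 2) 0.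
  rewrite /Phi /epi -expC_natmul mulrN; congr (_ *: mx2 _ _ _ _).
  by apply: (f_equal (@expC R)); ring.
have x1E := eNK x1; have x2E := eNK x2; have zE := eNK (z + tau).
have n1 : e (- x1) != 0 := expC_neq0 _.
have n2 : e (- (z + tau)) != 0 := expC_neq0 _.
rewrite !PhiE opprB (eD x1) -scalemxAr -scalemxAl.
split=> [H|[h1 h2 h3 h4]].
  have H' i j := f_equal (fun M : 'M[C]_2 => M i j) H.
  move: (H' 0 0) (H' 0 1) (H' 1 0) (H' 1 1).
  rewrite !scalemx2E !mulmx2E !mx2E => h00 h01 h10 h11.
  split; apply: (mulfI n1).
  - move: h01; rewrite !(mulr0, mul0r, mulr1, mul1r, addr0, add0r) => ->.
    by rewrite -[LHS]mul1r -x1E; ring.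
  - apply: (mulIf (expf_neq0 2 n2)); rewrite -mulrA.
    move: h10; rewrite !(mulr0, mul0r, mulr1, mul1r, addr0, add0r) => ->.
    by rewrite -[LHS]mul1r -x1E; ring.
  - apply: (mulIf (expf_neq0 2 n2)); rewrite -mulrA.
    move: h00; rewrite !(mulr0, mul0r, mulr1, mul1r, addr0, add0r) => ->.
    transitivity ((e x1 * e (- x1)) * (e (z + tau) * e (- (z + tau))) ^+ 2 * (e (- x2) * B 1 0)).
      by rewrite x1E zE; ring.
    ring.
  - move: h11; rewrite !(mulr0, mul0r, mulr1, mul1r, addr0, add0r) => ->.
    by rewrite -[LHS]mul1r -x1E; ring.
apply: mx2P; rewrite !scalemx2E !mulmx2E !mx2E !(mulr0, mul0r, mulr1, mul1r, addr0, add0r).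
- rewrite h3; transitivity ((e x1 * e (- x1)) * (e (z + tau) * e (- (z + tau))) ^+ 2 * (e (- x2) * B 1 0)).
    ring.
  by rewrite x1E zE; ring.
- by rewrite h1 -[RHS]mul1r -x1E; ring.
- by rewrite h2 -[RHS]mul1r -x1E; ring.
- by rewrite h4 -[RHS]mul1r -x1E; ring.
Qed.

(** Each component is multiplied by a constant under either period, so that a
    matrix condition becomes four scalar ones. *)
Lemma equivariant_componentP x1 x2 (F : C -> 'M[C]_2) :
  equivariant tau x1 x2 F <->
  forall (j i : bool) (z : C), component j i (F (z + 1)) (z + 1) = (-1) ^+ j * component j i (F z) z /\
    component j i (F (z + tau)) (z + tau) = (-1) ^+ i * e (- (x2 - x1)) * component j i (F z) z.
Proof.
split=> [H j i z|H z].
  have [-> /Phi_rel[h1 h2 h3 h4]] := H z; split.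
    rewrite /component; case: j; last by rewrite expr0 mul1r.
    by rewrite e_Nadd1 (_ : z + 1 + tau = z + tau + 1) ?e_add1; ring.
  rewrite /component h1 h2 h3 h4; case: j; last by case: i; ring.
  have zE := eNK (z + tau); rewrite (eD (z + tau) tau) (_ : e (- z) = e tau * e (- (z + tau))).
    transitivity (e (z + tau) * e (- (z + tau)) * (e (- (x2 - x1)) *
      (e (z + tau) * F z 1 0 + (-1) ^+ i * (e tau * e (- (z + tau)) * F z 0 1)))).
      ring.
    by rewrite zE; case: i; ring.
  by rewrite -eD; apply: (f_equal e); ring.
have ext (A B : 'M[C]_2) w : (forall j i, component j i A w = component j i B w) -> A = B.
  move=> AB; rewrite -(of_componentsK A w) -(of_componentsK B w); congr (of_components _ w).
  by apply/funext => j; apply/funext => i.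
split.
  apply: (ext _ _ (z + 1)) => j i; rewrite (H j i z).1 /component.
  case: j; last by rewrite expr0 mul1r.
  by rewrite e_Nadd1 (_ : z + 1 + tau = z + tau + 1) ?e_add1; ring.
apply/Phi_rel; set ep := e (- (x2 - x1)).
have -> : F (z + tau) = mx2 (ep * F z 1 1) (ep * e (z + tau) ^+ 2 * F z 1 0)
    (ep * e (- (z + tau)) ^+ 2 * F z 0 1) (ep * F z 0 0).
  apply: (ext _ _ (z + tau)) => j i; rewrite (H j i z).2 /component !mx2E -/ep.
  case: j; last by case: i; ring.
  have zE := eNK (z + tau); rewrite (eD (z + tau) tau) (_ : e (- z) = e tau * e (- (z + tau))).
    symmetry; transitivity (e (z + tau) * e (- (z + tau)) * (ep *
      (e (z + tau) * F z 1 0 + (-1) ^+ i * (e tau * e (- (z + tau)) * F z 0 1)))).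
      ring.
    by rewrite zE; case: i; ring.
  by rewrite -eD; apply: (f_equal e); ring.
by rewrite !mx2E.
Qed.

End sections.

(** * Sections with a simple pole and a given residue *)

Section hom_space.
Variable R : realType.
Notation C := (Cx R).
Variable tau : C.
Hypothesis tau_im : 0 < complex.Im tau.
Local Notation e := (@epi R).
Local Notation component := (component tau).
Local Notation of_components := (of_components tau).

Definition half_int (i : bool) : C := if i then 1 / 2 else 0.

(** The kernel with the two multipliers of the component [j], [i] of a section. *)
Definition kern (x : C) (j i : bool) : C -> C := kron tau j (x / 2 + half_int i).

Lemma kern_off_lattice (x : C) (j i : bool) : ~ lattice tau x ->
  ~ lattice tau (x / 2 + half_int i - half_shift tau j).
Proof.
move=> xl h; apply: xl; have := latticeD h h; set u := _ + _.
have -> : x = u - i%:R + j%:R * tau.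
  by rewrite /u /half_int /half_shift; case: i {h u}; case: j => /=; field.
move=> ul; apply: latticeD.
  apply: latticeB => //; exists i%:Z, 0; by rewrite mul0r addr0 -pmulrn.
by exists 0, j%:Z; rewrite add0r -pmulrn.
Qed.

Lemma kern_spec (x : C) (j i : bool) : ~ lattice tau x ->
  kernel_spec tau ((-1) ^+ j) ((-1) ^+ i * e (- x)) (kern x j i).
Proof.
move=> xl; have := kron_spec tau_im (kern_off_lattice (j := j) (i := i) xl).
suff -> : e (- (x / 2 + half_int i)) ^+ 2 = (-1) ^+ i * e (- x) by [].
rewrite opprD (eD (- (x / 2))) exprMn mulrC.
have -> : e (- (x / 2)) ^+ 2 = e (- x).
  by rewrite expr2 -eD; apply: (f_equal e); field.
apply: (f_equal (fun u => u * e (- x))).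
case: i => /=; last by rewrite /epi oppr0 mulr0 expC0 expr1n.
by rewrite e_Nhalf sqrrN expr2 iC2.
Qed.

Lemma e_neq0 (z : C) : e z != 0.
Proof. exact: expC_neq0. Qed.

(** By periodicity a kernel is proportional to its translates by the lattice, so
    what holds at the pole 0 holds at all the poles. *)
Lemma kernel_translate (s m l : C) (W : C -> C) : s != 0 -> m != 0 -> kernel_spec tau s m W ->
  lattice tau l -> exists mu : C, forall v, W (v + l) = mu * W v.
Proof.
move=> s0 m0 [W1 Wt _ _ _] ll.
have := @lattice_shift_ind R tau (fun l => exists mu : C, forall v, W (v + l) = mu * W v) 0 l.
rewrite add0r; apply => //; last by exists 1 => v; rewrite addr0 mul1r.
  move=> w; split=> -[mu H].
    by exists (s * mu) => v; rewrite addrA W1 H mulrA.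
  by exists (s^-1 * mu) => v; apply: (mulfI s0); rewrite -W1 -addrA H -mulrA mulVKf.
move=> w; split=> -[mu H].
  by exists (m * mu) => v; rewrite addrA Wt H mulrA.
by exists (m^-1 * mu) => v; apply: (mulfI m0); rewrite -Wt -addrA H -mulrA mulVKf.
Qed.

Lemma kernel_pole_at (s m p y1 : C) (W : C -> C) : s != 0 -> m != 0 -> kernel_spec tau s m W ->
  lattice tau (p - y1) -> exists g : C -> C,
  [/\ \forall w \near p, derivable g w 1, \forall w \near p^', W (w - y1) = g w / (w - p)
    & p = y1 -> g p = 1].
Proof.
move=> s0 m0 WP pl; have [W1 Wt Wl Wd [g [r r0 [g0 gd gW]]]] := WP.
have [mu0 Hmu0] := kernel_translate s0 m0 WP pl.
have [mu [mu1 Hmu]] : exists mu : C, (p = y1 -> mu = 1) /\ (forall v, W (v + (p - y1)) = mu * W v).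
  have [py|py] := eqVneq p y1; last by exists mu0; split=> // pE; rewrite pE eqxx in py.
  by exists 1; split=> // v; rewrite py subrr addr0 mul1r.
exists (fun w => mu * g (w - p)); split.
- apply/nbhsCP; exists r => // w wr; apply: derivable_scaleC.
  by apply: (derivable_shiftC (f := g)); exact: gd.
- apply/dnbhsCP; exists r => // w wp wr.
  have -> : w - y1 = (w - p) + (p - y1) by rewrite addrA subrK.
  by rewrite Hmu gW ?subr_eq0// mulrA.
- by move=> py; rewrite subrr g0 mulr1 mu1.
Qed.

Lemma holomorphic_of_components (c : bool -> bool -> C -> C) (z : C) :
  (forall j i, \forall w \near z, derivable (c j i) w 1) ->
  holomorphic_at (fun w => of_components (fun j i => c j i w) w) z.
Proof.
move=> H; apply: filterS (filter_forall _ (fun ji : bool * bool => H ji.1 ji.2)) => w h.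
have /= a00 := h (false, false); have /= a01 := h (false, true).
have /= a10 := h (true, false); have /= a11 := h (true, true).
have de (a b u : C) : derivable (fun v : C => e (a * v + b)) u 1.
  apply/derivableCP; eexists; apply: (is_derive_ext (f := fun w => expC (piC R * iC R * b) * expC (piC R * iC R * a * w))).
    by move=> v; rewrite -expCD /epi; apply: (f_equal (@expC R)); ring.
  exact: is_derive_expterm.
have de1 : derivable (fun u : C => e u) w 1.
  by have := de 1 0 w; rewrite (_ : (fun v : C => _) = (fun u => e u))//; apply/funext => v; rewrite mul1r addr0.
have de2 : derivable (fun u : C => e (- (u + tau))) w 1.
  have := de (-1) (- tau) w; rewrite (_ : (fun v : C => _) = (fun u => e (- (u + tau))))//.
  by apply/funext => v; rewrite mulN1r opprD.
have s1 := derivable_scaleC (a := 2^-1) (derivable_addC a00 a01).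
have s2 := derivable_scaleC (a := 2^-1) (derivable_mulC de1 (derivable_addC a10 a11)).
have s3 := derivable_scaleC (a := 2^-1) (derivable_mulC de2 (derivable_subC a10 a11)).
have s4 := derivable_scaleC (a := 2^-1) (derivable_subC a00 a01).
have ext (f g : C -> C) : derivable f w 1 -> (forall u, f u = g u) -> derivable g w 1.
  by move=> fd fg; rewrite (_ : g = f)//; apply/funext => u; rewrite fg.
apply: I2P; apply: I2P.
- by apply: (ext _ _ s1) => u; rewrite mx2E mulrC.
- by apply: (ext _ _ s2) => u; rewrite mx2E mulrC.
- by apply: (ext _ _ s3) => u; rewrite mx2E mulrC.
- by apply: (ext _ _ s4) => u; rewrite mx2E mulrC.
Qed.

Lemma derivable_component (F : C -> 'M[C]_2) (z : C) j i : holomorphic_at F z ->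
  derivable (fun w => component j i (F w) w) z 1.
Proof.
move=> /nbhs_singleton H.
have de1 : derivable (fun u : C => e (- u)) z 1.
  by apply/derivableCP; eexists; exact: is_derive_epi.
have de2 : derivable (fun u : C => e (u + tau)) z 1.
  apply/derivableCP; eexists; apply: (is_derive_ext (f := fun w => expC (piC R * iC R * tau) * expC (piC R * iC R * w))).
    by move=> v; rewrite -expCD /epi; apply: (f_equal (@expC R)); ring.
  exact: is_derive_expterm.
rewrite /component; case: j.
  apply: derivable_addC; first by apply: derivable_mulC; [exact: de1|exact: H].
  by apply: derivable_scaleC; apply: derivable_mulC; [exact: de2|exact: H].
by apply: derivable_addC; [exact: H|apply: derivable_scaleC; exact: H].
Qed.

(** In each component, the multiple of the kernel whose residue at [y1] is that
    component of [A]. *)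
Definition hom_section (x y1 : C) (A : 'M[C]_2) (z : C) : 'M[C]_2 :=
  of_components (fun j i => component j i A y1 * kern x j i (z - y1)) z.

Lemma component_hom_section (x y1 : C) A z j i :
  component j i (hom_section x y1 A z) z = component j i A y1 * kern x j i (z - y1).
Proof. exact: componentK. Qed.

Lemma hom_section_pole (x y1 p : C) (A : 'M[C]_2) : ~ lattice tau x -> lattice tau (p - y1) ->
  exists G : C -> 'M[C]_2, [/\ holomorphic_at G p,
    \forall w \near p^', hom_section x y1 A w = (w - p)^-1 *: G w & p = y1 -> G p = A].
Proof.
move=> xl pl.
have s0 (b : bool) : (-1) ^+ b != 0 :> C by rewrite signr_eq0.
have m0 (b : bool) : (-1) ^+ b * e (- x) != 0 :> C by rewrite mulf_neq0// e_neq0.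
have /choice[g Hg] := fun ji : bool * bool =>
  kernel_pole_at (s0 ji.1) (m0 ji.2) (kern_spec ji.1 ji.2 xl) pl.
exists (fun z => of_components (fun j i => component j i A y1 * g (j, i) z) z); split.
- apply: (holomorphic_of_components (c := fun j i w => component j i A y1 * g (j, i) w)) => j i.
  by have [h _ _] := Hg (j, i); apply: filterS h => w; exact: derivable_scaleC.
- have H j i : \forall w \near p^', kern x j i (w - y1) = g (j, i) w / (w - p).
    by have [_ h _] := Hg (j, i).
  apply: filterS (filter_forall _ (fun ji : bool * bool => H ji.1 ji.2)) => w h.
  rewrite -of_componentsZ /hom_section.
  apply: (f_equal (fun c => of_components c w)); apply/funext => j; apply/funext => i.
  by rewrite (h (j, i)) /=; ring.
- move=> py; rewrite [RHS](esym (of_componentsK tau A p)).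
  apply: (f_equal (fun c => of_components c p)); apply/funext => j; apply/funext => i.
  by have [_ _ ->] := Hg (j, i) => //; rewrite mulr1 py.
Qed.

Lemma hom_section_mem (x1 x2 y1 : C) (A : 'M[C]_2) : ~ lattice tau (x2 - x1) ->
  hom_pole tau x1 x2 y1 (hom_section (x2 - x1) y1 A).
Proof.
move=> xl; split.
- apply/equivariant_componentP => j i z; have [h1 ht _ _ _] := kern_spec j i xl.
  have h w := component_hom_section (x2 - x1) y1 A w j i.
  split; apply: (etrans (h _)); apply: esym; apply: (etrans (f_equal _ (h z))).
    by rewrite (addrAC z 1) h1; ring.
  by rewrite (addrAC z tau) ht; ring.
- move=> z zl; have [r r0 Hr] := off_lattice_open tau_im zl.
  apply: (holomorphic_of_components (c := fun j i w => component j i A y1 * kern (x2 - x1) j i (w - y1))) => j i.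
  apply/nbhsCP; exists r => // w wr; apply: derivable_scaleC.
  apply: (derivable_shiftC (f := kern (x2 - x1) j i)).
  apply: (kernel_derivable (kern_spec j i xl)); apply: Hr.
  by rewrite (_ : w - y1 - (z - y1) = w - z); last ring.
- move=> z zl; split.
    by have [G [h1 h2 _]] := hom_section_pole A xl zl; exists G.
  rewrite /hom_section -(scale0r (of_components (fun _ _ => 0) z)) -of_componentsZ.
  apply: (f_equal (fun c => of_components c z)); apply/funext => j; apply/funext => i.
  by rewrite (kernel_lattice (kern_spec j i xl) zl) !mulr0.
Qed.

Lemma mx_hausdorff (m n : nat) : hausdorff_space 'M[C]_(m, n).
Proof.
move=> A B AB; apply/matrixP => i j.
have hC : hausdorff_space C by exact: norm_hausdorff.
apply: hC => U V UA VB.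
have [M [MU MV]] := AB ((fun M : 'M[C]_(m, n) => M i j) @^-1` U)
  ((fun M : 'M[C]_(m, n) => M i j) @^-1` V) (coord_continuous UA) (coord_continuous VB).
by exists (M i j).
Qed.

Lemma residue_pole (p : C) (F G : C -> 'M[C]_2) : holomorphic_at G p ->
  (\forall w \near p^', F w = (w - p)^-1 *: G w) -> residue p F = G p.
Proof.
move=> /nbhs_singleton Gp FG; apply: cvg_lim; first exact: mx_hausdorff.
apply: cvg_mx => i j.
have /derivable_dcont : derivable (fun u => G u i j) p 1 by exact: Gp.
apply: cvg_trans; apply: near_eq_cvg.
have np : \forall w \near p^', w != p by exact: nbhs_dnbhs_neq.
by move: np FG; apply: filterS2 => w wp ->; rewrite scalerA divff ?subr_eq0// scale1r.
Qed.

Lemma removable_translate (s m p l : C) (f : C -> C) : s != 0 -> m != 0 ->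
  (forall z, f (z + 1) = s * f z) -> (forall z, f (z + tau) = m * f z) ->
  removable f p -> lattice tau l -> removable f (p + l).
Proof.
move=> s0 m0 f1 ft fp ll; apply: (@lattice_shift_ind R tau (removable f) p l _ _ ll fp).
  move=> v; split=> h.
    by apply: (removable_shift (b := s) (c := 0) h); apply: nearW => u; rewrite f1 addr0.
  rewrite -(addrK 1 v); apply: (removable_shift (b := s^-1) (c := 0) h).
  by apply: nearW => u; rewrite addr0; apply: (mulfI s0); rewrite -f1 subrK mulVKf.
move=> v; split=> h.
  by apply: (removable_shift (b := m) (c := 0) h); apply: nearW => u; rewrite ft addr0.
rewrite -(addrK tau v); apply: (removable_shift (b := m^-1) (c := 0) h).
by apply: nearW => u; rewrite addr0; apply: (mulfI m0); rewrite -ft subrK mulVKf.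
Qed.

(** The components of the difference of two sections with the same residue have
    only removable singularities, and a nontrivial character: they vanish. *)
Lemma hom_pole_inj (x1 x2 y1 : C) (F1 F2 : C -> 'M[C]_2) : ~ lattice tau (x2 - x1) ->
  hom_pole tau x1 x2 y1 F1 -> hom_pole tau x1 x2 y1 F2 ->
  residue y1 F1 = residue y1 F2 -> F1 = F2.
Proof.
move=> xl [/equivariant_componentP eq1 h1 p1] [/equivariant_componentP eq2 h2 p2] res.
have l0 : lattice tau (y1 - y1) by rewrite subrr; exact: lattice0.
have [[G1 G1h G1E] _] := p1 y1 l0; have [[G2 G2h G2E] _] := p2 y1 l0.
have G12 : G1 y1 = G2 y1.
  by rewrite -(residue_pole G1h G1E) -(residue_pole G2h G2E).
suff H j i z : component j i (F1 z) z = component j i (F2 z) z.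
  apply/funext => z; rewrite -(of_componentsK tau (F1 z) z) -(of_componentsK tau (F2 z) z).
  by apply: (f_equal (fun c => of_components c z)); apply/funext => j; apply/funext => i.
have [zl|zl] := pselect (lattice tau (z - y1)).
  by rewrite (p1 z zl).2 (p2 z zl).2.
pose f z := component j i (F1 z) z - component j i (F2 z) z.
have s0 (b : bool) : (-1) ^+ b != 0 :> C by rewrite signr_eq0.
have m0 : (-1) ^+ i * e (- (x2 - x1)) != 0 :> C by rewrite mulf_neq0// e_neq0.
have f1 w : f (w + 1) = (-1) ^+ j * f w.
  by rewrite /f (eq1 j i w).1 (eq2 j i w).1 mulrBr.
have ft w : f (w + tau) = (-1) ^+ i * e (- (x2 - x1)) * f w.
  by rewrite /f (eq1 j i w).2 (eq2 j i w).2 mulrBr.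
have fd w : off_poles tau [:: y1] w -> derivable f w 1.
  move=> wp; have wl : ~ lattice tau (w - y1) by apply: wp; rewrite inE.
  by apply: derivable_subC; apply: derivable_component; [exact: h1|exact: h2].
have fy : removable f y1.
  pose N z := component j i (G1 z) z - component j i (G2 z) z.
  apply: (@removable_near _ (fun z => N z / (z - y1))).
    move: G1E G2E; apply: filterS2 => w w1 w2.
    by rewrite /f w1 w2 !componentZ /N; ring.
  apply: quotient_removable; last by rewrite /N G12 subrr.
  by apply: derivable_subC; exact: derivable_component.
have fr w : removable f w.
  have [wl|wl] := pselect (lattice tau (w - y1)); last first.
    by apply: removable_derivable; apply: fd => p; rewrite inE => /eqP->.
  have -> : w = y1 + (w - y1) by rewrite addrC subrK.
  exact: (removable_translate (s0 j) m0 f1 ft).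
apply/eqP; rewrite -subr_eq0; apply/eqP.
apply: (no_section tau_im (s0 j) m0 (kern_spec j i xl) f1 ft fr fd).
by move=> p; rewrite inE => /eqP->.
Qed.

Lemma residue_hom_section (x y1 : C) (A : 'M[C]_2) : ~ lattice tau x ->
  residue y1 (hom_section x y1 A) = A.
Proof.
move=> xl; have [|G [h1 h2 h3]] := @hom_section_pole x y1 y1 A xl.
  by rewrite subrr; exact: lattice0.
by rewrite (residue_pole h1 h2) h3.
Qed.

Lemma residue_bij (x1 x2 y1 : C) : ~ lattice tau (x2 - x1) ->
  set_bij (hom_pole tau x1 x2 y1) setT (residue y1).
Proof.
move=> xl; split=> //.
  by move=> F1 F2 /set_mem h1 /set_mem h2; exact: (hom_pole_inj xl h1 h2).
move=> A _; exists (hom_section (x2 - x1) y1 A); first exact: hom_section_mem.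
exact: residue_hom_section.
Qed.

Lemma r_tildeE (x1 x2 y1 y2 : C) (A : 'M[C]_2) : ~ lattice tau (x2 - x1) ->
  r_tilde tau x1 x2 y1 y2 A = hom_section (x2 - x1) y1 A y2.
Proof.
move=> xl; rewrite /r_tilde; apply: (f_equal (fun F : C -> 'M[C]_2 => F y2)).
apply: xget_unique.
  by split; [exact: hom_section_mem|exact: residue_hom_section].
move=> F [Fh Fr]; apply: (hom_pole_inj xl Fh (hom_section_mem y1 A xl)).
by rewrite Fr residue_hom_section.
Qed.

End hom_space.

(** * Isomorphisms between the bundles *)

Section isomorphisms.
Variable R : realType.
Notation C := (Cx R).
Variable tau : C.
Local Notation e := (@epi R).

Lemma e_int (m : int) : e m%:~R = (-1) ^+ odd `|m|%N.
Proof.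
have eN (n : nat) : e n%:R = (-1) ^+ odd n.
  by rewrite signr_odd -e_1 /epi -expC_natmul mulr1; apply: (f_equal (@expC R)); ring.
case: m => n; first by rewrite -pmulrn eN.
rewrite NegzE mulrNz -pmulrn abszN absz_nat.
apply: (mulfI (expC_neq0 _ : e n.+1%:R != 0)).
by rewrite eNK eN -signr_addb addbb.
Qed.

Lemma det_mx2 (a b c d : C) : \det (mx2 a b c d) = a * d - b * c.
Proof.
rewrite (expand_det_row _ 0) !big_ord_recl big_ord0 /cofactor !det_mx11.
rewrite !mxE /= expr0 expr1; ring.
Qed.

(** When the parameters differ by a lattice point, an exponential without zeros
    has the multipliers of one of the components; with the other components equal
    to 0 it gives an invertible section. *)
Lemma lattice_isomorphic (x1 x2 : C) : lattice tau (x2 - x1) -> isomorphic_bundles tau x1 x2.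
Proof.
move=> [m [n xE]]; pose j := odd `|n|%N; pose i := odd `|m|%N.
pose w z := e (- n%:~R * z).
pose c (j' i' : bool) (z : C) := if (j' == j) && (i' == i) then w z else 0.
have wd z : derivable w z 1.
  apply/derivableCP; eexists.
  apply: (is_derive_ext (f := fun z => 1 * expC (piC R * iC R * (- n%:~R) * z))).
    by move=> v; rewrite mul1r /w /epi; apply: (f_equal (@expC R)); ring.
  exact: is_derive_expterm.
have signV (k : int) : e (- k%:~R) = (-1) ^+ odd `|k|%N.
  by rewrite -mulrNz e_int abszN.
exists (fun z => of_components tau (fun j i => c j i z) z); split.
- apply/equivariant_componentP => j' i' z; rewrite !componentK /c.
  case: eqVneq => [->|_] /=; last by rewrite !mulr0.
  case: eqVneq => [->|_] /=; last by rewrite !mulr0.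
  split; first by rewrite /w mulrDr mulr1 (eD (- n%:~R * z)) signV mulrC.
  rewrite /w mulrDr (eD (- n%:~R * z)) xE opprD (eD (- m%:~R)) signV (mulNr _ tau).
  rewrite mulrC; apply: (f_equal (fun u => u * _)).
  by rewrite mulrA -signr_addb addbb mul1r.
- move=> z; apply: (@holomorphic_of_components R tau c z) => j' i'.
  apply/nbhsCP; exists 1 => // v _.
  rewrite /c; case: ((j' == j) && (i' == i)); first exact: wd.
  by apply/derivableCP; exists 0; exact: is_deriveC_cst.
- move=> z; have w0 : w z != 0 := expC_neq0 _.
  have e0 : e z != 0 := expC_neq0 _.
  have e1 : e (- (z + tau)) != 0 := expC_neq0 _.
  have n2 : (2 : C) != 0 by rewrite pnatr_eq0.
  rewrite unitmxE det_mx2 unitfE /c.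
  case: (j); case: (i) => /=; rewrite !(addr0, add0r, subr0, sub0r, mul0r, mulr0, oppr0);
   rewrite ?oppr_eq0 !mulf_eq0 ?invr_eq0 ?oppr_eq0 ?(negbTE w0) ?(negbTE e0) ?(negbTE e1) ?(negbTE n2) //.
Qed.

End isomorphisms.

(** * Tensors in the Pauli basis *)

Section abstract_combinations.
Variable F : numFieldType.

Lemma bilinear_sum3 (V W : lmodType F) (B : V -> V -> W) :
  (forall u v w, B (u + v) w = B u w + B v w) -> (forall u v w, B w (u + v) = B w u + B w v) ->
  (forall a u w, B (a *: u) w = a *: B u w) -> (forall a u w, B w (a *: u) = a *: B w u) ->
  forall (U1 U2 U3 V1 V2 V3 : V) (p1 p2 p3 q1 q2 q3 : F)
    (Z1 Z2 Z3 X12 X13 X21 X23 X31 X32 : W),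
  B U1 V1 = 0 *: Z1 -> B U2 V2 = 0 *: Z2 -> B U3 V3 = 0 *: Z3 ->
  B U1 V2 = X12 -> B U1 V3 = X13 -> B U2 V1 = X21 ->
  B U2 V3 = X23 -> B U3 V1 = X31 -> B U3 V2 = X32 ->
  B (2^-1 *: (p1 *: U1 + p2 *: U2 + p3 *: U3)) (2^-1 *: (q1 *: V1 + q2 *: V2 + q3 *: V3)) =
  4^-1 *: ((p1 * q2) *: X12 + (p1 * q3) *: X13 + (p2 * q1) *: X21 + (p2 * q3) *: X23 +
           (p3 * q1) *: X31 + (p3 * q2) *: X32).
Proof.
move=> Dl Dr Zl Zr U1 U2 U3 V1 V2 V3 p1 p2 p3 q1 q2 q3 Z1 Z2 Z3 ? ? ? ? ? ? h1 h2 h3 <- <- <- <- <- <-.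
rewrite Zl Zr scalerA (_ : 2^-1 * 2^-1 = 4^-1 :> F); last by field.
apply: (f_equal (fun t => _ *: t)).
rewrite !Dl !Dr !Zl !Zr h1 h2 h3 !scale0r !scaler0 !scalerA.
by rewrite add0r !addr0 !addrA.
Qed.

Lemma scale_sum3 (V : lmodType F) (k b c d : F) (u v w : V) :
  k *: (b *: u + c *: v + d *: w) = (k * b) *: u + (k * c) *: v + (k * d) *: w.
Proof. by rewrite !scalerDr !scalerA. Qed.

Lemma YB_combination (n : nat) (k : F) (T1 T2 T3 T4 T5 T6 : 'M[F]_n)
    (p1 p2 p3 q1 q2 q3 r1 r2 r3 : F) :
  p1 * q2 + q3 * r1 - p3 * r2 = 0 -> p2 * q1 + q3 * r2 - p3 * r1 = 0 ->
  p1 * q3 + q2 * r1 - p2 * r3 = 0 -> p3 * q1 + q2 * r3 - p2 * r1 = 0 ->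
  p2 * q3 + q1 * r2 - p1 * r3 = 0 -> p3 * q2 + q1 * r3 - p1 * r2 = 0 ->
  4^-1 *: ((p1 * q2) *: (k *: T3) + (p1 * q3) *: (- k *: T4) + (p2 * q1) *: (- k *: T5) +
    (p2 * q3) *: (k *: T1) + (p3 * q1) *: (k *: T2) + (p3 * q2) *: (- k *: T6)) +
  4^-1 *: ((q1 * r2) *: (k *: T1) + (q1 * r3) *: (- k *: T6) + (q2 * r1) *: (- k *: T4) +
    (q2 * r3) *: (k *: T2) + (q3 * r1) *: (k *: T3) + (q3 * r2) *: (- k *: T5)) +
  4^-1 *: ((p1 * r2) *: (k *: T6) + (p1 * r3) *: (- k *: T1) + (p2 * r1) *: (- k *: T2) +
    (p2 * r3) *: (k *: T4) + (p3 * r1) *: (k *: T5) + (p3 * r2) *: (- k *: T3)) = 0.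
Proof.
move=> h1 h2 h3 h4 h5 h6; apply/matrixP => i j; rewrite !mxE.
transitivity (4^-1 * k * ((p1 * q2 + q3 * r1 - p3 * r2) * T3 i j
  - (p2 * q1 + q3 * r2 - p3 * r1) * T5 i j - (p1 * q3 + q2 * r1 - p2 * r3) * T4 i j
  + (p3 * q1 + q2 * r3 - p2 * r1) * T2 i j + (p2 * q3 + q1 * r2 - p1 * r3) * T1 i j
  - (p3 * q2 + q1 * r3 - p1 * r2) * T6 i j)); first by ring.
by rewrite h1 h2 h3 h4 h5 h6; ring.
Qed.

End abstract_combinations.

Section tensor_algebra.
Variable R : realType.
Notation C := (Cx R).
Local Notation h := (h_mx R).
Local Notation g := (gamma_mx R).
Local Notation s := (sigma_mx R).
Local Notation I := (iC R).

Lemma tensmxDl m n p q (A B : 'M[C]_(m, n)) (D : 'M[C]_(p, q)) : (A + B) *t D = A *t D + B *t D.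
Proof. by apply/matrixP => i j; rewrite !mxE mulrDl. Qed.

Lemma tensmxDr m n p q (A B : 'M[C]_(m, n)) (D : 'M[C]_(p, q)) : D *t (A + B) = D *t A + D *t B.
Proof. by apply/matrixP => i j; rewrite !mxE mulrDr. Qed.

Lemma tensmxZl m n p q a (A : 'M[C]_(m, n)) (D : 'M[C]_(p, q)) : (a *: A) *t D = a *: (A *t D).
Proof. by apply/matrixP => i j; rewrite !mxE mulrA. Qed.

Lemma tensmxZr m n p q a (A : 'M[C]_(m, n)) (D : 'M[C]_(p, q)) : D *t (a *: A) = a *: (D *t A).
Proof. by apply/matrixP => i j; rewrite !mxE mulrCA. Qed.

Lemma tens_ext (A B : 'M[C]_(2 * 2)) :
  (forall i k j l, A (mxtens_index (i, k)) (mxtens_index (j, l)) =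
                   B (mxtens_index (i, k)) (mxtens_index (j, l))) -> A = B.
Proof.
move=> AB; apply/matrixP => p q.
by case: (mxtens_indexP p) => i k; case: (mxtens_indexP q) => j l.
Qed.

Section lifts.
Variables (V : lmodType C) (f : 'M[C]_2 -> 'M[C]_2 -> V).

Lemma tensor_liftD t u : tensor_lift f (t + u) = tensor_lift f t + tensor_lift f u.
Proof.
rewrite /tensor_lift; do 4!(rewrite -big_split; apply: eq_bigr => ? _) => /=.
by rewrite mxE scalerDl.
Qed.

Lemma tensor_liftZ a t : tensor_lift f (a *: t) = a *: tensor_lift f t.
Proof.
rewrite /tensor_lift; do 4!(rewrite scaler_sumr; apply: eq_bigr => ? _).
by rewrite mxE scalerA.
Qed.

Lemma tensor_lift_sum3 k b c d t1 t2 t3 :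
  tensor_lift f (k *: (b *: t1 + c *: t2 + d *: t3)) =
  k *: (b *: tensor_lift f t1 + c *: tensor_lift f t2 + d *: tensor_lift f t3).
Proof. by rewrite tensor_liftZ !tensor_liftD !tensor_liftZ. Qed.

Lemma mx_linear_sum (G : 'M[C]_2 -> V) (A : 'M[C]_2) :
  (forall a u v, G (a *: u + v) = a *: G u + G v) ->
  G A = \sum_(i < 2) \sum_(j < 2) A i j *: G (delta_mx i j).
Proof.
move=> GL; have G0 : G 0 = 0.
  by have := GL (-1) 0 0; rewrite scaler0 addr0 scaleN1r addNr.
have GD u v : G (u + v) = G u + G v by rewrite -{1}(scale1r u) GL scale1r.
rewrite {1}(matrix_sum_delta A) (big_morph G GD G0); apply: eq_bigr => i _.
rewrite (big_morph G GD G0); apply: eq_bigr => j _.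
by rewrite -[X in G X]addr0 GL G0 addr0.
Qed.

(** The universal property of the tensor product. *)
Lemma tensor_lift_tens (a b : 'M[C]_2) :
  (forall c d u v, f (c *: u + v) d = c *: f u d + f v d) ->
  (forall c d u v, f d (c *: u + v) = c *: f d u + f d v) ->
  tensor_lift f (a *t b) = f a b.
Proof.
move=> fl fr; rewrite (mx_linear_sum (G := f^~ b) a (fun c u v => fl c b u v)).
rewrite /tensor_lift; apply: eq_bigr => i _; apply: eq_bigr => j _.
rewrite (mx_linear_sum b (fun c u v => fr c _ u v)) scaler_sumr; apply: eq_bigr => k _.
rewrite scaler_sumr; apply: eq_bigr => l _.
by rewrite tensmxE scalerA.
Qed.

End lifts.

Lemma pr_sl2_linear a (u v : 'M[C]_2) : pr_sl2 (a *: u + v) = a *: pr_sl2 u + pr_sl2 v.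
Proof.
rewrite /pr_sl2 mxtraceD mxtraceZ; apply/matrixP => i j; rewrite !mxE.
by case: (i == j); rewrite ?mulr1n ?mulr0n; ring.
Qed.

Lemma pr_tensor_tens (a b : 'M[C]_2) : pr_tensor (a *t b) = pr_sl2 a *t pr_sl2 b.
Proof.
apply: tensor_lift_tens => c d u v; rewrite pr_sl2_linear.
  by rewrite tensmxDl tensmxZl.
by rewrite tensmxDr tensmxZr.
Qed.

Lemma mxtrace2 (A : 'M[C]_2) : \tr A = A 0 0 + A 1 1.
Proof.
by rewrite /mxtrace big_ord_recl big_ord1 (_ : lift _ _ = 1)//; exact: val_inj.
Qed.

Lemma pr_sl2_1 : pr_sl2 (1%:M : 'M[C]_2) = 0.
Proof.
rewrite /pr_sl2 mxtrace_scalar (_ : 1 *+ 2 / 2 = 1 :> C) ?subrr//.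
by rewrite -[1 *+ 2]/(2%:R) divff// pnatr_eq0.
Qed.

Lemma pr_sl2_traceless (A : 'M[C]_2) : A 0 0 + A 1 1 = 0 -> pr_sl2 A = A.
Proof. by move=> A0; rewrite /pr_sl2 mxtrace2 A0 mul0r raddf0 subr0. Qed.

Lemma pr_pauli : (pr_sl2 h = h) * (pr_sl2 g = g) * (pr_sl2 s = s).
Proof.
by rewrite !pr_sl2_traceless// /h_mx /gamma_mx /sigma_mx !mx2E ?subrr ?addr0.
Qed.

Definition pauli3 (b c d : C) : 'M[C]_(2 * 2) :=
  2^-1 *: (b *: (h *t h) + c *: (g *t g) + d *: (s *t s)).

Definition pauli4 (a b c d : C) : 'M[C]_(2 * 2) :=
  (2^-1 * a) *: (1%:M *t 1%:M) + pauli3 b c d.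

Lemma pr_tensor_pauli4 a b c d : pr_tensor (pauli4 a b c d) = pauli3 b c d.
Proof.
rewrite /pauli4 /pr_tensor tensor_liftD tensor_liftZ tensor_lift_sum3.
have lin := pr_tensor_tens; rewrite /pr_tensor in lin.
rewrite (lin 1%:M 1%:M) (lin h h) (lin g g) (lin s s) !pr_pauli.
by rewrite pr_sl2_1 tens0mx scaler0 add0r.
Qed.

Lemma leg12_tens (a b : 'M[C]_2) : leg12 (a *t b) = a *t b *t (1%:M : 'M[C]_2).
Proof.
apply: tensor_lift_tens => c d u v; first by rewrite !(tensmxDl, tensmxZl).
by rewrite !(tensmxDr, tensmxZr) !(tensmxDl, tensmxZl).
Qed.

Lemma leg13_tens (a b : 'M[C]_2) : leg13 (a *t b) = a *t (1%:M : 'M[C]_2) *t b.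
Proof.
apply: tensor_lift_tens => c d u v; first by rewrite !(tensmxDl, tensmxZl).
by rewrite !(tensmxDr, tensmxZr).
Qed.

Lemma leg23_tens (a b : 'M[C]_2) : leg23 (a *t b) = (1%:M : 'M[C]_2) *t a *t b.
Proof.
apply: tensor_lift_tens => c d u v.
  by rewrite !(tensmxDr, tensmxZr) !(tensmxDl, tensmxZl).
by rewrite !(tensmxDr, tensmxZr).
Qed.

Lemma bracketDl n (A B D : 'M[C]_n) : bracket (A + B) D = bracket A D + bracket B D.
Proof. by rewrite /bracket mulmxDl mulmxDr opprD addrACA. Qed.
Lemma bracketDr n (A B D : 'M[C]_n) : bracket D (A + B) = bracket D A + bracket D B.
Proof. by rewrite /bracket mulmxDl mulmxDr opprD addrACA. Qed.
Lemma bracketZl n a (A B : 'M[C]_n) : bracket (a *: A) B = a *: bracket A B.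
Proof. by rewrite /bracket -scalemxAl -scalemxAr scalerBr. Qed.
Lemma bracketZr n a (A B : 'M[C]_n) : bracket B (a *: A) = a *: bracket B A.
Proof. by rewrite /bracket -scalemxAl -scalemxAr scalerBr. Qed.

Lemma tensmxBl m n p q (A B : 'M[C]_(m, n)) (D : 'M[C]_(p, q)) : (A - B) *t D = A *t D - B *t D.
Proof. by rewrite -scaleN1r tensmxDl tensmxZl scaleN1r. Qed.
Lemma tensmxBr m n p q (A B : 'M[C]_(m, n)) (D : 'M[C]_(p, q)) : D *t (A - B) = D *t A - D *t B.
Proof. by rewrite -scaleN1r tensmxDr tensmxZr scaleN1r. Qed.

Lemma bracket12_13 (k : C) (a b c d m : 'M[C]_2) : bracket a c = k *: m ->
  bracket (a *t b *t (1%:M : 'M[C]_2)) (c *t (1%:M : 'M[C]_2) *t d) = k *: (m *t b *t d).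
Proof.
move=> acE; rewrite /bracket !tensmx_mul !mulmx1 !mul1mx -!tensmxBl -/(bracket a c) acE.
by rewrite !tensmxZl.
Qed.

Lemma bracket13_23 (k : C) (a b c d m : 'M[C]_2) : bracket b d = k *: m ->
  bracket (a *t (1%:M : 'M[C]_2) *t b) ((1%:M : 'M[C]_2) *t c *t d) = k *: (a *t c *t m).
Proof.
move=> bdE; rewrite /bracket !tensmx_mul !mulmx1 !mul1mx -tensmxBr -/(bracket b d) bdE.
by rewrite tensmxZr.
Qed.

Lemma bracket12_23 (k : C) (a b c d m : 'M[C]_2) : bracket b c = k *: m ->
  bracket (a *t b *t (1%:M : 'M[C]_2)) ((1%:M : 'M[C]_2) *t c *t d) = k *: (a *t m *t d).
Proof.
move=> bcE; rewrite /bracket !tensmx_mul !mulmx1 !mul1mx -tensmxBl -tensmxBr -/(bracket b c) bcE.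
by rewrite tensmxZr tensmxZl.
Qed.

Lemma bracketC n (A B : 'M[C]_n) : bracket B A = - bracket A B.
Proof. by rewrite /bracket opprB. Qed.

Lemma bracket2E (A B : 'M[C]_2) i j : bracket A B i j =
  A i 0 * B 0 j + A i 1 * B 1 j - (B i 0 * A 0 j + B i 1 * A 1 j).
Proof. by rewrite -!mulmx2E /bracket !mxE. Qed.

Lemma bracket_pauli : [/\ bracket h g = (2 * I) *: s, bracket g s = (2 * I) *: h
  & bracket s h = (2 * I) *: g].
Proof.
have i2 : 2 * I * I = - 2 by rewrite -mulrA iC2 mulrN1.
split; apply: mx2P; rewrite scalemx2E bracket2E !mx2E; do ?ring.
- by rewrite (mulrN _ I) i2; ring.
- by rewrite i2; ring.
Qed.

Lemma legs_pauli3 b c d :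
  [/\ leg12 (pauli3 b c d) = 2^-1 *: (b *: (h *t h *t (1%:M : 'M[C]_2)) +
        c *: (g *t g *t (1%:M : 'M[C]_2)) + d *: (s *t s *t (1%:M : 'M[C]_2))),
      leg13 (pauli3 b c d) = 2^-1 *: (b *: (h *t (1%:M : 'M[C]_2) *t h) +
        c *: (g *t (1%:M : 'M[C]_2) *t g) + d *: (s *t (1%:M : 'M[C]_2) *t s))
    & leg23 (pauli3 b c d) = 2^-1 *: (b *: ((1%:M : 'M[C]_2) *t h *t h) +
        c *: ((1%:M : 'M[C]_2) *t g *t g) + d *: ((1%:M : 'M[C]_2) *t s *t s))].
Proof.
split; apply: (etrans (tensor_lift_sum3 _ _ _ _ _ _ _ _)).
- by rewrite -/(leg12 (h *t h)) -/(leg12 (g *t g)) -/(leg12 (s *t s)) !leg12_tens.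
- by rewrite -/(leg13 (h *t h)) -/(leg13 (g *t g)) -/(leg13 (s *t s)) !leg13_tens.
- by rewrite -/(leg23 (h *t h)) -/(leg23 (g *t g)) -/(leg23 (s *t s)) !leg23_tens.
Qed.

(** The commutators of the Pauli matrices leave six tensors, all products of the
    three matrices in some order; the hypotheses are their coefficients, up to a
    common factor and signs. *)
Lemma pauli3_YB (p1 p2 p3 q1 q2 q3 r1 r2 r3 : C) :
  p1 * q2 + q3 * r1 - p3 * r2 = 0 -> p2 * q1 + q3 * r2 - p3 * r1 = 0 ->
  p1 * q3 + q2 * r1 - p2 * r3 = 0 -> p3 * q1 + q2 * r3 - p2 * r1 = 0 ->
  p2 * q3 + q1 * r2 - p1 * r3 = 0 -> p3 * q2 + q1 * r3 - p1 * r2 = 0 ->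
  bracket (leg12 (pauli3 p1 p2 p3)) (leg13 (pauli3 q1 q2 q3)) +
  bracket (leg13 (pauli3 q1 q2 q3)) (leg23 (pauli3 r1 r2 r3)) +
  bracket (leg12 (pauli3 p1 p2 p3)) (leg23 (pauli3 r1 r2 r3)) = 0.
Proof.
move=> h1 h2 h3 h4 h5 h6.
have [l12 l13 _] := legs_pauli3 p1 p2 p3.
have [_ m13 _] := legs_pauli3 q1 q2 q3.
have [_ _ n23] := legs_pauli3 r1 r2 r3.
have [hg gs sh] := bracket_pauli.
have gh : bracket g h = - (2 * I) *: s by rewrite bracketC hg scaleNr.
have sg : bracket s g = - (2 * I) *: h by rewrite bracketC gs scaleNr.
have hs : bracket h s = - (2 * I) *: g by rewrite bracketC sh scaleNr.
have self (A : 'M[C]_2) : bracket A A = 0 *: A by rewrite /bracket subrr scale0r.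
have sum3 := @bilinear_sum3 C _ _ (@bracket R (2 * 2 * 2)) (@bracketDl _) (@bracketDr _)
  (@bracketZl _) (@bracketZr _).
have e1 := sum3 _ _ _ _ _ _ p1 p2 p3 q1 q2 q3 _ _ _ _ _ _ _ _ _
  (bracket12_13 _ _ (self h)) (bracket12_13 _ _ (self g)) (bracket12_13 _ _ (self s))
  (bracket12_13 h g hg) (bracket12_13 h s hs) (bracket12_13 g h gh)
  (bracket12_13 g s gs) (bracket12_13 s h sh) (bracket12_13 s g sg).
have e2 := sum3 _ _ _ _ _ _ q1 q2 q3 r1 r2 r3 _ _ _ _ _ _ _ _ _
  (bracket13_23 _ _ (self h)) (bracket13_23 _ _ (self g)) (bracket13_23 _ _ (self s))
  (bracket13_23 h g hg) (bracket13_23 h s hs) (bracket13_23 g h gh)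
  (bracket13_23 g s gs) (bracket13_23 s h sh) (bracket13_23 s g sg).
have e3 := sum3 _ _ _ _ _ _ p1 p2 p3 r1 r2 r3 _ _ _ _ _ _ _ _ _
  (bracket12_23 _ _ (self h)) (bracket12_23 _ _ (self g)) (bracket12_23 _ _ (self s))
  (bracket12_23 h g hg) (bracket12_23 h s hs) (bracket12_23 g h gh)
  (bracket12_23 g s gs) (bracket12_23 s h sh) (bracket12_23 s g sg).
pose br := @bracket R (2 * 2 * 2); pose add (u v : 'M[C]_(2 * 2 * 2)) := u + v.
have {}e1 := etrans (f_equal2 br l12 m13) e1.
have {}e2 := etrans (f_equal2 br m13 n23) e2.
have {}e3 := etrans (f_equal2 br l12 n23) e3.
apply: (etrans (f_equal2 add (f_equal2 add e1 e2) e3)).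
exact: YB_combination.
Qed.

End tensor_algebra.

(** * The geometric tensor *)

Section gauged_tensor.
Variable R : realType.
Notation C := (Cx R).

Lemma diag_conjE (a d a' d' : C) (A : 'M[C]_2) i j :
  (mx2 a 0 0 d *m A *m mx2 a' 0 0 d') i j = mx2 a 0 0 d i i * A i j * mx2 a' 0 0 d' j j.
Proof.
by rewrite !mulmx2E; move: i; apply: I2P; move: j; apply: I2P; rewrite !mx2E; ring.
Qed.

Lemma invmx_diag (a d : C) : a != 0 -> d != 0 -> invmx (mx2 a 0 0 d) = mx2 a^-1 0 0 d^-1.
Proof.
move=> a0 d0; have AB : mx2 a 0 0 d *m mx2 a^-1 0 0 d^-1 = 1%:M.
  apply: mx2P; rewrite mulmx2E !mx2E mxE /= ?mulr1n ?mulr0n; try ring.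
    by rewrite divff// mulr0 addr0.
  by rewrite divff// mulr0 add0r.
have [Au _] := mulmx1_unit AB.
by rewrite -[RHS](mulKmx Au) AB mulmx1.
Qed.

(** Conjugation by diagonal matrices rescales the coefficients. *)
Lemma gauged_sum (f : 'M[C]_2 -> 'M[C]_2) (a d b c : C) i k j l :
  a != 0 -> d != 0 -> b != 0 -> c != 0 ->
  ((mx2 a 0 0 d *t mx2 b 0 0 c) *m tensor_of f *m
     (invmx (mx2 a 0 0 d) *t invmx (mx2 b 0 0 c))) (mxtens_index (i, k)) (mxtens_index (j, l)) =
  mx2 a 0 0 d i i * mx2 a^-1 0 0 d^-1 j j *
    (mx2 b 0 0 c k k * f (delta_mx j i) k l * mx2 b^-1 0 0 c^-1 l l).
Proof.
move=> a0 d0 b0 c0; rewrite !invmx_diag//.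
have dE (p q : 'I_2) : (delta_mx q p : 'M[C]_2) i j = ((i == q) && (j == p))%:R by rewrite mxE.
rewrite /tensor_of mulmx_sumr mulmx_suml summxE (bigD1 j)//= [X in _ + X]big1; last first.
  move=> p pj; rewrite mulmx_sumr mulmx_suml summxE big1// => q _.
  rewrite !tensmx_mul tensmxE !diag_conjE dE (eq_sym j) (negbTE pj) andbF /=; ring.
rewrite addr0 mulmx_sumr mulmx_suml summxE (bigD1 i)//= [X in _ + X]big1; last first.
  move=> q qi; rewrite !tensmx_mul tensmxE !diag_conjE dE (eq_sym i) (negbTE qi) /=; ring.
by rewrite addr0 !tensmx_mul tensmxE !diag_conjE dE !eqxx /=; ring.
Qed.

Variable tau : C.
Hypothesis tau_im : 0 < complex.Im tau.
Local Notation e := (@epi R).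

Lemma of_components_delta (k : bool -> bool -> C) (y1 y2 : C) :
  let T A := of_components tau (fun j i => component tau j i A y1 * k j i) y2 in
  [/\ T (delta_mx 0 0) =
        mx2 ((k false false + k false true) / 2) 0 0 ((k false false - k false true) / 2),
      T (delta_mx 1 1) =
        mx2 ((k false false - k false true) / 2) 0 0 ((k false false + k false true) / 2),
      T (delta_mx 0 1) =
        mx2 0 (e y2 * e (- y1) * (k true false + k true true) / 2)
          (e (- (y2 + tau)) * e (- y1) * (k true false - k true true) / 2) 0
    & T (delta_mx 1 0) =
        mx2 0 (e y2 * e (y1 + tau) * (k true false - k true true) / 2)
          (e (- (y2 + tau)) * e (y1 + tau) * (k true false + k true true) / 2) 0].
Proof.
have dE (p q i j : 'I_2) : (delta_mx p q : 'M[C]_2) i j = ((i == p) && (j == q))%:R by rewrite mxE.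
rewrite /of_components /component !dE /=.
move: (e (- y1)) (e (y1 + tau)) (e y2) (e (- (y2 + tau))) => a b c d.
move: (k false false) (k false true) (k true false) (k true true) => k0 k1 k2 k3.
by split; apply: mx2P; rewrite !mx2E; ring.
Qed.

Lemma sigma_tens : sigma_mx R *t sigma_mx R = - (mx2 0 (-1) 1 0 *t mx2 0 (-1) 1 0).
Proof.
have -> : sigma_mx R = iC R *: mx2 0 (-1) 1 0 by apply: mx2P; rewrite scalemx2E !mx2E; ring.
by rewrite tensmxZl tensmxZr scalerA iC2 scaleN1r.
Qed.

Lemma pauli4E (a b c d : C) i k j l :
  pauli4 a b c d (mxtens_index (i, k)) (mxtens_index (j, l)) =
  2^-1 * (a * ((i == j)%:R * (k == l)%:R) + b * (h_mx R i j * h_mx R k l) +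
    c * (gamma_mx R i j * gamma_mx R k l) - d * (mx2 0 (-1) 1 0 i j * mx2 0 (-1) 1 0 k l)).
Proof.
rewrite /pauli4 /pauli3 sigma_tens.
have E (A B : 'M[C]_(2 * 2)) p q : (A + B) p q = A p q + B p q by rewrite mxE.
have N (A : 'M[C]_(2 * 2)) p q : (- A) p q = - A p q by rewrite mxE.
have Z u (A : 'M[C]_(2 * 2)) p q : (u *: A) p q = u * A p q by rewrite mxE.
rewrite !(E, Z, N) !tensmxE.
have D p q : (1%:M : 'M[C]_2) p q = (p == q)%:R by rewrite mxE.
by rewrite !D; ring.
Qed.

(** The exponentials in the off-diagonal components are exactly those that the
    gauge transformation removes; what remains depends on differences only. *)
Lemma r_gaugedE (x1 x2 y1 y2 : C) : ~ lattice tau (x2 - x1) ->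
  r_gauged tau x1 x2 y1 y2 =
  pauli4 (kern tau (x2 - x1) false false (y2 - y1)) (kern tau (x2 - x1) false true (y2 - y1))
    (kern tau (x2 - x1) true false (y2 - y1)) (kern tau (x2 - x1) true true (y2 - y1)).
Proof.
move=> xl; pose k j i := kern tau (x2 - x1) j i (y2 - y1).
have [f00 f11 f01 f10] := of_components_delta k y1 y2.
have fE A : r_tilde tau x1 x2 y1 y2 A = hom_section tau (x2 - x1) y1 A y2 by exact: r_tildeE.
have gE y : gauge_mx tau y = mx2 (e y)^-1 0 0 (e (tau / 2)).
  by rewrite /gauge_mx expCN -(mulrA _ tau).
have n1 : e y1 != 0 := expC_neq0 _; have n2 : e y2 != 0 := expC_neq0 _.
have n3 : e (tau / 2) != 0 := expC_neq0 _.
have t1 : e (y1 + tau) = e y1 * e (tau / 2) ^+ 2.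
  by rewrite (eD y1) expr2 -(eD (tau / 2)); apply: (f_equal (fun u => _ * e u)); field.
have t2 : e (- (y2 + tau)) = (e y2 * e (tau / 2) ^+ 2)^-1.
  rewrite /epi mulrN expCN -/(epi (y2 + tau)); apply: (f_equal (@GRing.inv C)).
  by rewrite (eD y2) expr2 -(eD (tau / 2)); apply: (f_equal (fun u => _ * e u)); field.
have t3 : e (- y1) = (e y1)^-1 by rewrite /epi mulrN expCN.
apply: tens_ext => i k' j l; rewrite /r_gauged !gE gauged_sum ?invr_eq0// pauli4E.
rewrite !invrK fE /hom_section.
move: f00 f11 f01 f10; rewrite t1 t2 t3 -/(k false false) -/(k false true) -/(k true false) -/(k true true).
move: (k false false) (k false true) (k true false) (k true true) => k0 k1 k2 k3 f00 f11 f01 f10.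
by move: i; apply: I2P; move: j; apply: I2P; rewrite ?f00 ?f11 ?f01 ?f10;
  move: k'; apply: I2P; move: l; apply: I2P; rewrite !mx2E /=; field; rewrite ?n1 ?n2 ?n3.
Qed.

Lemma r_matrixE (x y : C) : ~ lattice tau x ->
  r_matrix tau x y = pauli4 (kern tau x false false y) (kern tau x false true y)
    (kern tau x true false y) (kern tau x true true y).
Proof. by move=> xl; rewrite /r_matrix r_gaugedE !subr0. Qed.

End gauged_tensor.

(** * The classical limit *)

Section classical_limit.
Variable R : realType.
Notation C := (Cx R).
Variable tau : C.
Hypothesis tau_im : 0 < complex.Im tau.
Local Notation e := (@epi R).

Definition kron_h : C -> C := kron tau false (1 / 2).
Definition kron_gamma : C -> C := kron tau true 0.
Definition kron_sigma : C -> C := kron tau true (1 / 2).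

Lemma Nhalftau_off_lattice : ~ lattice tau (0 - tau / 2).
Proof. by rewrite sub0r => /latticeN; rewrite opprK; exact: halftau_off_lattice. Qed.

Lemma halfdiff_off_lattice : ~ lattice tau (1 / 2 - tau / 2).
Proof.
apply: (off_lattice_eq _ (halfsum_off_lattice tau_im)); right.
have -> : 1 / 2 - tau / 2 + (1 / 2 + tau / 2) = 1 by field.
exact: lattice1.
Qed.

Lemma kron_h_spec : kernel_spec tau 1 (-1) kron_h.
Proof.
have := @kron_spec _ _ tau_im false (1 / 2); rewrite subr0 e_Nhalf sqrrN expr2 iC2.
by apply; exact: half_off_lattice.
Qed.

Lemma kron_gamma_spec : kernel_spec tau (-1) 1 kron_gamma.
Proof.
have := @kron_spec _ _ tau_im true 0; rewrite expr1 oppr0 /epi mulr0 expC0 expr1n.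
by apply; exact: Nhalftau_off_lattice.
Qed.

Lemma kron_sigma_spec : kernel_spec tau (-1) (-1) kron_sigma.
Proof.
have := @kron_spec _ _ tau_im true (1 / 2); rewrite expr1 e_Nhalf sqrrN expr2 iC2.
by apply; exact: halfdiff_off_lattice.
Qed.

Lemma kron_h_odd z : kron_h (- z) = - kron_h z.
Proof. by rewrite /kron_h !kron_half// theta2_even// theta1_odd// mulrN invrN mulrN. Qed.

Lemma kron_gamma_odd z : kron_gamma (- z) = - kron_gamma z.
Proof. by rewrite /kron_gamma !kron_halftau// theta4_even// theta1_odd// mulrN invrN mulrN. Qed.

Lemma kron_sigma_odd z : kron_sigma (- z) = - kron_sigma z.
Proof. by rewrite /kron_sigma !kron_halfsum// theta3_even// theta1_odd// mulrN invrN mulrN. Qed.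

(** The left side is, as a function of [x], a section with the character of
    [wc]; its residues vanish at 0, where those of [wa] and [wc] cancel, and at
    [- y], because [wa] is odd. Hence it is 0. *)
Lemma three_term (sa ma sb mb sc mc : C) (wa wb wc : C -> C) (x y : C) :
  sc != 0 -> mc != 0 -> sc = sa * sb -> mc = ma * mb ->
  kernel_spec tau sa ma wa -> kernel_spec tau sb mb wb -> kernel_spec tau sc mc wc ->
  (forall z, wa (- z) = - wa z) ->
  ~ lattice tau x -> ~ lattice tau y -> ~ lattice tau (x + y) ->
  wa x * wb (x + y) + wc (x + y) * wa y - wc x * wb y = 0.
Proof.
move=> s0 m0 sE mE Ka Kb Kc odd_a xl yl xyl.
have [a1 at_ _ ad [ga [ra ra0 [ga0 gad gaE]]]] := Ka.
have [b1 bt _ bd [gb [rb rb0 [gb0 gbd gbE]]]] := Kb.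
have [c1 ct _ cd [gc [rc rc0 [gc0 gcd gcE]]]] := Kc.
pose f z := wa z * wb (z + y) + wc (z + y) * wa y - wc z * wb y.
have f1 z : f (z + 1) = sc * f z.
  by rewrite /f (addrAC z 1) a1 b1 !c1 sE; ring.
have ft z : f (z + tau) = mc * f z.
  by rewrite /f (addrAC z tau) at_ bt !ct mE; ring.
have sh (F : C -> C) z : derivable F (z + y) 1 -> derivable (fun v : C => F (v + y)) z 1.
  exact: derivable_shiftC.
have cst (k : C -> C) (a z : C) : derivable k z 1 -> derivable (fun v : C => k v * a) z 1.
  move=> kd; apply: derivable_mulC; first exact: kd.
  by apply/derivableCP; exists 0; exact: is_deriveC_cst.
have idd (b z : C) : derivable (fun v : C => v + b) z 1.
  have := is_derive_affine 1 b z => H; apply/derivableCP; exists 1.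
  by apply: is_derive_ext H => v; rewrite mul1r.
have fd z : ~ lattice tau z -> ~ lattice tau (z + y) -> derivable f z 1.
  move=> zl zyl; apply: derivable_subC; last by apply/cst/cd.
  apply: derivable_addC; last by apply/cst/sh/cd.
  by apply: derivable_mulC; [exact: ad|apply/sh/bd].
have f0 : removable f 0.
  pose N z := ga z * wb (z + y) + (z + 0) * (wc (z + y) * wa y) - gc z * wb y.
  apply: (@removable_near _ (fun z => N z / (z - 0))).
    apply/dnbhsCP; exists (Num.min ra rc); first by rewrite lt_min ra0.
    move=> w w0; rewrite subr0 lt_min => /andP[wra wrc].
    rewrite /N /f (gaE _ w0 wra) (gcE _ w0 wrc) addr0.
    by field.
  apply: quotient_removable; last by rewrite /N ga0 gc0 !addr0 mul0r add0r addr0 !mul1r subrr.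
  apply: derivable_subC; last by apply/cst/gcd; rewrite cabs0.
  apply: derivable_addC.
    apply: derivable_mulC; first by apply: gad; rewrite cabs0.
    by apply/sh/bd; rewrite add0r.
  apply: derivable_mulC; first exact: idd.
  by apply/cst/sh/cd; rewrite add0r.
have fy : removable f (- y).
  pose N z := wa z * gb (z + y) + gc (z + y) * wa y - (z + y) * (wc z * wb y).
  have nyl : ~ lattice tau (- y) by move=> /latticeN; rewrite opprK.
  apply: (@removable_near _ (fun z => N z / (z - - y))).
    apply/dnbhsCP; exists (Num.min rb rc); first by rewrite lt_min rb0.
    move=> w wy; rewrite opprK lt_min => /andP[wrb wrc].
    have w0 : w + y != 0 by rewrite addr_eq0.
    rewrite /N /f (gbE _ w0 wrb) (gcE _ w0 wrc).
    by field.
  apply: quotient_removable; last first.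
    by rewrite /N addNr gb0 gc0 odd_a mul0r subr0 mulr1 mul1r addNr.
  apply: derivable_subC.
    apply: derivable_addC; last by apply/cst/sh/gcd; rewrite addNr cabs0.
    by apply: derivable_mulC; [exact: ad|apply/sh/gbd; rewrite addNr cabs0].
  by apply: derivable_mulC; [exact: idd|apply/cst/cd].
have fr z : removable f z.
  have [zl|zl] := pselect (lattice tau z).
    by have := removable_translate s0 m0 f1 ft f0 zl; rewrite add0r.
  have [zyl|zyl] := pselect (lattice tau (z + y)); last exact/removable_derivable/fd.
  by have := removable_translate s0 m0 f1 ft fy zyl; rewrite addrC addrK.
have offP z : off_poles tau [:: 0; - y] z <-> ~ lattice tau z /\ ~ lattice tau (z + y).
  split=> [H|[h1 h2] p].
    split; first by have := H 0; rewrite subr0; apply; rewrite inE eqxx.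
    by have := H (- y); rewrite opprK; apply; rewrite !inE eqxx orbT.
  by rewrite !inE => /orP[/eqP->|/eqP->]; rewrite ?subr0 ?opprK.
have fd' z : off_poles tau [:: 0; - y] z -> derivable f z 1.
  by move=> /offP[]; exact: fd.
have xp : off_poles tau [:: 0; - y] x by exact/offP.
exact: (no_section tau_im s0 m0 Kc f1 ft fr fd' xp).
Qed.

Lemma pauli3_cvg (F : set_system C) (FF : Filter F) (b c d : C -> C) (b0 c0 d0 : C) :
  b @ F --> b0 -> c @ F --> c0 -> d @ F --> d0 ->
  (fun x => pauli3 (b x) (c x) (d x)) @ F --> pauli3 b0 c0 d0.
Proof.
move=> bl cl dl; apply: cvg_mx => i j.
have E u v w : pauli3 u v w i j = 2^-1 * (u * (h_mx R *t h_mx R) i j +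
    v * (gamma_mx R *t gamma_mx R) i j + w * (sigma_mx R *t sigma_mx R) i j).
  rewrite /pauli3; move: (h_mx R *t _) (gamma_mx R *t _) (sigma_mx R *t _) => A B D.
  by rewrite !mxE.
have H : (fun x => 2^-1 * (b x * (h_mx R *t h_mx R) i j +
    c x * (gamma_mx R *t gamma_mx R) i j + d x * (sigma_mx R *t sigma_mx R) i j)) @ F -->
    pauli3 b0 c0 d0 i j.
  rewrite E; apply: cvgC_mul; first exact: cvgC_cst.
  apply: cvgC_add; last by apply: cvgC_mul; [exact: dl|exact: cvgC_cst].
  by apply: cvgC_add; apply: cvgC_mul; [exact: bl|exact: cvgC_cst|exact: cl|exact: cvgC_cst].
by move: H; apply: cvg_trans; apply: near_eq_cvg; apply: nearW => x; rewrite E.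
Qed.

Lemma r_matrix_cvg (y : C) : ~ lattice tau y ->
  pr_tensor (r_matrix tau x y) @[x --> (0 : C)^'] --> pauli3 (kron_h y) (kron_gamma y) (kron_sigma y).
Proof.
move=> yl.
have hl : ~ lattice tau (1 / 2 - half_shift tau false).
  by rewrite subr0; exact: half_off_lattice.
have H := pauli3_cvg (dnbhs_filter _) (kron_cvg tau_im hl yl)
  (kron_cvg tau_im (j := true) Nhalftau_off_lattice yl)
  (kron_cvg tau_im (j := true) halfdiff_off_lattice yl).
apply: cvg_trans H; apply: near_eq_cvg.
apply: filterS (off_lattice_near tau_im 0 0) => x; rewrite subr0 => xl.
by rewrite r_matrixE// pr_tensor_pauli4.
Qed.

Lemma r_barE (y : C) : ~ lattice tau y -> r_bar tau y = pauli3 (kron_h y) (kron_gamma y) (kron_sigma y).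
Proof. by move=> yl; apply: cvg_lim (r_matrix_cvg yl); exact: mx_hausdorff. Qed.

Lemma r_bar_YB : classical_YB (lattice tau) (r_bar tau).
Proof.
move=> x y xl yl xyl; rewrite !r_barE//.
have n1 : (1 : C) != 0 by exact: oner_neq0.
have nN : (-1 : C) != 0 by rewrite oppr_eq0 oner_neq0.
have Kh := kron_h_spec; have Kg := kron_gamma_spec; have Ks := kron_sigma_spec.
have oh := kron_h_odd; have og := kron_gamma_odd; have os := kron_sigma_odd.
apply: pauli3_YB.
- by apply: (three_term _ _ _ _ Kh Kg Ks oh xl yl xyl) => //; rewrite ?mul1r ?mulr1.
- by apply: (three_term _ _ _ _ Kg Kh Ks og xl yl xyl) => //; rewrite ?mul1r ?mulr1.
- by apply: (three_term _ _ _ _ Kh Ks Kg oh xl yl xyl) => //; rewrite ?mul1r ?mulrNN ?mulr1.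
- by apply: (three_term _ _ _ _ Ks Kh Kg os xl yl xyl) => //; rewrite ?mulr1 ?mulrNN ?mulr1.
- by apply: (three_term _ _ _ _ Kg Ks Kh og xl yl xyl) => //; rewrite ?mul1r ?mulrNN ?mulr1.
- by apply: (three_term _ _ _ _ Ks Kg Kh os xl yl xyl) => //; rewrite ?mulrNN ?mulr1.
Qed.

(** The kernels are normalized by the residue 1 at 0, the quotients of elliptic
    functions are not; Jacobi's derivative formula gives the factor. *)
Lemma elliptic_rE (y : C) : ~ lattice tau y -> theta4 tau y != 0 ->
  (piC R * theta3 tau 0 ^+ 2) *: elliptic_r tau y = pauli3 (kron_h y) (kron_gamma y) (kron_sigma y).
Proof.
move=> yl t4y; have t1y := th_neq0 tau_im yl.
have t2 := theta2_0_neq0 tau_im; have t3 := theta3_0_neq0 tau_im; have t4 := theta4_0_neq0 tau_im.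
rewrite /elliptic_r /pauli3 scalerA (mulrC _ 2^-1) -(scalerA 2^-1); apply: (f_equal (fun t => _ *: t)).
have hE : piC R * theta3 tau 0 ^+ 2 * (cn tau y / sn tau y) = kron_h y.
  rewrite /kron_h kron_half// /cn /sn /theta1'0; by field; rewrite t1y t2 t3 t4y.
have gE : piC R * theta3 tau 0 ^+ 2 * (1 / sn tau y) = kron_gamma y.
  rewrite /kron_gamma kron_halftau// /sn /theta1'0; by field; rewrite t1y t2 t3 t4 t4y.
have sE : piC R * theta3 tau 0 ^+ 2 * (dn tau y / sn tau y) = kron_sigma y.
  rewrite /kron_sigma kron_halfsum// /dn /sn /theta1'0; by field; rewrite t1y t2 t3 t4y.
by rewrite scale_sum3 hE gE sE.
Qed.

Lemma elliptic_r_cvg (y : C) : ~ lattice tau y ->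
  (piC R * theta3 tau 0 ^+ 2) *: elliptic_r tau w @[w --> y^'] --> pauli3 (kron_h y) (kron_gamma y) (kron_sigma y).
Proof.
move=> yl.
have H := pauli3_cvg (dnbhs_filter _) (derivable_dcont (kernel_derivable kron_h_spec yl))
  (derivable_dcont (kernel_derivable kron_gamma_spec yl)) (derivable_dcont (kernel_derivable kron_sigma_spec yl)).
apply: cvg_trans H; apply: near_eq_cvg.
apply: filterS2 (off_lattice_near tau_im 0 y) (off_lattice_near tau_im (- (tau / 2)) y) => w.
rewrite subr0 opprK => wl w2.
by rewrite elliptic_rE//; exact: theta4_neq0.
Qed.

End classical_limit.

Theorem theorem8p19 (R : realType) (tau : Cx R) :
  0 < complex.Im tau ->
  [/\ forall x1 x2 y1 y2 : Cx R,
        ~ isomorphic_bundles tau x1 x2 -> ~ lattice tau (y2 - y1) ->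
        set_bij (hom_pole tau x1 x2 y1) setT (residue y1) /\
        r_gauged tau x1 x2 y1 y2 = r_matrix tau (x2 - x1) (y2 - y1),
      forall y : Cx R, ~ lattice tau y ->
        pr_tensor (r_matrix tau x y) @[x --> 0^'] --> r_bar tau y,
      classical_YB (lattice tau) (r_bar tau),
      forall y : Cx R, ~ lattice tau y -> theta4 tau y != 0 ->
        r_bar tau y = (piC R * theta3 tau 0 ^+ 2) *: elliptic_r tau y
    & forall y : Cx R, ~ lattice tau y ->
        (piC R * theta3 tau 0 ^+ 2) *: elliptic_r tau w @[w --> y^'] --> r_bar tau y].
Proof.
move=> tau_im; split.
- move=> x1 x2 y1 y2 niso _.
  have xl : ~ lattice tau (x2 - x1) by move=> /lattice_isomorphic.
  by split; [exact: residue_bij|rewrite r_gaugedE// r_matrixE].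
- by move=> y yl; rewrite r_barE//; exact: r_matrix_cvg.
- exact: r_bar_YB.
- by move=> y yl t4; rewrite r_barE// elliptic_rE.
- by move=> y yl; rewrite r_barE//; exact: elliptic_r_cvg.
Qed.
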